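(* Let $0<m<1$, assume (A1) and (A2), and let $u$ be a nonnegative weak dual solution (WDS) of (CDP) with initial datum $u_0\in L^{1+m}(\Omega)\cap H^*(\Omega)$. If there exists a (finite) extinction time $T>0$ and (K1) holds, then $$\|u(t)\|_{H^*(\Omega)}\le\mathsf c_1\,\mathcal Q^*[u_0]^{\frac1{1-m}}(T-t)^{\frac1{1-m}}\qquad\text{for every }0\le t<T,$$ with $\mathsf c_1=(1-m)^{\frac1{1-m}}$. In addition, if $m\in(m_s,1)$ with $m_s=\frac{N-2s}{N+2s}$, then the lower estimate also holds: $$\mathsf c_0(T-t)^{\frac1{1-m}}\le\|u(t)\|_{H^*(\Omega)}\le\mathsf c_1\,\mathcal Q^*[u_0]^{\frac1{1-m}}(T-t)^{\frac1{1-m}}\qquad\text{for every }0\le t<T,$$ with $\mathsf c_0>0$ depending on $m,s,N,\Omega$ and $\mathcal H_{\mathcal L}$.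
   Context: Setting: $\Omega\subset\mathbb R^N$ ($N\ge1$) is a bounded domain with smooth boundary (at least $C^{2,\alpha}$), $s\in(0,1]$, $N>2s$, and $u^m:=|u|^{m-1}u$. $\mathcal L:\mathrm{dom}(\mathcal L)\subseteq L^1(\Omega)\to L^1(\Omega)$ is a densely defined linear (possibly nonlocal) operator, self-adjoint and nonnegative on $L^2(\Omega)$. (A1): $\mathcal L$ is $m$-accretive in $L^1(\Omega)$. (A2): if $0\le f\le1$ then $0\le e^{-t\mathcal L}f\le1$ for all $t\ge0$. $\mathcal L$ has an inverse $\mathcal L^{-1}:L^1(\Omega)\to L^1(\Omega)$, $\mathcal L^{-1}f(x)=\int_\Omega G_\Omega(x,y)f(y)\,dy$. (K1): there is $c_{1,\Omega}>0$ with $0\le G_\Omega(x,y)\le c_{1,\Omega}|x-y|^{-(N-2s)}$ for a.e. $x,y\in\Omega$. Under (K1), $\mathcal L$ has a first eigenpair $(\lambda_1,\Phi_1)$ with $\lambda_1>0$, $0\le\Phi_1\in L^\infty(\Omega)$, $\|\Phi_1\|_2=1$. $H(\Omega)=\{u\in L^2(\Omega):\int_\Omega u\mathcal Lu\,dx<\infty\}$; $H^*(\Omega)$ is its dual, with norm $\|u\|_{H^*(\Omega)}^2=\int_\Omega u\,\mathcal L^{-1}u\,dx$. Under (K1) the Hardy–Littlewood–Sobolev inequality $\|f\|_{H^*(\Omega)}\le\mathcal H_{\mathcal L}\|f\|_{\frac{2N}{N+2s}}$ holds; this defines $\mathcal H_{\mathcal L}$. Dual nonlinear Rayleigh quotient: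 $\mathcal Q^*[f]=\dfrac{\|f\|_{1+m}^{1+m}}{\|f\|_{H^*(\Omega)}^{1+m}}=\dfrac{\int_\Omega|f|^{1+m}dx}{\left(\int_\Omega f\,\mathcal L^{-1}f\,dx\right)^{\frac{1+m}2}}$. $L^1_{\Phi_1}(\Omega)$ has norm $\|f\|_{L^1_{\Phi_1}(\Omega)}=\int_\Omega|f|\Phi_1dx$. (CDP): $\partial_tu=-\mathcal Lu^m$ on $(0,\infty)\times\Omega$, $u=0$ on the lateral boundary, $u(0,\cdot)=u_0$. Weak dual solution (WDS): for $T'>0$, $u\in C((0,T'):L^1_{\Phi_1}(\Omega))$ with $u^m\in L^1([0,T']:L^1_{\Phi_1}(\Omega))$ is a WDS of the equation if $\int_0^{T'}\int_\Omega\mathcal L^{-1}u\,\partial_t\psi\,dx\,dt=\int_0^{T'}\int_\Omega u^m\psi\,dx\,dt$ for all $\psi$ with $\psi/\Phi_1\in C^1_c((0,T'):L^\infty(\Omega))$; it is a WDS of (CDP) with initial datum $u_0\in L^1_{\Phi_1}(\Omega)$ if moreover $u\in C([0,T'):L^1_{\Phi_1}(\Omega))$ and $\|u(t)-u_0\|_{L^1_{\Phi_1}}\to0$ as $t\to0^+$. Extinction time: the smallest $T\ge0$ such that $u(t)=0$ a.e. in $\Omega$ for all $t\ge T$.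
   Formalization: The first eigenfunction Φ₁ is assumed positive a.e. in Ω, not merely nonnegative; this is needed for ‖·‖ on L¹_{Φ₁} to be a norm and for ψ/Φ₁ to make sense, and without it the claim fails for operators that decouple. *)

(* Defs.v *)
From HB Require Import structures.
From mathcomp Require Import all_boot all_order all_algebra.
From mathcomp Require Import all_classical all_reals all_analysis.

Set Implicit Arguments.
Unset Strict Implicit.
Unset Printing Implicit Defensive.

Import Order.TTheory GRing.Theory Num.Theory.
Import numFieldNormedType.Exports.

Local Open Scope classical_set_scope.
Local Open Scope ring_scope.

Section rV_measurable.
Context (R : realType) (n : nat).

HB.instance Definition _ := @isMeasurable.Build
  (sigma_display (@open 'rV[R]_n)) 'rV[R]_n <<s @open 'rV[R]_n >>
  (@sigma_algebra0 _ setT (@open 'rV[R]_n)) (@sigma_algebraC _ (@open 'rV[R]_n))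
  (@sigma_algebra_bigcup _ setT (@open 'rV[R]_n)).

Lemma open_measurable_rV (U : set 'rV[R]_n) : open U -> measurable U.
Proof. exact: sub_sigma_algebra. Qed.

Lemma continuous_measurable_rV (f : 'rV[R]_n -> R) :
  continuous f -> measurable_fun setT f.
Proof.
move=> /continuousP cf.
apply: (measurability _ (measurable_realfun.RGenOpens.measurableE R)).
move=> _ [_ [a [b ->] <-]]; rewrite setTI.
by apply: open_measurable_rV; apply: cf; exact: interval_open.
Qed.

Lemma measurable_fun_rV d (T : measurableType d) (f : T -> 'rV[R]_n) :
  (forall i, measurable_fun setT (fun x => f x ord0 i)) ->
  measurable_fun setT f.
Proof.
move=> mf; apply: (measurability (@open 'rV[R]_n)) => // _ [U oU <-].
rewrite setTI.
pose B (q : 'rV[rat]_n * rat) : set 'rV[R]_n :=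
  [set y | forall i, ball (ratr (q.1 ord0 i) : R) (ratr q.2) (y ord0 i)].
have -> : f @^-1` U =
    \bigcup_q (if `[< B q `<=` U >] then f @^-1` (B q) else set0).
  apply/seteqP; split=> x /=; last first.
    by move=> [q _]; case: asboolP => // BU; exact: BU.
  move=> Ux; have /nbhs_ballP[e /= e0 eU] : nbhs (f x) U.
    exact: open_nbhs_nbhs.
  have [r r_e] : exists r, (ratr r : R) \in `]0, (e / 2)[%R.
    by apply: rat_in_itvoo; rewrite divr_gt0.
  move: r_e; rewrite in_itv/= => /andP[r0 re].
  have H i : exists r', (ratr r' : R) \in
      `](f x ord0 i - ratr r), (f x ord0 i + ratr r)[%R.
    by apply: rat_in_itvoo; rewrite ltrBlDr -addrA ltrDl addr_gt0.
  have Hq i : `|f x ord0 i - ratr (sval (cid (H i)))| < ratr r.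
    case: cid => /= r'; rewrite in_itv/= => /andP[h1 h2].
    by rewrite distrC ltr_distl h1 h2.
  exists (\row_i sval (cid (H i)), r) => //.
  rewrite asboolT/=.
    by move=> i; rewrite mxE /ball/= distrC.
  move=> y By; apply: eU; split => // i j; rewrite ord1.
  have := By j; rewrite mxE /= => yj.
  apply: (@le_ball _ _ (f x ord0 j) (ratr r + ratr r)).
    by rewrite (splitr e) lerD// ltW.
  by apply: (ball_triangle _ yj); rewrite /ball/=.
apply: countable_bigcupT_measurable => // q.
case: asboolP => // _.
have -> : f @^-1` (B q) = \bigcap_(i in [set: 'I_n])
    ((fun x => f x ord0 i) @^-1` ball (ratr (q.1 ord0 i) : R) (ratr q.2)).
  by apply/seteqP; split => [x Bx i _|x Bx i]; exact: Bx.
apply: fin_bigcap_measurable => // i _.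
rewrite -[X in measurable X]setTI; apply: mf => //.
by apply: measurable_realfun.open_measurable; exact: ball_open.
Qed.

End rV_measurable.

Section lebesgue_rV.
Context (R : realType).

Definition cons_rV n (p : measurableTypeR R * 'rV[R]_n) : 'rV[R]_n.+1 :=
  \row_i (if unlift ord0 i is Some j then p.2 ord0 j else p.1).

Lemma measurable_cons_rV n : measurable_fun setT (@cons_rV n).
Proof.
apply: measurable_fun_rV => i; case: (unliftP ord0 i) => [j ->|->].
  under eq_fun do rewrite mxE liftK.
  apply: (measurableT_comp (f := fun v : 'rV[R]_n => v ord0 j)) => //.
  by apply: continuous_measurable_rV; exact: coord_continuous.
under eq_fun do rewrite mxE unlift_none.
exact: measurable_fst.
Qed.

HB.instance Definition _ n := isMeasurableFun.Build _ _ _ _ (@cons_rV n)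
  (@measurable_cons_rV n).

Section step.
Context n (m : {sigma_finite_measure set 'rV[R]_n -> \bar R}).

Definition lebesgue_step : set 'rV[R]_n.+1 -> \bar R :=
  pushforward (lebesgue_measure \x m)%E (@cons_rV n).

Let step0 : lebesgue_step set0 = 0%E.
Proof. by rewrite /lebesgue_step /pushforward preimage_set0 measure0. Qed.

Let step_ge0 A : (0 <= lebesgue_step A)%E.
Proof. by rewrite /lebesgue_step /pushforward measure_ge0. Qed.

Let step_sigma_additive : semi_sigma_additive lebesgue_step.
Proof. exact: measure_semi_sigma_additive. Qed.

HB.instance Definition _ := isMeasure.Build _ _ _ lebesgue_step
  step0 step_ge0 step_sigma_additive.

Let step_sigma_finite : sigma_finite setT lebesgue_step.
Proof.
have /sigma_finiteP[F [FT ndF Foo]] :=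
  sigma_finiteT (lebesgue_measure : {sigma_finite_measure set _ -> \bar R}).
have /sigma_finiteP[G [GT ndG Goo]] := sigma_finiteT m.
pose uncons (v : 'rV[R]_n.+1) : measurableTypeR R * 'rV[R]_n :=
  (v ord0 ord0, \row_j v ord0 (lift ord0 j)).
have muncons : measurable_fun setT uncons.
  apply: measurable_fun_pair.
    by apply: continuous_measurable_rV; exact: coord_continuous.
  apply: measurable_fun_rV => i; under eq_fun do rewrite mxE.
  by apply: continuous_measurable_rV; exact: coord_continuous.
have consK : cancel (@cons_rV n) uncons.
  move=> [x v]; rewrite /uncons mxE unlift_none; congr pair.
  by apply/rowP => j; rewrite !mxE liftK.
exists (fun k => uncons @^-1` (F k `*` G k)).
  apply/esym; rewrite -subTset => v _.
  have [i _ Fi] : (\bigcup_k F k) (uncons v).1 by rewrite -FT.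
  have [j _ Gj] : (\bigcup_k G k) (uncons v).2 by rewrite -GT.
  exists (maxn i j) => //; split.
    by move: Fi; exact/subsetPset/ndF/leq_maxl.
  by move: Gj; exact/subsetPset/ndG/leq_maxr.
move=> k; have [mFk Fkoo] := Foo k; have [mGk Gkoo] := Goo k; split.
  rewrite -[X in measurable X]setTI.
  by apply: muncons => //; exact: measurableX.
rewrite /lebesgue_step /pushforward -comp_preimage.
rewrite (_ : uncons \o _ = id); last by apply/funext => p; exact: consK.
by rewrite preimage_id product_measure1E// lte_mul_pinfty// ge0_fin_numE.
Qed.

HB.instance Definition _ := @Measure_isSigmaFinite.Build _ _ _ lebesgue_step
  step_sigma_finite.

End step.

Fixpoint lebesgue_rV n : {sigma_finite_measure set 'rV[R]_n -> \bar R} :=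
  if n is k.+1 then lebesgue_step (lebesgue_rV k) else \d_(0 : 'rV[R]_0).

Definition lebesgue_on n (Omega : set 'rV[R]_n) (oOmega : open Omega) :
    {measure set 'rV[R]_n -> \bar R} :=
  mrestr (lebesgue_rV n) (open_measurable_rV oOmega).

End lebesgue_rV.

Section domains.
Context (R : realType) (N : nat).
Local Notation E := 'rV[R]_N.

(* The norm of 'rV[R]_N in the library is the sup norm. *)
Definition enorm (x : E) : R := Num.sqrt (\sum_i x ord0 i ^+ 2).

Definition partial (i : 'I_N) (f : E -> R) : E -> R :=
  fun x => 'D_(delta_mx ord0 i) f x.

(* Hoelder continuity of the second partial derivatives makes them continuous,
   so that f is C^2 on U. *)
Definition C2alpha (alpha : R) (U : set E) (f : E -> R) : Prop :=
  (forall x i, U x -> derivable f x (delta_mx ord0 i)) /\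
  (forall x i j, U x -> derivable (partial i f) x (delta_mx ord0 j)) /\
  (exists C : R, forall x y i j, U x -> U y ->
    `|partial j (partial i f) x - partial j (partial i f) y|
      <= C * enorm (x - y) `^ alpha).

Definition C2alpha_boundary (Omega : set E) : Prop :=
  exists alpha : R, 0 < alpha < 1 /\
  forall x0, closure Omega x0 -> ~ Omega x0 ->
  exists r : R, exists rho : E -> R,
    [/\ 0 < r, C2alpha alpha (ball x0 r) rho, exists i, partial i rho x0 != 0
      & forall x, ball x0 r x -> (Omega x <-> rho x < 0)].

Definition bounded_C2alpha_domain (Omega : set E) : Prop :=
  [/\ Omega !=set0, connected Omega, bounded_set Omega
    & C2alpha_boundary Omega].

End domains.

(* Functions on Omega are represented by functions on the whole space, taken
   up to equality almost everywhere for mu, the Lebesgue measure of Omega. *)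
Section operators.
Context (R : realType) (N : nat).
Local Notation E := 'rV[R]_N.
Variable mu : {measure set E -> \bar R}.

Definition pairing (f g : E -> R) : R := \int[mu]_x (f x * g x).

Definition Lp_norm (p : R) (f : E -> R) : \bar R :=
  ('N[mu]_(p%:E)[EFin \o f])%E.

Definition Loo_norm (f : E -> R) : \bar R := ('N[mu]_(+oo)[EFin \o f])%E.

Arguments Lp_norm p%_R f%_R.
Arguments Loo_norm f%_R.

Record operator := Operator {
  dom : set (E -> R) ;
  app :> (E -> R) -> (E -> R) }.

Definition densely_defined_linear (L : operator) : Prop :=
  [/\ forall (f : E -> R), dom L f -> f \in Lfun mu 1 /\ L f \in Lfun mu 1,
      forall (f g : E -> R), dom L f -> g \in Lfun mu 1 -> f = g %[ae mu] ->
        dom L g /\ L f = L g %[ae mu],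
      forall (a : R) (f g : E -> R), dom L f -> dom L g ->
        dom L (fun x => a * f x + g x) /\
        L (fun x => a * f x + g x) = (fun x => a * L f x + L g x) %[ae mu]
    & forall (f : E -> R) (e : R), f \in Lfun mu 1 -> 0 < e ->
        exists2 g, dom L g & (Lp_norm 1 (f \- g) < e%:E)%E].

(* domain of the part of L in L^2 *)
Definition dom2 (L : operator) (f : E -> R) : Prop :=
  [/\ dom L f, f \in Lfun mu 2%:E & L f \in Lfun mu 2%:E].

Definition selfadjoint_nonneg (L : operator) : Prop :=
  [/\ forall (f : E -> R) (e : R), f \in Lfun mu 2%:E -> 0 < e ->
        exists2 g, dom2 L g & (Lp_norm 2 (f \- g) < e%:E)%E,
      forall (v w : E -> R), v \in Lfun mu 2%:E -> w \in Lfun mu 2%:E ->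
        (dom2 L v /\ L v = w %[ae mu]) <->
        (forall (u : E -> R), dom2 L u -> pairing (L u) v = pairing u w)
    & forall (u : E -> R), dom2 L u -> 0 <= pairing u (L u)].

Definition m_accretive (L : operator) : Prop :=
  (forall (l : R) (f : E -> R), 0 < l -> dom L f ->
    (Lp_norm 1 f <= Lp_norm 1 (fun x => f x + l * L f x)%R)%E) /\
  (forall (l : R) (g : E -> R), 0 < l -> g \in Lfun mu 1 ->
    exists2 f, dom L f & (fun x => f x + l * L f x) = g %[ae mu]).

(* S t = e^{-tL}: the C_0-semigroup of contractions of L^1 with generator -L *)
Definition semigroup_generated (L : operator)
    (S : R -> (E -> R) -> (E -> R)) : Prop :=
  [/\ forall (t : R) (f : E -> R), 0 <= t -> f \in Lfun mu 1 ->
        S t f \in Lfun mu 1,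
      forall (t a : R) (f g : E -> R), 0 <= t ->
        f \in Lfun mu 1 -> g \in Lfun mu 1 ->
        S t (fun x => a * f x + g x) = (fun x => a * S t f x + S t g x)
          %[ae mu] /\
        (Lp_norm 1 (S t f \- S t g) <= Lp_norm 1 (f \- g))%E,
      forall (t r : R) (f : E -> R), 0 <= t -> 0 <= r -> f \in Lfun mu 1 ->
        S 0 f = f %[ae mu] /\ S (t + r) f = S t (S r f) %[ae mu],
      forall (f : E -> R), f \in Lfun mu 1 ->
        Lp_norm 1 (S t f \- f) @[t --> 0^'+] --> 0%E
    & forall (f g : E -> R), f \in Lfun mu 1 -> g \in Lfun mu 1 ->
        (dom L f /\ L f = g %[ae mu]) <->
        (Lp_norm 1 (fun x => t^-1 * (f x - S t f x) - g x) @[t --> 0^'+]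
          --> 0%E)].

Definition sub_markovian (L : operator) : Prop :=
  exists2 S, semigroup_generated L S &
    forall (t : R) (f : E -> R), 0 <= t -> measurable_fun setT f ->
      {ae mu, forall x, 0 <= f x <= 1} -> {ae mu, forall x, 0 <= S t f x <= 1}.

Definition green_op (G : E -> E -> R) (f : E -> R) : E -> R :=
  fun x => \int[mu]_y (G x y * f y).

Definition inverse_kernel (L : operator) (G : E -> E -> R) : Prop :=
  [/\ measurable_fun setT (fun z : E * E => G z.1 z.2),
      forall (f : E -> R), f \in Lfun mu 1 ->
        {ae mu, forall x, mu.-integrable setT (fun y => (G x y * f y)%:E)},
      forall (f : E -> R), f \in Lfun mu 1 ->
        dom L (green_op G f) /\ L (green_op G f) = f %[ae mu]
    & forall (f : E -> R), dom L f -> green_op G (L f) = f %[ae mu]].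

(* Besides being nonnegative, Phi is required to be positive a.e., as is
   implicit in the use of Phi as a weight for a norm and as a divisor. *)
Definition first_eigenpair (L : operator) (lambda : R) (Phi : E -> R) : Prop :=
  [/\ 0 < lambda,
      dom2 L Phi /\ L Phi = (fun x => lambda * Phi x) %[ae mu],
      forall (l : R) (f : E -> R), dom2 L f ->
        L f = (fun x => l * f x) %[ae mu] ->
        ~ (f = cst 0 %[ae mu]) -> lambda <= l,
      {ae mu, forall x, 0 < Phi x} /\ Phi \in Lfun mu +oo%E
    & Lp_norm 2 Phi = 1%E].

(* The integral of v L v for an arbitrary v in L^2: the lower semicontinuous
   extension of the quadratic form of L, i.e. its closed quadratic form. *)
Definition energy (L : operator) (v : E -> R) : \bar R :=
  ereal_inf [set l | exists w : (E -> R)^nat,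
    [/\ forall n, dom2 L (w n), Lp_norm 2 (w n \- v) @[n --> \oo] --> 0%E
      & l = limn_einf (fun n => (pairing (w n) (L (w n)))%:E)]].

Definition in_H (L : operator) (v : E -> R) : Prop :=
  v \in Lfun mu 2%:E /\ (energy L v < +oo)%E.

(* f belongs to the dual of H(Omega) through the pairing of L^2 *)
Definition in_Hstar (L : operator) (f : E -> R) : Prop :=
  exists C : R, forall (v : E -> R), in_H L v ->
    mu.-integrable setT (fun x => (f x * v x)%:E) /\
    `|pairing f v| <= C * Num.sqrt (fine (energy L v)).

Definition Hstar_norm (G : E -> E -> R) (f : E -> R) : \bar R :=
  sqrte (\int[mu]_x (f x * green_op G f x)%:E).

Definition HLS_constant (G : E -> E -> R) (s H : R) : Prop :=
  forall (f : E -> R), f \in Lfun mu ((2 * N%:R / (N%:R + 2 * s))%:E) ->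
    (Hstar_norm G f <= H%:E * Lp_norm (2 * N%:R / (N%:R + 2 * s)) f)%E.

Definition Qstar (G : E -> E -> R) (m : R) (f : E -> R) : R :=
  fine (Lp_norm (1 + m) f) `^ (1 + m) / fine (Hstar_norm G f) `^ (1 + m).

Definition spow (m : R) (f : E -> R) : E -> R :=
  fun x => `|f x| `^ (m - 1) * f x.

Definition wnorm (Phi f : E -> R) : \bar R := \int[mu]_x (`|f x| * Phi x)%:E.

Arguments wnorm (Phi f)%_R.

Definition in_L1w (Phi f : E -> R) : Prop :=
  measurable_fun setT f /\ (wnorm Phi f < +oo)%E.

Definition continuous_L1w (Phi : E -> R) (I : set R) (u : R -> E -> R) : Prop :=
  forall t : R, I t -> in_L1w Phi (u t) /\
    (wnorm Phi (u r \- u t) @[r --> within I (nbhs t)] --> 0%E).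

(* eta is C^1 from R to L^oo, with derivative deta, and has compact support
   in ]0, T[ *)
Definition C1c_Loo (T : R) (eta deta : R -> E -> R) : Prop :=
  [/\ forall t : R, eta t \in Lfun mu +oo%E /\ deta t \in Lfun mu +oo%E,
      forall t : R,
        Loo_norm (fun x => h^-1 * (eta (t + h) x - eta t x) - deta t x)
          @[h --> 0^'] --> 0%E,
      forall t : R, Loo_norm (deta r \- deta t) @[r --> t] --> 0%E
    & exists a b : R, [/\ 0 < a, b < T &
        forall t : R, ~ (a <= t <= b) -> eta t = cst 0 %[ae mu]]].

(* The test functions are psi = eta * Phi, with eta = psi / Phi.  The integrand
   of the time integral in the second clause is continuous on ]0, T[ by the
   first one, so that no measurability in time has to be required. *)
Definition WDS (Phi : E -> R) (G : E -> E -> R) (m T : R) (u : R -> E -> R) :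
    Prop :=
  [/\ continuous_L1w Phi `]0, T[%classic u,
      (\int[lebesgue_measure]_(t in `[0%R, T]) wnorm Phi (spow m (u t))
        < +oo)%E
    & forall eta deta, C1c_Loo T eta deta ->
        \int[lebesgue_measure]_(t in `]0, T[)
          (\int[mu]_x (green_op G (u t) x * (deta t x * Phi x))) =
        \int[lebesgue_measure]_(t in `]0, T[)
          (\int[mu]_x (spow m (u t) x * (eta t x * Phi x)))].

Definition WDS_CDP (Phi : E -> R) (G : E -> E -> R) (m : R) (u0 : E -> R)
    (u : R -> E -> R) : Prop :=
  in_L1w Phi u0 /\
  forall T : R, 0 < T ->
    [/\ WDS Phi G m T u, continuous_L1w Phi `[0, T[%classic u
      & wnorm Phi (u t \- u0) @[t --> 0^'+] --> 0%E].

Definition extinct_from (u : R -> E -> R) (T : R) : Prop :=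
  0 <= T /\ forall t : R, T <= t -> u t = cst 0 %[ae mu].

Definition extinction_time (u : R -> E -> R) (T : R) : Prop :=
  extinct_from u T /\ forall T', extinct_from u T' -> T <= T'.

End operators.

(* On the diagonal, a null set, the right-hand side is c * 0 because powR maps 0
   to 0 for nonzero exponents. *)
Definition green_bound (R : realType) (N : nat) (Omega : set 'rV[R]_N) (s : R)
    (G : 'rV[R]_N -> 'rV[R]_N -> R) : Prop :=
  exists2 c : R, 0 < c &
    {ae (lebesgue_rV R N \x lebesgue_rV R N)%E, forall z,
      Omega z.1 -> Omega z.2 ->
      0 <= G z.1 z.2 <= c * enorm (z.1 - z.2) `^ (- (N%:R - 2 * s))}.

(* Main.v *)
(* Let [B f g] be the integral of [f G g], [Y t = B (u t) (u t)], which is the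
   square of the H^* norm, and [A t] the integral of [u(t)^(1+m)].  As [G >= 0],
   testing the equation with bounded multiples of [Phi_1] and truncating gives,
   for every [chi >= 0],
     B chi (u a) = B chi (u b) + int_a^b int u(t)^m chi dt.
   With [chi = u a] and [chi = u b] this yields
     Y a - Y b = int_a^b int u(t)^m (u a + u b) dt >= 2 int_a^b A.
   Young's inequality under the integral and [B (u a) (u b)^2 <= Y a * Y b] give
     (1 + m) (sqrt (Y a) - sqrt (Y b))^2 <= 2 int_a^b (A a - A t) dt,
   so that [A] is nonincreasing and, to second order in [b - a], the quotient
   [A / Y^((1+m)/2)] is nonincreasing.  Since [Y' = - 2 A], integrating the
   differential inequality for [Y^((1-m)/2)] up to the extinction time gives the
   upper bound.  The lower one follows in the same way from the lower bound on
   the quotient provided by the Hardy-Littlewood-Sobolev inequality. *)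
Require Import Defs.
From mathcomp Require Import all_boot all_order all_algebra.
From mathcomp Require Import all_classical all_reals all_analysis.
From mathcomp Require Import measurable_realfun ess_sup_inf ring lra.

Import Order.TTheory GRing.Theory Num.Theory.
Import numFieldNormedType.Exports.

Local Open Scope classical_set_scope.
Local Open Scope ring_scope.

Set Implicit Arguments.
Unset Strict Implicit.
Unset Printing Implicit Defensive.

(** * The extinction argument for a scalar pair *)

(** The bound [Y a - Y b >= 2 int A] does not hold integrand by integrand. It is an infinitesimal
    statement, and it passes to [[a, b]] because both sides are additive over subintervals.
    Continuity in time, which the infinitesimal step needs, is available only for truncated
    integrals, hence the approximations [J k]. The function [A] itself is only known to be lower
    semicontinuous and, at first, finite at time 0 alone, and neither [A] nor [Y] comes with a
    derivative. Every differential inequality is therefore proved with an arbitrarily small slack,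
    through [le_of_locally_nondecreasing]. The exponent of the quotient comes out as follows. If [A]
    stays above a line of slope [b] through [A s], the inequality for the square roots bounds
    [(1 + m)] times the square of their drop over a time [h] by [- b h^2]. That drop is about
    [h A / sqrt Y], so [b <= - (1 + m) A^2 / Y]. Since [Y' = - 2 A], this is exactly the slope at
    which [A / Y^((1+m)/2)] is stationary. *)

(** Young's inequality for the product of [x ^ a] and [1], with conjugate exponents [1 / a] and
    [1 / (1 - a)]. *)
Lemma powR_bernoulli (R : realType) (a x : R) :
  0 < a < 1 -> 0 <= x -> x `^ a <= 1 + a * (x - 1).
Proof.
move=> /andP[a0 a1] x0.
have b0 : 0 < 1 - a by rewrite subr_gt0.
have := @conjugate_powR R (x `^ a) 1 a^-1 (1 - a)^-1 (powR_ge0 _ _) ler01.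
rewrite !invr_gt0 !invrK subrKC => /(_ a0 b0 erefl).
by rewrite -powRrM divff ?gt_eqF// powRr1// powR1 mulr1 mul1r; lra.
Qed.

(** Concavity of the power: the preceding bound at [y / x], multiplied by [x ^ a]. The end [y] may
    be [0], the point of tangency may not. *)
Lemma powR_tangent (R : realType) (a x y : R) : 0 < a < 1 -> 0 < x -> 0 <= y ->
  y `^ a - x `^ a <= a * (x `^ (a - 1) * (y - x)).
Proof.
move=> a01 x0 y0; have yx0 : 0 <= y / x by rewrite divr_ge0// ltW.
have := powR_bernoulli a01 yx0.
rewrite -(ler_pM2l (powR_gt0 a x0)) -powRM ?(ltW x0)//.
rewrite [x * _]mulrC divfK ?gt_eqF// => h. rewrite powRB//; last by rewrite (gt_eqF x0) implybT.
rewrite powRr1 ?(ltW x0)//.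
have -> : a * (x `^ a / x * (y - x)) = x `^ a * (a * (y / x - 1)).
  by field; rewrite gt_eqF.
by rewrite lerBlDl; rewrite mulrDr mulr1 in h; exact: h.
Qed.

(** A bound from below cannot come from a tangent of a concave function. The upper bound is applied
    to [1 / (1 - x)], which is at most [1 + x + 2 x^2] for [x <= 1/2], and reciprocals are taken,
    using [1 / (1 + z) >= 1 - z]. *)
Lemma powR_1B_ge (R : realType) (a x : R) : 0 < a < 1 -> 0 <= x <= 2^-1 ->
  1 - a * x - 2 * a * x ^+ 2 <= (1 - x) `^ a.
Proof.
move=> a01 /andP[x0 x1].
have y0 : 0 < 1 - x by lra.
have := @powR_bernoulli _ a (1 - x)^-1 a01.
rewrite invr_ge0 ltW// => /(_ isT).
have -> : (1 - x)^-1 `^ a = ((1 - x) `^ a)^-1.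
  by rewrite -powR_inv1 ?ltW// -powRrM mulN1r powRN.
set p := (1 - x) `^ a => h.
have p0 : 0 < p by rewrite powR_gt0.
have /andP[a0 a1] := a01.
have i0 : (1 - x)^-1 <= 1 + x + 2 * x ^+ 2.
  rewrite -[X in X <= _]mul1r ler_pdivrMr//.
  have -> : (1 + x + 2 * x ^+ 2) * (1 - x) = 1 + x ^+ 2 * (1 - 2 * x) by ring.
  by rewrite lerDl mulr_ge0// ?sqr_ge0//; lra.
set z := a * (x + 2 * x ^+ 2).
have z0 : 0 <= z.
  by rewrite mulr_ge0 ?(ltW a0)// addr_ge0// mulr_ge0// sqr_ge0.
have h2 : p^-1 <= 1 + z.
  apply: (le_trans h); rewrite lerD2l /z ler_wpM2l ?(ltW a0)//; lra.
have : 1 <= p * (1 + z).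
  by rewrite -(ler_pM2l p0) mulfV ?gt_eqF// in h2.
have -> : 1 - a * x - 2 * a * x ^+ 2 = 1 - z by rewrite /z; ring.
case: (lerP (1 - z) 0) => [hz _|hz h3]; first by rewrite (le_trans hz)// ltW.
have z1 : 0 < 1 + z by lra.
rewrite -(ler_pM2r z1); apply: le_trans h3.
have -> : (1 - z) * (1 + z) = 1 - z ^+ 2 by ring.
by rewrite gerBl sqr_ge0.
Qed.

(** This stands in for integrating a differential inequality when no derivative exists. The supremum
    of the points where [f] is at least [f a] is itself such a point by the condition on the left,
    and is [b] because the condition on the right would provide a later one. *)
Lemma le_of_locally_nondecreasing (R : realType) (f : R -> R) (a b : R) :
  a <= b ->
  (forall s, a <= s < b -> forall d, 0 < d ->
    exists t, [/\ s < t, t < s + d, t <= b & f s <= f t]) ->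
  (forall s, a < s <= b -> forall e, 0 < e ->
    exists2 d, 0 < d & forall t, a <= t -> s - d < t < s -> f t <= f s + e) ->
  f a <= f b.
Proof.
move=> ab hr hl.
pose S := [set t | a <= t <= b /\ f a <= f t].
have Sa : S a by split; rewrite ?lexx.
have supS : has_sup S.
  by split; [exists a|exists b => t [/andP[]]].
set s := sup S.
have as_ : a <= s by apply: ub_le_sup Sa; case: supS.
have sb : s <= b.
  by apply: ge_sup; [exists a|move=> t [/andP[]]].
have fs : f a <= f s.
  move: as_; rewrite le_eqVlt => /predU1P[<-//|as_].
  apply/ler_addgt0Pr => e e0.
  have [d d0 hd] := hl s ltac:(by rewrite as_ sb) e e0.
  have [t St st] := sup_adherent d0 supS; rewrite -/s in st.
  have ts : t <= s by apply: ub_le_sup St; case: supS.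
  case: St => /andP[at_ tb] ft.
  move: ts; rewrite le_eqVlt => /predU1P[<-|ts]; first by rewrite ler_wpDr// ltW.
  by apply: (le_trans ft); apply: hd => //; rewrite st ts.
move: sb; rewrite le_eqVlt => /predU1P[<-//|sb].
have [t [st _ tb ft]] := hr s ltac:(by rewrite as_ sb) 1 ltr01.
have : t <= s.
  apply: ub_le_sup; first by case: supS.
  by split; [rewrite tb (le_trans as_ (ltW st))|exact: le_trans ft].
by rewrite leNgt st.
Qed.

Lemma exists_small (R : realType) (d K e : R) : 0 < d -> 0 <= K -> 0 < e ->
  exists2 g, 0 < g < d & K * g <= e.
Proof.
move=> d0 K0 e0; have K1 : 0 < 1 + K by lra.
have eK : 0 < e / (1 + K) by rewrite divr_gt0.
exists (Num.min (d / 2) (e / (1 + K))).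
  by rewrite lt_min eK gt_min divr_gt0//= ltr_pdivrMr// ltr_pMr// ltr1n.
apply: (@le_trans _ _ (K * (e / (1 + K)))).
  by rewrite ler_wpM2l// ge_min lexx orbT.
by rewrite mulrA ler_pdivrMr// mulrC ler_pM2l//; lra.
Qed.

(** * Differential inequalities for the pair [(Y, A)] *)

Section scalar.
Variables (R : realType) (T m : R) (Y A : R -> R).
Hypothesis m01 : 0 < m < 1.
Hypothesis A_ge0 : forall t : R, 0 <= t -> 0 <= A t.
Hypothesis A_noninc : forall s t : R, 0 <= s -> s <= t -> A t <= A s.
Hypothesis Y_ge : forall s t : R, 0 <= s -> s <= t -> 2 * ((t - s) * A t) <= Y s - Y t.
Hypothesis Y_le : forall s t : R, 0 <= s -> s <= t -> Y s - Y t <= 2 * ((t - s) * A s).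
Hypothesis Y_gt0 : forall t : R, 0 <= t < T -> 0 < Y t.
Hypothesis Y_T : Y T = 0.
Hypothesis Y_sqrt : forall s t b : R, 0 <= s -> s < t ->
  (forall r, s < r <= t -> A s + b * (r - s) <= A r) ->
  (1 + m) * (Num.sqrt (Y s) - Num.sqrt (Y t)) ^+ 2 <= - b * (t - s) ^+ 2.

Let al := (1 + m) / 2.
Let al01 : 0 < al < 1. Proof. by move: m01; rewrite /al => /andP[? ?]; lra. Qed.

Let Y_noninc (s t : R) : 0 <= s -> s <= t -> Y t <= Y s.
Proof.
move=> s0 st; rewrite -subr_ge0; apply: le_trans (Y_ge s0 st).
by rewrite mulr_ge0// mulr_ge0 ?subr_ge0// A_ge0// (le_trans s0).
Qed.

(** As [Y] is the squared norm, [Y ^ al] is the norm to the power [1 + m], and this is the dual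
    Rayleigh quotient at time [t]. *)
Definition rayleigh t := A t / Y t `^ al.

(* An increase of the quotient at rate [e] keeps [A] above a line through
   [A s] whose slope exceeds [- (1 + m) A s ^ 2 / Y s], while [Y_sqrt] forbids
   such slopes on short intervals. *)
Lemma rayleigh_not_increasing s e d : 0 <= s < T -> 0 < e -> 0 < d ->
  s + d <= T ->
  (forall t, s < t < s + d -> rayleigh s + e * (t - s) < rayleigh t) -> False.
Proof.
move=> /andP[s0 sT] e0 d0 sdT H.
have Ys0 : 0 < Y s by rewrite Y_gt0// s0 sT.
set Y0 := Y s in Ys0; set A0 := A s.
have A00 : 0 <= A0 by exact: A_ge0.
set P := Y0 `^ al; have P0 : 0 < P by exact: powR_gt0.
have A0E : A0 = rayleigh s * P by rewrite /rayleigh divfK// gt_eqF.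
(* The growth of the quotient adds [e * P = 4 * e1] to the slope of [A]. The factor [w >= 1/2] below
   keeps at least half of it, the second-order term takes [e1], and [e1] is left for [b]. *)
set e1 := e * P / 4; have e10 : 0 < e1 by rewrite /e1 divr_gt0// mulr_gt0.
have eP : e * P = 4 * e1 by rewrite /e1; field.
have /andP[m0 m1] := m01; have /andP[al0 al1] := al01.
set D := A0 / Y0; have D0 : 0 <= D by rewrite /D divr_ge0// ltW.
have A0D : A0 = D * Y0 by rewrite /D divfK// gt_eqF.
clearbody e1 D.
(* The slope that keeps the quotient stationary when [Y' = - 2 A], plus the margin [e1]. *)
set b := - (1 + m) * A0 * D + e1.
(* [C] is the coefficient of the second-order loss [2 * al * x ^ 2] with [x = 2 * g * D]; [F * A0]
   bounds the first-order loss when [A0 + b * h] is squared at the end. *)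
set C := 8 * al * A0 * D ^+ 2.
have m10 : 0 <= 1 + m by lra.
have C0 : 0 <= C by rewrite /C !mulr_ge0 ?exprn_ge0 ?invr_ge0 ?(ltW Ys0)//.
set F := 2 * (1 + m) ^+ 2 * A0 * D.
have F0 : 0 <= F by rewrite /F !mulr_ge0 ?exprn_ge0 ?invr_ge0 ?(ltW Ys0)//.
have [h [h0 hd hD hC hF]] : exists h,
    [/\ 0 < h, h < d, D * h <= 8^-1, C * h <= e1 & F * A0 * h < e1 * Y0].
  have FA0 : 0 <= F * A0 by exact: mulr_ge0.
  exists (Num.min (d / 2) (Num.min (8^-1 / (1 + D)) (Num.min (e1 / (1 + C))
    (e1 * Y0 / (1 + F * A0))))).
  have D1 : 0 < 1 + D by lra.
  have C1 : 0 < 1 + C by lra.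
  have F1 : 0 < 1 + F * A0 by lra.
  have eY : 0 < e1 * Y0 by exact: mulr_gt0.
  split.
  - by rewrite !lt_min !divr_gt0//; lra.
  - by rewrite !gt_min ltr_pdivrMr// ltr_pMr// ltr1n.
  - apply: (@le_trans _ _ (D * (8^-1 / (1 + D)))).
      by rewrite ler_wpM2l// !ge_min lexx !orbT.
    by rewrite mulrA ler_pdivrMr//; lra.
  - apply: (@le_trans _ _ (C * (e1 / (1 + C)))).
      by rewrite ler_wpM2l// !ge_min lexx !orbT.
    by rewrite mulrA ler_pdivrMr// mulrC ler_pM2l//; lra.
  - apply: (@le_lt_trans _ _ (F * A0 * (e1 * Y0 / (1 + F * A0)))).
      by rewrite ler_wpM2l// !ge_min lexx !orbT.
    by rewrite mulrA ltr_pdivrMr// mulrC ltr_pM2l//; lra.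
have s0T : 0 <= s by [].
have lowA r : s < r <= s + h -> A0 + b * (r - s) <= A r.
  move=> /andP[sr rh]; set g := r - s.
  have g0 : 0 < g by rewrite /g subr_gt0.
  have gh : g <= h by rewrite /g lerBlDl.
  have := H r ltac:(by rewrite sr (le_lt_trans rh)// ltrD2l).
  have rT : r < T by rewrite (lt_le_trans _ sdT)// (le_lt_trans rh)// ltrD2l.
  have Yr0 : 0 < Y r by rewrite Y_gt0// rT (le_trans s0)// ltW.
  rewrite /rayleigh -/A0 -/g -/P ltr_pdivlMr ?powR_gt0// => /ltW HA.
  apply: le_trans HA.
  (* By [Y_le], the fraction of [Y0] lost between [s] and [r] is at most [x]. *)
  set x := 2 * g * D.
  have Dg : D * g <= 8^-1 by apply: le_trans hD; rewrite ler_wpM2l.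
  have Dg0 : 0 <= D * g by rewrite mulr_ge0// ltW.
  have x0 : 0 <= x by rewrite /x !mulr_ge0// ltW.
  have x4 : x <= 4^-1 by rewrite /x; lra.
  have YrE : (Y0 * (1 - x)) `^ al <= Y r `^ al.
    have Yx : Y0 * (1 - x) <= Y r.
      have := Y_le s0 (ltW sr); rewrite -/Y0 -/A0 -/g /x A0D; lra.
    rewrite ge0_ler_powR ?(ltW al0)// nnegrE ?(ltW Yr0)//.
    by rewrite mulr_ge0 ?(ltW Ys0)//; lra.
  have bern : 1 - al * x - 2 * al * x ^+ 2 <= (1 - x) `^ al.
    by apply: powR_1B_ge => //; rewrite x0; lra.
  rewrite powRM ?(ltW Ys0)// -/P in YrE; last by lra.
  have R0 : 0 <= A0 / P by rewrite divr_ge0// ltW.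
  have half : 2^-1 <= 1 - al * x - 2 * al * x ^+ 2.
    have : al * x <= x by rewrite ler_piMl// ltW.
    have x20 : 0 <= x ^+ 2 by exact: sqr_ge0.
    have : al * x ^+ 2 <= x ^+ 2 by rewrite ler_piMl// ltW.
    have : x ^+ 2 <= 4^-1 * x by rewrite expr2 ler_wpM2r.
    lra.
  have g1 : 0 <= A0 / P + e * g by rewrite addr_ge0// mulr_ge0// ltW.
  apply: (@le_trans _ _ ((A0 / P + e * g) * (P * (1 - al * x - 2 * al * x ^+ 2)))); last first.
    by rewrite ler_wpM2l// (le_trans _ YrE)// ler_wpM2l// ltW.
  set w := 1 - al * x - 2 * al * x ^+ 2.
  have -> : (A0 / P + e * g) * (P * w) = A0 * w + 4 * e1 * g * w.
    by rewrite -eP; field; rewrite gt_eqF.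
  have : 2 * e1 * g <= 4 * e1 * g * w.
    have e1g : 0 < e1 * g by rewrite mulr_gt0.
    have : e1 * g * 2^-1 <= e1 * g * w by rewrite ler_wpM2l// ltW.
    lra.
  have -> : A0 * w = A0 - (1 + m) * A0 * D * g - C * g * g.
    by rewrite /w /x /C /al; field.
  have : C * g * g <= e1 * g.
    by rewrite ler_wpM2r// ?(ltW g0)// (le_trans _ hC)// ler_wpM2l.
  rewrite /b; lra.
have sh : s < s + h by rewrite ltrDl.
have E : s + h - s = h by ring.
have := @Y_sqrt s (s + h) b s0 sh _; rewrite E.
move=> /(_ lowA).
have Ysh0 : 0 < Y (s + h).
  by rewrite Y_gt0// addr_ge0 ?(ltW h0)//= (lt_le_trans _ sdT)// ltrD2l.
have := Y_ge s0 (ltW sh); rewrite E -/Y0.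
have := lowA (s + h) ltac:(by rewrite sh lexx); rewrite E.
set a1 := A (s + h) => La1 LY.
set y0 := Num.sqrt Y0; set y1 := Num.sqrt (Y (s + h)).
have y00 : 0 < y0 by rewrite sqrtr_gt0.
have y10 : 0 < y1 by rewrite sqrtr_gt0.
have yY0 : y0 ^+ 2 = Y0 by rewrite sqr_sqrtr// ltW.
have yY1 : y1 ^+ 2 = Y (s + h) by rewrite sqr_sqrtr// ltW.
have y10' : y1 <= y0 by rewrite ler_wsqrtr// Y_noninc// ltW.
set q := A0 + b * h in La1 *.
have q0 : 0 <= q.
  have A0Dh : A0 * (D * h) <= A0 * 8^-1 by rewrite ler_wpM2l.
  have mA : m * (A0 * (D * h)) <= A0 * (D * h).
    by rewrite ler_piMl ?(ltW m1)// !mulr_ge0// ltW.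
  have e1h : 0 < e1 * h by exact: mulr_gt0.
  rewrite /q /b; lra.
(* Since [2 * h * a1 <= y0 ^ 2 - y1 ^ 2] and [y1 <= y0], the square root drops by at least
   [h * q / y0]. [Y_sqrt] bounds the same drop from above. *)
have hq : h * q <= y0 * (y0 - y1).
  have hqa : h * q <= h * a1 by rewrite ler_pM2l.
  have yy : y1 * (y0 - y1) <= y0 * (y0 - y1) by rewrite ler_wpM2r ?subr_ge0.
  rewrite -yY0 -yY1 in LY.
  have -> : y0 * (y0 - y1) = (y0 ^+ 2 - y1 ^+ 2) / 2 + (y0 - y1) ^+ 2 / 2 by field.
  have := sqr_ge0 (y0 - y1); lra.
move=> fin.
have hq2 : (h * q) ^+ 2 <= Y0 * (y0 - y1) ^+ 2.
  rewrite -yY0 -exprMn lerXn2r// nnegrE mulr_ge0 ?subr_ge0// ltW//.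
have fin2 : (1 + m) * (h * q) ^+ 2 <= Y0 * (- b * h ^+ 2).
  apply: (@le_trans _ _ ((1 + m) * (Y0 * (y0 - y1) ^+ 2))).
    by rewrite ler_wpM2l//; lra.
  by rewrite mulrCA ler_wpM2l// ltW.
(* To leading order this reads [(1 + m) * A0 ^ 2 <= (1 + m) * A0 ^ 2 - e1 * Y0], and the error, at
   most [F * A0 * h < e1 * Y0], is too small to save it. *)
have fin3 : (1 + m) * q ^+ 2 <= - b * Y0.
  have h20 : 0 < h ^+ 2 by rewrite exprn_gt0.
  by rewrite -(ler_pM2r h20) (le_trans _ (le_trans fin2 _))//; lra.
have qq : A0 ^+ 2 + 2 * A0 * (b * h) <= q ^+ 2.
  by rewrite /q; have := sqr_ge0 (b * h); lra.
have {}qq : (1 + m) * (A0 ^+ 2 + 2 * A0 * (b * h)) <= (1 + m) * q ^+ 2.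
  by rewrite ler_wpM2l.
have bY : - b * Y0 = (1 + m) * A0 ^+ 2 - e1 * Y0.
  by rewrite /b [in RHS]expr2 {3}A0D; ring.
have mbh : - (F * A0 * h) <= (1 + m) * (2 * A0 * (b * h)).
  have : 0 <= (1 + m) * (2 * A0 * (e1 * h)) by rewrite !mulr_ge0// ltW.
  rewrite /F /b; lra.
lra.
Qed.

(** [rayleigh_not_increasing] excludes only growth at a positive rate to the right of a point, so
    the monotonicity is proved for [- rayleigh] with an added slope [c], where [c] is arbitrarily
    small. *)
Lemma rayleigh_noninc s t : 0 <= s -> s <= t -> t < T -> rayleigh t <= rayleigh s.
Proof.
move=> s0 st tT; apply/ler_addgt0Pr => e e0.
have ts0 : 0 <= t - s by rewrite subr_ge0.
have [c /andP[c0 _] ce] := exists_small ltr01 ts0 e0.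
suff : - rayleigh s + c * s <= - rayleigh t + c * t by lra.
apply: (@le_of_locally_nondecreasing _ (fun r => - rayleigh r + c * r)) => //.
- move=> r /andP[sr rt] d d0; apply: contrapT => noex.
  have r0 : 0 <= r by exact: le_trans sr.
  have rT : r < T by exact: lt_trans tT.
  pose d' := Num.min d (t - r).
  have d'0 : 0 < d' by rewrite /d' lt_min d0 subr_gt0.
  have d't : r + d' <= t by rewrite -lerBrDl /d' ge_min lexx orbT.
  apply: (@rayleigh_not_increasing r c d') => //.
  + by rewrite r0.
  + exact: le_trans (ltW tT).
  + move=> x /andP[rx xd]; rewrite ltNge; apply/negP => h; apply: noex.
    exists x; split => //.
    * by rewrite (lt_le_trans xd)// lerD2l /d' ge_min lexx.
    * by rewrite (le_trans (ltW xd)).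
    * lra.
(* To the left of [r], [A] is at least [A r] and [Y] exceeds [Y r] by at most [2 * A 0 * (r - x)],
   so the quotient falls below its value at [r] by at most [K * (r - x)]. *)
- move=> r /andP[sr rt] e' e'0.
  have r0 : 0 < r by exact: le_lt_trans sr.
  have Yr0 : 0 < Y r by rewrite Y_gt0// (ltW r0) (le_lt_trans rt).
  have /andP[al0 al1] := al01.
  have P0 : 0 < Y r `^ al by exact: powR_gt0.
  have Ar0 : 0 <= A r by rewrite A_ge0// ltW.
  have A0 : 0 <= A 0 by exact: A_ge0.
  pose K := A r * (al * (Y r `^ (al - 1) * (2 * A 0))) / (Y r `^ al * Y r `^ al).
  have K0 : 0 <= K.
    apply: divr_ge0; last by rewrite mulr_ge0 ?powR_ge0.
    apply: mulr_ge0 => //; apply: mulr_ge0; first exact: ltW.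
    by rewrite mulr_ge0 ?powR_ge0// mulr_ge0.
  have [d /andP[d0 _] dK] := exists_small ltr01 K0 e'0.
  exists d => // x sx /andP[rx xr].
  have x0 : 0 <= x by exact: le_trans sx.
  have Yx : Y r <= Y x by exact: Y_noninc (ltW xr).
  have Yx0 : 0 < Y x by exact: lt_le_trans Yx.
  have Px : Y r `^ al <= Y x `^ al.
    by rewrite ge0_ler_powR ?(ltW al0)// nnegrE ltW.
  have Px0 : 0 < Y x `^ al by exact: powR_gt0.
  have Axr : A r <= A x by apply: A_noninc => //; exact: ltW.
  have YY : Y x - Y r <= 2 * A 0 * (r - x).
    apply: (le_trans (Y_le x0 (ltW xr))).
    rewrite -mulrA ler_pM2l// mulrC ler_wpM2r ?subr_ge0 ?(ltW xr)//.
    exact: A_noninc.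
  have tang : Y x `^ al - Y r `^ al <= al * (Y r `^ (al - 1) * (2 * A 0 * (r - x))).
    apply: (le_trans (powR_tangent al01 Yr0 (ltW Yx0))).
    by rewrite ler_pM2l// ler_wpM2l// powR_ge0.
  have R1 : A r / Y x `^ al <= rayleigh x.
    by rewrite /rayleigh ler_pM2r ?invr_gt0.
  have R2 : rayleigh r - A r / Y x `^ al <= K * (r - x).
    have -> : rayleigh r - A r / Y x `^ al =
        A r * (Y x `^ al - Y r `^ al) / (Y r `^ al * Y x `^ al).
      by rewrite /rayleigh; field; rewrite !gt_eqF.
    apply: (@le_trans _ _ (A r * (Y x `^ al - Y r `^ al) / (Y r `^ al * Y r `^ al))).
      apply: ler_wpM2l; first by rewrite mulr_ge0// subr_ge0.
      by rewrite lef_pV2 ?posrE ?mulr_gt0// ler_pM2l.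
    rewrite /K [X in _ <= X]mulrAC ler_pM2r ?invr_gt0 ?mulr_gt0//.
    rewrite -[X in _ <= X]mulrA ler_wpM2l//; apply: (le_trans tang).
    by rewrite !mulrA.
  have R3 : K * (r - x) <= K * d by rewrite ler_wpM2l//; lra.
  have R4 : c * x <= c * r by rewrite ler_pM2l// ltW.
  lra.
Qed.

Let th := 1 - al.
Let th01 : 0 < th < 1.
Proof. by move: al01; rewrite /th => /andP[? ?]; lra. Qed.

(** Formally [(Y ^ th)' = - 2 * th * A / Y ^ al = - (1 - m) * rayleigh], which is at least
    [- (1 - m) * rayleigh 0]; this is integrated up to the time [T], where [Y] vanishes. *)
Lemma extinction_upper t : 0 <= t < T ->
  Y t `^ ((1 - m) / 2) <= (1 - m) * rayleigh 0 * (T - t).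
Proof.
move=> /andP[t0 tT].
have -> : (1 - m) / 2 = th by rewrite /th /al; field.
have mE : 1 - m = 2 * th by rewrite /th /al; field.
have /andP[al0 al1] := al01; have /andP[th0 th1] := th01.
rewrite mE; set C := rayleigh 0.
have C0 : 0 <= C by rewrite /C /rayleigh divr_ge0 ?powR_ge0// A_ge0.
have A0 : 0 <= A 0 by exact: A_ge0.
(* The power [th < 1] has no tangent where [Y] vanishes, so the estimate stops at [b < T]. Then
   [b = T - g], with [g] so small that [Y b <= 2 * A 0 * g] contributes at most [e / 2]. *)
suff H e b : 0 < e -> t <= b -> b < T ->
    Y t `^ th <= Y b `^ th + 2 * th * (C + e) * (T - t).
  apply/ler_addgt0Pr => e e0.
  have K0 : 0 <= 2 * th * (T - t) by rewrite !mulr_ge0 ?subr_ge0 ?ltW.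
  have e20 : 0 < e / 2 by rewrite divr_gt0.
  have [c /andP[c0 _] ce] := exists_small ltr01 K0 e20.
  have A20 : 0 <= 2 * A 0 by rewrite mulr_ge0.
  have ep0 : 0 < (e / 2) `^ (th^-1) by rewrite powR_gt0.
  have Tt : 0 < T - t by rewrite subr_gt0.
  have [g /andP[g0 gt_] gA] := exists_small Tt A20 ep0.
  have tTg : t <= T - g by lra.
  have TgT : T - g < T by lra.
  apply: (le_trans (H c (T - g) c0 tTg TgT)).
  have YTg : Y (T - g) <= (e / 2) `^ (th^-1).
    apply: le_trans gA.
    have Tg0 : 0 <= T - g by exact: le_trans tTg.
    have := Y_le Tg0 (ltW TgT); rewrite Y_T subr0 => h; apply: (le_trans h).
    have -> : T - (T - g) = g by ring.
    by rewrite -mulrA ler_pM2l// mulrC ler_pM2r// A_noninc.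
  have YTg0 : 0 <= Y (T - g) by rewrite ltW// Y_gt0// TgT (le_trans t0).
  have : Y (T - g) `^ th <= e / 2.
    have <- : ((e / 2) `^ th^-1) `^ th = e / 2.
      by rewrite -powRrM mulVf ?gt_eqF// powRr1// ltW.
    by rewrite ge0_ler_powR ?(ltW th0)// nnegrE ?powR_ge0.
  move: ce; lra.
move=> e0 tb bT.
suff : Y t `^ th + 2 * th * (C + e) * t <= Y b `^ th + 2 * th * (C + e) * b.
  have : 2 * th * (C + e) * b <= 2 * th * (C + e) * T.
    by rewrite ler_wpM2l ?(ltW bT)// !mulr_ge0 ?(ltW th0)// addr_ge0// ltW.
  lra.
have Ce0 : 0 < C + e by rewrite ltr_wpDl.
apply: (@le_of_locally_nondecreasing _ (fun r => Y r `^ th + 2 * th * (C + e) * r)) => //.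
- move=> s /andP[ts sb] d d0.
  have s0 : 0 <= s by exact: le_trans ts.
  have sT : s < T by exact: lt_trans bT.
  have Ys0 : 0 < Y s by rewrite Y_gt0// s0.
  have As0 : 0 <= A s by exact: A_ge0.
  have b0 : 0 < Num.min d (b - s) by rewrite lt_min d0 subr_gt0.
  (* With a step [g] bounded through this constant, the first summand leaves at least half of [Y s],
     and the second limits the change of [Y ^ al]. *)
  have K0 : 0 <= (4 * A s + C * al * 4 * A s) / Y s.
    have Cal : 0 <= C * al by rewrite mulr_ge0// ltW.
    rewrite divr_ge0 ?(ltW Ys0)// addr_ge0//; first exact: mulr_ge0.
    by rewrite mulr_ge0// mulr_ge0.
  pose e1 := Num.min 1 e.
  have e10 : 0 < e1 by rewrite lt_min ltr01.
  have [g /andP[g0]] := exists_small b0 K0 e10.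
  rewrite lt_min => /andP[gd gb]; rewrite /e1 le_min => /andP[gK1 gKe].
  exists (s + g).
  have sg : s < s + g by rewrite ltrDl.
  have sgb : s + g < b by lra.
  split; rewrite ?ltrD2l ?(ltW sgb)//.
  set Yr := Y (s + g).
  have Yr0 : 0 < Yr by rewrite Y_gt0// addr_ge0 ?(ltW g0)//= (lt_trans sgb).
  have YY : Y s - Yr <= 2 * (g * A s).
    have := Y_le s0 (ltW sg); by have -> : s + g - s = g by ring.
  have YYn : Yr <= Y s by apply: Y_noninc => //; exact: ltW.
  have gA : 0 <= g * A s by rewrite mulr_ge0// ltW.
  rewrite mulrAC ler_pdivrMr// mul1r in gK1; rewrite mulrAC ler_pdivrMr// in gKe.
  have CA : 0 <= C * al * 4 * A s * g.
    have Cal : 0 <= C * al by rewrite mulr_ge0// ltW.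
    by apply: mulr_ge0; [apply: mulr_ge0 => //; apply: mulr_ge0|exact: ltW].
  have Yr2 : Y s <= 2 * Yr by lra.
  (* Concavity bounds the drop of [Y ^ th] from above by the tangent at the right end [Yr], whereas
     [A s] is bounded in terms of [Y s ^ al]. [rat] passes from one to the other at the price of
     [e]. *)
  have tang := powR_tangent th01 Yr0 (ltW Ys0).
  have thE : th - 1 = - al by rewrite /th; ring.
  rewrite thE powRN in tang.
  have Pr0 : 0 < Yr `^ al by exact: powR_gt0.
  have Ps0 : 0 < Y s `^ al by exact: powR_gt0.
  have ACY : A s <= C * Y s `^ al.
    by rewrite -ler_pdivrMr//; exact: rayleigh_noninc.
  have rat : C * Y s `^ al <= (C + e) * Yr `^ al.
    have tang2 := powR_tangent al01 Yr0 (ltW Ys0).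
    rewrite powRB ?powRr1 ?(ltW Yr0)// ?(gt_eqF Yr0) ?implybT// in tang2.
    have h1 : Y s `^ al - Yr `^ al <= Yr `^ al * (al * (2 * (g * A s)) / Yr).
      apply: (le_trans tang2).
      have -> : Yr `^ al * (al * (2 * (g * A s)) / Yr) =
        al * (Yr `^ al / Yr * (2 * (g * A s))) by field; rewrite gt_eqF.
      by rewrite ler_pM2l// ler_wpM2l// divr_ge0 ?powR_ge0// ltW.
    have h2 : C * (al * (2 * (g * A s)) / Yr) <= e.
      have -> : C * (al * (2 * (g * A s)) / Yr) = C * al * 2 * g * A s / Yr.
        by field; rewrite gt_eqF.
      have : e * Y s <= e * (2 * Yr) by rewrite ler_pM2l.
      by rewrite ler_pdivrMr//; lra.
    have h3 : C * (Y s `^ al - Yr `^ al) <= C * (Yr `^ al * (al * (2 * (g * A s)) / Yr)).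
      by rewrite ler_wpM2l.
    have h4 : Yr `^ al * (C * (al * (2 * (g * A s)) / Yr)) <= Yr `^ al * e.
      by rewrite ler_pM2l.
    lra.
  have fin : Y s `^ th - Yr `^ th <= th * (2 * (g * (C + e))).
    apply: (le_trans tang); rewrite ler_pM2l//.
    rewrite mulrC ler_pdivrMr//; apply: (le_trans YY).
    rewrite -!mulrA ler_pM2l// ler_pM2l//.
    exact: le_trans rat.
  lra.
- move=> s /andP[ts sb] e' e'0.
  have s0 : 0 <= s by rewrite (le_trans t0)// ltW.
  have Ys0 : 0 < Y s by rewrite Y_gt0// s0 (le_lt_trans sb).
  have K0 : 0 <= th * (Y s `^ (th - 1) * (2 * A 0)).
    by rewrite mulr_ge0 ?(ltW th0)// mulr_ge0 ?powR_ge0// mulr_ge0.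
  have [d /andP[d0 _] dK] := exists_small ltr01 K0 e'0.
  exists d => // x tx /andP[sx xs].
  have x0 : 0 <= x by exact: le_trans tx.
  have Yx : Y s <= Y x by exact: Y_noninc (ltW xs).
  have YY : Y x - Y s <= 2 * A 0 * (s - x).
    apply: (le_trans (Y_le x0 (ltW xs))).
    rewrite -mulrA ler_pM2l// mulrC ler_wpM2r ?subr_ge0 ?(ltW xs)//.
    exact: A_noninc.
  have tang : Y x `^ th - Y s `^ th <= th * (Y s `^ (th - 1) * (2 * A 0 * (s - x))).
    apply: (le_trans (powR_tangent th01 Ys0 (le_trans (ltW Ys0) Yx))).
    by rewrite ler_pM2l// ler_wpM2l// powR_ge0.
  have : th * (Y s `^ (th - 1) * (2 * A 0)) * (s - x) <=
      th * (Y s `^ (th - 1) * (2 * A 0)) * d by rewrite ler_wpM2l//; lra.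
  have : 2 * th * (C + e) * x <= 2 * th * (C + e) * s.
    by rewrite ler_wpM2l ?(ltW xs)// !mulr_ge0 ?(ltW th0)// ltW.
  lra.
Qed.

(** The same computation with the inequalities reversed: the tangent at the left end now bounds the
    drop of [Y ^ th] from below. The condition on the left uses only that [Y] is nonincreasing, so
    the argument reaches [T] itself. *)
Lemma extinction_lower c t : 0 <= c ->
  (forall r, 0 <= r < T -> c * Y r `^ ((1 + m) / 2) <= A r) -> 0 <= t < T ->
  (1 - m) * c * (T - t) <= Y t `^ ((1 - m) / 2).
Proof.
move=> c0 cA /andP[t0 tT].
have -> : (1 - m) / 2 = th by rewrite /th /al; field.
have mE : 1 - m = 2 * th by rewrite /th /al; field.
have /andP[al0 al1] := al01; have /andP[th0 th1] := th01.
rewrite mE.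
suff H e : 0 < e -> 2 * th * (c - e) * (T - t) <= Y t `^ th.
  apply/ler_addgt0Pr => e e0.
  have K0 : 0 <= 2 * th * (T - t) by rewrite !mulr_ge0 ?subr_ge0 ?ltW.
  have [x /andP[x0 _] xe] := exists_small ltr01 K0 e0.
  have := H x x0; lra.
move=> e0.
suff : - Y t `^ th - 2 * th * (c - e) * t <= - Y T `^ th - 2 * th * (c - e) * T.
  rewrite Y_T powR0 ?gt_eqF//; lra.
apply: (@le_of_locally_nondecreasing _ (fun r => - Y r `^ th - 2 * th * (c - e) * r)) => //.
- exact: ltW.
- move=> s /andP[ts sT] d d0.
  have s0 : 0 <= s by exact: le_trans ts.
  have Ys0 : 0 < Y s by rewrite Y_gt0// s0.
  have As0 : 0 <= A s by exact: A_ge0.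
  have b0 : 0 < Num.min d (T - s) by rewrite lt_min d0 subr_gt0.
  have K0 : 0 <= (2 * A s + 2 * c * A s) / Y s.
    by rewrite divr_ge0 ?(ltW Ys0)// addr_ge0// ?mulr_ge0.
  pose e1 := Num.min 1 e.
  have e10 : 0 < e1 by rewrite lt_min ltr01.
  have [g /andP[g0]] := exists_small b0 K0 e10.
  rewrite lt_min => /andP[gd gb]; rewrite /e1 le_min => /andP[gK1 gKe].
  exists (s + g).
  have sg : s < s + g by rewrite ltrDl.
  have sgb : s + g < T by lra.
  split; rewrite ?ltrD2l ?(ltW sgb)//.
  set Yr := Y (s + g).
  have sg0 : 0 <= s + g < T by rewrite sgb addr_ge0// ltW.
  have Yr0 : 0 < Yr by rewrite Y_gt0.
  have YY : Y s - Yr <= 2 * (g * A s).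
    have := Y_le s0 (ltW sg); by have -> : s + g - s = g by ring.
  have YY2 : 2 * (g * A (s + g)) <= Y s - Yr.
    have := Y_ge s0 (ltW sg); by have -> : s + g - s = g by ring.
  rewrite mulrAC ler_pdivrMr// mul1r in gK1; rewrite mulrAC ler_pdivrMr// in gKe.
  have gA : 0 <= g * A s by rewrite mulr_ge0// ltW.
  have cgA : 0 <= c * (g * A s) by rewrite mulr_ge0.
  have YYn : Yr <= Y s by apply: Y_noninc => //; exact: ltW.
  have Ps0 : 0 < Y s `^ al by exact: powR_gt0.
  have tang := powR_tangent th01 Ys0 (ltW Yr0).
  have thE : th - 1 = - al by rewrite /th; ring.
  rewrite thE powRN in tang.
  have rat : (c - e) * Y s `^ al <= A (s + g).
    apply: le_trans (cA _ sg0).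
    have h1 : Y s `^ al * (Yr / Y s) <= Yr `^ al.
      have q0 : 0 < Yr / Y s by rewrite divr_gt0.
      have q1 : Yr / Y s <= 1 by rewrite ler_pdivrMr// mul1r.
      have -> : Yr `^ al = Y s `^ al * (Yr / Y s) `^ al.
        rewrite -powRM ?(ltW Ys0) ?(ltW q0)//.
        by rewrite [Y s * _]mulrC divfK// gt_eqF.
      rewrite ler_pM2l// -[X in X <= _](@powRr1 _ (Yr / Y s)) ?(ltW q0)//.
      by rewrite ger_powR ?q0// ltW.
    have h2 : c - e <= c * (Yr / Y s).
      rewrite mulrA ler_pdivlMr//.
      have : c * (Y s - Yr) <= c * (2 * (g * A s)) by rewrite ler_wpM2l.
      lra.
    apply: (@le_trans _ _ (c * (Yr / Y s) * Y s `^ al)); first by rewrite ler_pM2r.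
    by rewrite -mulrA ler_wpM2l// mulrC.
  have h3 : 2 * (g * (c - e)) <= (Y s `^ al)^-1 * (Y s - Yr).
    rewrite [X in _ <= X]mulrC ler_pdivlMr//; apply: le_trans YY2.
    by rewrite -!mulrA ler_pM2l// ler_pM2l.
  have : th * (2 * (g * (c - e))) <= th * ((Y s `^ al)^-1 * (Y s - Yr)).
    by rewrite ler_pM2l.
  lra.
- move=> s /andP[ts sT] e' e'0.
  have K0 : 0 <= 2 * th * `|c - e| by rewrite !mulr_ge0// ltW.
  have [d /andP[d0 _] dK] := exists_small ltr01 K0 e'0.
  exists d => // x tx /andP[sx xs].
  have x0 : 0 <= x by exact: le_trans tx.
  have Yx : Y s <= Y x by exact: Y_noninc (ltW xs).
  have Ys0 : 0 <= Y s.
    move: sT; rewrite le_eqVlt => /predU1P[->|sT]; first by rewrite Y_T.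
    by rewrite ltW// Y_gt0// sT (le_trans x0)// ltW.
  have : Y s `^ th <= Y x `^ th.
    by rewrite ge0_ler_powR ?(ltW th0)// nnegrE// (le_trans Ys0).
  have : 2 * th * `|c - e| * (s - x) <= 2 * th * `|c - e| * d.
    by rewrite ler_wpM2l//; lra.
  have : 2 * th * (c - e) * (s - x) <= 2 * th * `|c - e| * (s - x).
    rewrite ler_wpM2r ?subr_ge0 ?(ltW xs)// ler_wpM2l ?ler_norm//.
    by rewrite mulr_ge0// ltW.
  lra.
Qed.

End scalar.

(** * Nonnegative kernels *)

Lemma cvg_integral_nondecreasing d (T : measurableType d) (R : realType)
    (mu : {measure set T -> \bar R}) (D : set T) (g : (T -> \bar R)^nat)
    (f : T -> \bar R) : measurable D ->
  (forall n, measurable_fun D (g n)) -> (forall n x, D x -> (0 <= g n x)%E) ->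
  (forall x, D x -> {homo g^~ x : n p / (n <= p)%N >-> (n <= p)%E}) ->
  (forall x, D x -> g n x @[n --> \oo] --> f x) ->
  (\int[mu]_(x in D) g n x)%E @[n --> \oo] --> (\int[mu]_(x in D) f x)%E.
Proof.
move=> mD mg g0 ndg gf.
have -> : (\int[mu]_(x in D) f x = \int[mu]_(x in D) limn (g^~ x))%E.
  by apply: eq_integral => x; rewrite inE => Dx; apply/esym/cvg_lim => //; exact: gf.
exact: cvg_monotone_convergence.
Qed.

Lemma measurable_fun_EFin d (T : measurableType d) (R : realType) (D : set T)
  (k : T -> R) : measurable_fun D k -> measurable_fun D (fun x => (k x)%:E).
Proof. by move=> mk; exact/(measurable_EFinP D k). Qed.

Lemma le_integralD d (T : measurableType d) (R : realType)
    (mu : {measure set T -> \bar R}) (f g h : T -> R) :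
  measurable_fun setT f -> measurable_fun setT g -> measurable_fun setT h ->
  (forall x, 0 <= f x) -> (forall x, 0 <= g x) -> (forall x, 0 <= h x) ->
  (forall x, f x <= g x + h x) ->
  (\int[mu]_x (f x)%:E <= \int[mu]_x (g x)%:E + \int[mu]_x (h x)%:E)%E.
Proof.
move=> mf mg mh f0 g0 h0 fgh.
have mE := @measurable_fun_EFin _ T R setT.
rewrite -ge0_integralD//.
- apply: ge0_le_integral => //.
  + by move=> x _; rewrite lee_fin.
  + exact: mE.
  + by apply: (mE (g \+ h)); exact: measurable_funD.
  + by move=> x _; rewrite -EFinD lee_fin.
- by move=> x _; rewrite lee_fin.
- exact: mE.
- by move=> x _; rewrite lee_fin.
- exact: mE.
Qed.

Definition nonneg_measurable d (T : measurableType d) (R : realType)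
  (f : T -> R) := measurable_fun setT f /\ forall x, 0 <= f x.

Section bilinear.
Context d (T : measurableType d) (R : realType).
Variables (mu : {finite_measure set T -> \bar R}) (K : T * T -> R) (Phi : T -> R).
Hypothesis K_nm : nonneg_measurable K.
Hypothesis mPhi : measurable_fun setT Phi.
Hypothesis Phi_gt0 : forall x, 0 < Phi x.
Local Notation nm := (@nonneg_measurable _ T R).

Definition kform (f g : T -> R) : \bar R :=
  (\int[mu \x mu]_z (f z.1 * K z * g z.2)%:E)%E.

Lemma kform_measurable f g : nm f -> nm g ->
  measurable_fun setT (fun z : T * T => f z.1 * K z * g z.2).
Proof.
move=> [mf _] [mg _]; have [mK _] := K_nm.
apply: measurable_funM.
  by apply: measurable_funM => //; exact: (measurableT_comp mf measurable_fst).
exact: (measurableT_comp mg measurable_snd).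
Qed.

Lemma kform_integrand_ge0 f g z : nm f -> nm g -> 0 <= f z.1 * K z * g z.2.
Proof.
by move=> [_ f0] [_ g0]; have [_ K0] := K_nm; rewrite !mulr_ge0.
Qed.

Lemma kform_ge0 f g : nm f -> nm g -> (0 <= kform f g)%E.
Proof.
by move=> nf ng; apply: integral_ge0 => z _; rewrite lee_fin kform_integrand_ge0.
Qed.

Lemma nmD f g : nm f -> nm g -> nm (f \+ g).
Proof.
move=> [mf f0] [mg g0]; split; first exact: measurable_funD.
by move=> x; rewrite addr_ge0.
Qed.

Lemma nmZ r f : 0 <= r -> nm f -> nm (fun x => r * f x).
Proof.
move=> r0 [mf f0]; split; first exact: measurable_funM.
by move=> x; rewrite mulr_ge0.
Qed.

Lemma nm_min f g : nm f -> nm g -> nm (fun x => Num.min (f x) (g x)).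
Proof.
move=> [mf f0] [mg g0]; split; first exact: measurable_minr.
by move=> x; rewrite le_min f0 g0.
Qed.

Lemma nm_mul f g : nm f -> nm g -> nm (fun x => f x * g x).
Proof.
move=> [mf f0] [mg g0]; split; first exact: measurable_funM.
by move=> x; rewrite mulr_ge0.
Qed.

Lemma nm_cst r : 0 <= r -> nm (fun=> r).
Proof. by move=> r0; split => //; exact: measurable_cst. Qed.

Lemma nm_powR f p : nm f -> nm (fun x => f x `^ p).
Proof.
move=> [mf f0]; split; last by move=> x; exact: powR_ge0.
exact: (measurableT_comp (measurable_powR p)).
Qed.

Lemma nm_dist f g : nm f -> nm g -> nm (fun x => `|f x - g x|).
Proof.
move=> [mf f0] [mg g0]; split => //.
by apply: measurableT_comp => //; exact: measurable_funB.
Qed.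

Lemma nmPhi : nm Phi. Proof. by split => // x; exact: ltW. Qed.

Lemma kformDr f g h : nm f -> nm g -> nm h ->
  (kform f (g \+ h)%R = kform f g + kform f h)%E.
Proof.
move=> nf ng nh; rewrite /kform -ge0_integralD//.
- by apply: eq_integral => z _; rewrite -EFinD mulrDr.
- by move=> z _; rewrite lee_fin kform_integrand_ge0.
- by apply: measurable_fun_EFin; exact: kform_measurable.
- by move=> z _; rewrite lee_fin kform_integrand_ge0.
- by apply: measurable_fun_EFin; exact: kform_measurable.
Qed.

Lemma kformZr r f g : 0 <= r -> nm f -> nm g ->
  (kform f (fun x => r * g x)%R = r%:E * kform f g)%E.
Proof.
move=> r0 nf ng; rewrite /kform -ge0_integralZl_EFin//.
- by apply: eq_integral => z _; rewrite -EFinM mulrCA.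
- by move=> z _; rewrite lee_fin kform_integrand_ge0.
- by apply: measurable_fun_EFin; exact: kform_measurable.
Qed.

Lemma kformZl r f g : 0 <= r -> nm f -> nm g ->
  (kform (fun x => r * f x)%R g = r%:E * kform f g)%E.
Proof.
move=> r0 nf ng; rewrite /kform -ge0_integralZl_EFin//.
- by apply: eq_integral => z _; rewrite -EFinM !mulrA.
- by move=> z _; rewrite lee_fin kform_integrand_ge0.
- by apply: measurable_fun_EFin; exact: kform_measurable.
Qed.

Lemma le_kform f f' g g' : nm f -> nm f' -> nm g -> nm g' ->
  (forall x, f x <= f' x) -> (forall x, g x <= g' x) -> (kform f g <= kform f' g')%E.
Proof.
move=> nf nf' ng ng' ff gg; apply: ge0_le_integral => //.
- by move=> z _; rewrite lee_fin kform_integrand_ge0.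
- by apply: measurable_fun_EFin; exact: kform_measurable.
- by apply: measurable_fun_EFin; exact: kform_measurable.
move=> z _; rewrite lee_fin.
have [[[_ f0] [_ g0]] [_ K0]] := (nf, ng, K_nm).
by rewrite ler_pM// ?mulr_ge0// ler_wpM2r.
Qed.

(** The weak formulation admits test functions that are bounded multiples of [Phi]. As [Phi > 0],
    every nonnegative function is the increasing limit of its truncations at [n * Phi], so
    identities known for dominated functions extend by monotone convergence. *)
Definition trunc (f : T -> R) n (x : T) := Num.min (f x) (n%:R * Phi x).
Definition dominated (f : T -> R) := exists n : nat, forall x, f x <= n%:R * Phi x.

Lemma trunc_nm f n : nm f -> nm (trunc f n).
Proof. by move=> nf; apply: nm_min => //; apply: nmZ => //; exact: nmPhi. Qed.

Lemma trunc_dominated f n : dominated (trunc f n).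
Proof. by exists n => x; rewrite ge_min lexx orbT. Qed.

Lemma trunc_le f n x : trunc f n x <= f x.
Proof. by rewrite ge_min lexx. Qed.

Lemma trunc_homo f x : {homo trunc f ^~ x : n p / (n <= p)%N >-> n <= p}.
Proof.
move=> n p np; rewrite /trunc le_min ge_min lexx /=.
by rewrite ge_min ler_wpM2r ?orbT ?ler_nat// ltW.
Qed.

Lemma trunc_eventually f x : \forall n \near \oo, trunc f n x = f x.
Proof.
exists (Num.Def.truncn (f x / Phi x)).+1 => // n /= ln.
apply/min_idPl; rewrite -ler_pdivrMr//.
apply: ltW; apply: lt_le_trans (truncnS_gt _) _.
by rewrite ler_nat.
Qed.

Lemma cvg_kform_trunc f g : nm f -> nm g ->
  kform (trunc f n) (trunc g n) @[n --> \oo] --> kform f g.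
Proof.
move=> nf ng; have [mK K0] := K_nm.
apply: cvg_integral_nondecreasing => //.
- by move=> n; apply: measurable_fun_EFin; apply: kform_measurable; exact: trunc_nm.
- by move=> n z _; rewrite lee_fin kform_integrand_ge0//; exact: trunc_nm.
- move=> z _ n p np; rewrite lee_fin.
  have [_ f0] := trunc_nm n nf; have [_ g0] := trunc_nm n ng.
  by rewrite ler_pM ?mulr_ge0// ?ler_wpM2r// trunc_homo.
- move=> z _; apply: cvg_near_cst.
  near=> n.
  have -> : trunc f n z.1 = f z.1 by near: n; exact: trunc_eventually.
  by have -> : trunc g n z.2 = g z.2 by near: n; exact: trunc_eventually.
Unshelve. all: end_near. Qed.

Lemma cvg_kform_truncl f g : nm f -> nm g ->
  kform (trunc f n) g @[n --> \oo] --> kform f g.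
Proof.
move=> nf ng; have [mK K0] := K_nm; have [_ g0] := ng.
apply: cvg_integral_nondecreasing => //.
- by move=> n; apply: measurable_fun_EFin; apply: kform_measurable => //; exact: trunc_nm.
- by move=> n z _; rewrite lee_fin kform_integrand_ge0//; exact: trunc_nm.
- move=> z _ n p np; rewrite lee_fin.
  have [_ f0] := trunc_nm n nf.
  by rewrite ler_wpM2r// ler_wpM2r// trunc_homo.
- move=> z _; apply: cvg_near_cst.
  near=> n.
  by have -> : trunc f n z.1 = f z.1 by near: n; exact: trunc_eventually.
Unshelve. all: end_near. Qed.

Hypothesis kform_sym_dominated : forall f g, nm f -> nm g ->
  dominated f -> dominated g -> kform f g = kform g f.
Hypothesis kform_psd_dominated : forall f g, nm f -> nm g ->
  dominated f -> dominated g ->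
  (kform f g + kform g f <= kform f f + kform g g)%E.

Lemma kform_sym f g : nm f -> nm g -> kform f g = kform g f.
Proof.
move=> nf ng; apply: (@cvg_unique _ (@ereal_hausdorff R) _ _ _ _ (cvg_kform_trunc nf ng)).
apply: cvg_trans (cvg_kform_trunc ng nf); apply: near_eq_cvg; near=> n.
by apply: kform_sym_dominated; [exact: trunc_nm|exact: trunc_nm|
  exact: trunc_dominated|exact: trunc_dominated].
Unshelve. all: end_near. Qed.

(** Nonnegativity of the form at [f - g], written without subtraction so that it makes sense for
    infinite values. *)
Lemma kform_psd f g : nm f -> nm g ->
  (kform f g + kform f g <= kform f f + kform g g)%E.
Proof.
move=> nf ng.
have h1 n : (kform (trunc f n) (trunc g n) + kform (trunc f n) (trunc g n) <=
    kform f f + kform g g)%E.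
  have [tf tg] := (trunc_nm n nf, trunc_nm n ng).
  rewrite {2}kform_sym//; apply: (le_trans (kform_psd_dominated _ _ _ _)) => //; try exact: trunc_dominated.
  by apply: leeD; apply: le_kform => // x; exact: trunc_le.
have := cvg_kform_trunc nf ng => h.
have c2 : (kform (trunc f n) (trunc g n) + kform (trunc f n) (trunc g n))%E @[n --> \oo] -->
    (kform f g + kform f g)%E.
  by apply: cvgeD => //; apply: ge0_adde_def; rewrite inE; exact: kform_ge0.
apply: (cvge_to_le c2); near=> n; exact: h1.
Unshelve. all: end_near. Qed.

(** Cauchy-Schwarz. Positivity is applied to [f] and [l * g] with [l >= 0], which keeps both
    arguments nonnegative, and [l] is then optimised. *)
Lemma kform_sqrt f g : nm f -> nm g -> (kform f f < +oo)%E -> (kform g g < +oo)%E ->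
  (kform f g < +oo)%E /\
  fine (kform f g) <= Num.sqrt (fine (kform f f)) * Num.sqrt (fine (kform g g)).
Proof.
move=> nf ng foo goo.
have [[f0 g0] fg0] := (kform_ge0 nf nf, kform_ge0 ng ng, kform_ge0 nf ng).
have fF : kform f f \is a fin_num by rewrite ge0_fin_numE.
have gF : kform g g \is a fin_num by rewrite ge0_fin_numE.
have fgoo : (kform f g < +oo)%E.
  have := kform_psd nf ng; move: (kform f g) fg0 => [r| |]//= _.
    by rewrite ltry.
  by rewrite -(fineK fF) -(fineK gF).
split=> //.
have fgF : kform f g \is a fin_num by rewrite ge0_fin_numE.
have H l : 0 <= l -> 2 * l * fine (kform f g) <= fine (kform f f) + l ^+ 2 * fine (kform g g).
  move=> l0; have nlg := nmZ l0 ng.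
  have := kform_psd nf nlg.
  rewrite !kformZr// kformZl// -(fineK fF) -(fineK gF) -(fineK fgF) -!EFinM -!EFinD lee_fin.
  lra.
have a0 : 0 <= fine (kform f f) by exact: fine_ge0.
have c0 : 0 <= fine (kform g g) by exact: fine_ge0.
have b0 : 0 <= fine (kform f g) by exact: fine_ge0.
move: (fine (kform f f)) (fine (kform g g)) (fine (kform f g)) H a0 c0 b0 => a c b H.
move=> a0 c0 b0.
have sa := sqr_sqrtr a0; have sc := sqr_sqrtr c0.
have x0 := sqrtr_ge0 a; have y0 := sqrtr_ge0 c.
move: (Num.sqrt a) (Num.sqrt c) sa sc x0 y0 => x y sa sc x0 y0.
rewrite -{}sa -{}sc in H.
apply/ler_addgt0Pr => e e0.
have xy0 : 0 <= x * y by exact: mulr_ge0.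
(* The optimal choice is [l = x / y]. If [y = 0] a large [l], and if [x = 0] a small positive one,
   are tuned to give [b <= e]. *)
move: y0; rewrite le_eqVlt => /predU1P[y0|y0].
  have l0 : 0 <= (x ^+ 2 + 1) / (2 * e) by rewrite divr_ge0 ?addr_ge0 ?sqr_ge0 ?mulr_ge0 ?(ltW e0).
  have := H _ l0; rewrite -y0 expr0n/= !mulr0 addr0 add0r.
  have -> : 2 * ((x ^+ 2 + 1) / (2 * e)) * b = (x ^+ 2 + 1) * b / e by field; rewrite gt_eqF.
  rewrite ler_pdivrMr// => h.
  have x2 : 0 < x ^+ 2 + 1 by rewrite ltr_wpDl// sqr_ge0.
  rewrite -(ler_pM2l x2); apply: (le_trans h); lra.
move: x0; rewrite le_eqVlt => /predU1P[x0|x0].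
  have l0 : 0 < e / y ^+ 2 by rewrite divr_gt0// exprn_gt0.
  have := H _ (ltW l0); rewrite -x0 expr0n/= mul0r !add0r.
  have -> : (e / y ^+ 2) ^+ 2 * y ^+ 2 = (e / y ^+ 2) * e by field; rewrite gt_eqF.
  have -> : 2 * (e / y ^+ 2) * b = e / y ^+ 2 * (2 * b) by ring.
  rewrite ler_pM2l//; lra.
have l0 : 0 < x / y by rewrite divr_gt0.
have := H _ (ltW l0); have -> : x ^+ 2 + (x / y) ^+ 2 * y ^+ 2 = 2 * (x / y) * (x * y).
  by field; rewrite gt_eqF.
have l20 : 0 < 2 * (x / y) by rewrite mulr_gt0.
by rewrite ler_pM2l// => h; rewrite (le_trans h)// lerDl ltW.
Qed.

End bilinear.

(** * Weak derivatives in time *)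

Section primitives.
Variable R : realType.
Local Notation leb := (@lebesgue_measure R).

Lemma continuous_integrable_cc (f : R -> R) (a b : R) : continuous f ->
  leb.-integrable `[a, b] (EFin \o f).
Proof.
move=> cf; apply: continuous_compact_integrable; first exact: segment_compact.
exact: continuous_subspaceT.
Qed.

Definition has_primitive_on (A : set R) (f F : R -> R) :=
  forall x, A x -> derivable F x 1 /\ derive1 F x = f x.

(** Used with [c = -1], which makes the time [0] an interior point, so that the primitive has a
    two-sided derivative there. *)
Lemma primitive_gt (f : R -> R) (c : R) : continuous f ->
  exists F, has_primitive_on [set x | c < x] f F.
Proof.
move=> cf; exists (fun x => \int[leb]_(t in `[c, x]) f t) => x /= cx.
have xu : x < x + 1 by rewrite ltrDl.
apply: (continuous_FTC1_closed xu) => //.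
- exact: continuous_integrable_cc.
- exact: cf.
Qed.

Lemma primitive_continuous A f F x : has_primitive_on A f F -> A x ->
  {for x, continuous F}.
Proof.
by move=> /(_ x) h /h[dF _]; apply/differentiable_continuous/derivable1_diffP.
Qed.

Lemma primitive_LR f F a b : has_primitive_on `[a, b] f F -> a < b ->
  derivable_oo_LRcontinuous F a b.
Proof.
move=> H ab.
have ca : {for a, continuous F}.
  by apply: (primitive_continuous H); rewrite /= in_itv/= lexx ltW.
have cb : {for b, continuous F}.
  by apply: (primitive_continuous H); rewrite /= in_itv/= lexx ltW.
split.
- move=> x /= xab; apply: (proj1 (H x _)).
  by move: xab; rewrite /= !in_itv/= => /andP[/ltW -> /ltW ->].
- by apply: cvg_at_right_filter.
- by apply: cvg_at_left_filter.
Qed.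

Lemma integral_primitive f F a b : continuous f -> has_primitive_on `[a, b] f F ->
  a <= b -> (\int[leb]_(x in `[a, b]) (f x)%:E)%E = (F b - F a)%:E.
Proof.
move=> cf H; rewrite le_eqVlt => /predU1P[->|ab].
  by rewrite set_itv1 integral_set1 subrr.
rewrite (@continuous_FTC2 _ f F)//.
- exact: continuous_subspaceT.
- exact: (@primitive_LR f).
- move=> x xab; apply: (proj2 (H x _)).
  by move: xab; rewrite /= !in_itv/= => /andP[/ltW -> /ltW ->].
Qed.

Lemma Rintegral_oo_cc f (a b : R) : continuous f -> a < b ->
  \int[leb]_(x in `]a, b[) f x = \int[leb]_(x in `[a, b]) f x.
Proof.
move=> cf ab; rewrite /Rintegral; congr fine.
rewrite (@integral_itv_bndoo _ a b _ true false)//.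
apply: (@measurable_funS _ _ _ _ setT) => //.
apply: measurable_fun_EFin.
exact: continuous_measurable_fun.
Qed.

Lemma continuous_mul (f g : R -> R) : continuous f -> continuous g ->
  continuous (fun x => f x * g x).
Proof. by move=> cf cg x; apply: (@continuousM _ _ f g x); [exact: cf|exact: cg]. Qed.

(* The test function is the primitive of [k (W - c)], with [W = U + Q], [k] a
   continuous bump and [c] the [k]-mean of [W]: after an integration by parts
   the weak equation says that the integral of [k (W - c) ^ 2] vanishes. *)
Lemma weak_primitive_constant (U V Q : R -> R) (T : R) :
  continuous U -> continuous V -> 0 < T ->
  has_primitive_on [set x | -1 < x] V Q ->
  (forall th dth : R -> R,
    (forall t : R, derivable th t 1 /\ derive1 th t = dth t) -> continuous dth ->
    (exists a b : R, [/\ 0 < a, b < T & forall t : R, ~ (a <= t <= b) -> th t = 0]) ->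
    \int[leb]_(t in `]0, T[) (U t * dth t) = \int[leb]_(t in `]0, T[) (V t * th t)) ->
  forall a b : R, 0 < a -> a <= b -> b < T -> U a + Q a = U b + Q b.
Proof.
move=> cU cV T0 HQ H a b a0 ab bT.
(* The bump lives on [[a', b']], which is contained in []0, T[] and has [a] and [b] in its
   interior. *)
pose a' := a / 2; pose b' := (b + T) / 2.
have a'0 : 0 < a' by rewrite /a'; lra.
have a'a : a' < a by rewrite /a'; lra.
have b'b : b < b' by rewrite /b'; lra.
have b'T : b' < T by rewrite /b'; lra.
pose k (t : R) : R := Num.max 0 (t - a') * Num.max 0 (b' - t).
have ck : continuous k.
  apply: continuous_mul => x.
    by apply: (@continuous_max _ _ (fun=> 0) (fun t : R => t - a')); [exact: cst_continuous|apply: continuousB => //; exact: cst_continuous].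
  by apply: (@continuous_max _ _ (fun=> 0) (fun t : R => b' - t)); [exact: cst_continuous|apply: continuousB => //; exact: cst_continuous].
have k0 t : 0 <= k t by rewrite mulr_ge0// le_max lexx.
have kin t : a' < t < b' -> 0 < k t.
  by move=> /andP[h1 h2]; rewrite mulr_gt0// lt_max subr_gt0 ?h1 ?h2 orbT.
have kout t : ~ (a' <= t <= b') -> k t = 0.
  move=> /negP; rewrite negb_and -!ltNge => /orP[h|h].
    by rewrite /k (max_idPl _) ?mul0r// subr_le0 ltW.
  by rewrite /k [X in _ * X](max_idPl _) ?mulr0// subr_le0 ltW.
(* [Q] is under control only to the right of [-1]. Freezing it for negative times gives a function
   continuous on the whole line, without change on [[0, T]]. *)
pose W (t : R) : R := U t + Q (Num.max t 0).
have cQ : continuous (fun t : R => Q (Num.max t 0)).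
  move=> x; apply: (@continuous_comp _ _ _ (fun t : R => Num.max t 0) Q).
    by apply: (@continuous_max _ _ (id : R -> R) (fun=> 0)) => //; exact: cst_continuous.
  apply: (primitive_continuous HQ) => /=.
  by rewrite (lt_le_trans (ltrN10 R))// le_max lexx orbT.
have cW : continuous W by move=> x; apply: continuousD; [exact: cU|exact: cQ].
have kW : continuous (fun t : R => k t * W t) by exact: continuous_mul.
pose I (f : R -> R) : R := \int[leb]_(t in `[0, T]) f t.
have ID (f g : R -> R) : continuous f -> continuous g -> I (f \+ g) = I f + I g.
  by move=> cf cg; rewrite /I RintegralD//; exact: continuous_integrable_cc.
have IZ (r : R) (f : R -> R) : continuous f -> I (fun x => r * f x) = r * I f.
  by move=> cf; rewrite /I RintegralZl//; exact: continuous_integrable_cc.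
have IP (f F : R -> R) : continuous f -> has_primitive_on [set x | -1 < x] f F ->
    forall x y : R, 0 <= x -> x <= y -> \int[leb]_(t in `[x, y]) f t = F y - F x.
  move=> cf HF x y x0 xy; rewrite /Rintegral (integral_primitive cf _ xy (F := F))//.
  move=> z /=; rewrite in_itv/= => /andP[xz _]; apply: HF => /=.
  by rewrite (lt_le_trans (ltrN10 R))// (le_trans x0).
(* A continuous nonnegative function of zero integral vanishes: its primitive is monotone with equal
   end values, hence constant. *)
have Ipos (f : R -> R) : continuous f -> (forall x, 0 <= f x) -> I f <= 0 ->
    forall x : R, 0 < x < T -> f x = 0.
  move=> cf f0 If x /andP[x0 xT].
  have [P HP] := primitive_gt (-1) cf.
  have T0' := ltW T0.
  have PT : P T - P 0 <= 0 by rewrite -(IP f P cf HP).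
  have Pm (y z : R) : 0 <= y -> y <= z -> P y <= P z.
    by move=> y0 yz; rewrite -subr_ge0 -(IP f P cf HP)//; apply: Rintegral_ge0.
  have Pc (y : R) : 0 <= y -> y <= T -> P y = P 0.
    move=> y0 yT; apply/eqP; rewrite eq_le; apply/andP; split; last exact: Pm.
    by rewrite (le_trans (Pm _ _ y0 yT))// -subr_le0.
  have [|dP <-] := HP x; first by rewrite /= (lt_trans (ltrN10 R)).
  rewrite derive1E (@near_eq_derive _ _ _ P (cst (P 0)))//; last first.
    have : \forall z \near x, z \in `]0, T[.
      by apply: near_in_itvoo; rewrite in_itv/= x0.
    apply: filterS => z; rewrite in_itv/= => /andP[z0 zT].
    by rewrite Pc// ltW.
  by rewrite derive_cst.
have Ik : 0 < I k.
  rewrite lt_neqAle Rintegral_ge0// andbT; apply/negP => /eqP Ik0.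
  have aT : 0 < a < T by rewrite a0 (le_lt_trans ab).
  have := Ipos k ck k0 _ a aT; rewrite -Ik0 lexx => /(_ isT) ka.
  by have := kin a; rewrite ka ltxx a'a (le_lt_trans ab b'b) => /(_ isT).
pose c := I (fun t : R => k t * W t) / I k.
pose g (t : R) : R := k t * (W t - c).
have cg : continuous g.
  apply: continuous_mul => // x; apply: continuousB; [exact: cW|exact: cst_continuous].
(* The zero mean, which is why [c] is subtracted, makes the primitive [th] of [g] vanish also beyond
   [b'], so that it is an admissible test function. *)
have Ig : I g = 0.
  have -> : g = (fun t : R => k t * W t) \+ (fun t : R => (- c) * k t).
    by apply/funext => t; rewrite /g /=; ring.
  rewrite ID//; last by apply: continuous_mul => //; exact: cst_continuous.
  by rewrite IZ// mulNr divfK ?subrr// gt_eqF.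
have gout (t : R) : ~ (a' <= t <= b') -> g t = 0 by move=> h; rewrite /g kout ?mul0r.
have gint : leb.-integrable setT (EFin \o g).
  have : leb.-integrable setT ((EFin \o g) \_ `[a', b']).
    apply: (proj1 (integrable_mkcond _ _)) => //. exact: continuous_integrable_cc.
  congr (integrable _ _ _); apply/funext => x; rewrite patchE; case: ifPn => //.
  by rewrite notin_setE /= in_itv/= => h; rewrite gout.
pose th (x : R) : R := \int[leb]_(t in `]-oo, x]) g t.
have dth (t : R) : derivable th t 1 /\ derive1 th t = g t.
  have tu : t < t + 1 by rewrite ltrDl.
  apply: (continuous_FTC1 tu) => //.
  - exact: (integrableS measurableT _ _ gint).
  - by rewrite ltNyr.
  - exact: cg.
have thE (x y : R) : x <= y -> th y = th x + \int[leb]_(t in `]x, y]) g t.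
  move=> xy; rewrite /th -Rintegral_setU//.
  - by congr (Rintegral _ _ _); rewrite -itv_bndbnd_setU.
  - by apply: (integrableS measurableT _ _ gint) => //; exact: measurableU.
  - rewrite disj_set2E; apply/eqP/seteqP; split => // z [/=].
    rewrite !in_itv/= => h /andP[h2 _].
    by move: (lt_le_trans h2 h); rewrite ltxx.
have th_lo (x : R) : x < a' -> th x = 0.
  move=> xa; rewrite /th (@eq_Rintegral _ _ _ _ _ (fun=> 0)).
    by rewrite Rintegral_cst//= mul0r.
  move=> z; rewrite inE /= in_itv/= => zx; rewrite gout// => /andP[h _].
  by move: (le_lt_trans h (le_lt_trans zx xa)); rewrite ltxx.
have th0 : th 0 = 0 by exact: th_lo.
have thT : th T = 0.
  rewrite (thE 0 T (ltW T0)) th0 add0r Rintegral_itv_obnd_cbnd; first exact: Ig.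
  exact: (integrableS measurableT _ _ gint).
have th_hi (x : R) : b' < x -> th x = 0.
  move=> bx.
  have z0 (u v : R) : b' < u -> u <= v -> th u = th v.
    move=> bu uv; rewrite (thE u v uv) (@eq_Rintegral _ _ _ _ _ (fun=> 0)).
      by rewrite Rintegral_cst//= mul0r addr0.
    move=> z; rewrite inE /= in_itv/= => /andP[uz _]; rewrite gout// => /andP[_ h].
    by move: (le_lt_trans h (lt_trans bu uz)); rewrite ltxx.
  by case: (leP x T) => xT; [rewrite (z0 x T)|rewrite -(z0 T x)// ltW].
have cth : continuous th.
  by move=> x; apply: (primitive_continuous (A := setT) (f := g)).
have HH := H th g dth cg _.
have {}HH : I (fun t : R => U t * g t) = I (fun t : R => V t * th t).
  rewrite /I -Rintegral_oo_cc//; last exact: continuous_mul.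
  rewrite -[RHS]Rintegral_oo_cc//; last exact: continuous_mul.
  apply: HH; exists a', b'; split => // t.
  move=> /negP; rewrite negb_and -!ltNge => /orP[h|h]; [exact: th_lo|exact: th_hi].
have parts : I (fun t : R => Q t * g t) = - I (fun t : R => V t * th t).
  rewrite /I (@Rintegration_by_parts _ Q th V g)//.
  - by rewrite th0 thT !mulr0 subrr sub0r.
  - exact: continuous_subspaceT.
  - apply: (@primitive_LR V) => // z; rewrite /= in_itv/= => /andP[z0 _].
    by apply: HQ => /=; rewrite (lt_le_trans (ltrN10 R)).
  - move=> z; rewrite in_itv/= => /andP[z0 _].
    by apply: (proj2 (HQ z _)) => /=; rewrite (lt_trans (ltrN10 R)).
  - exact: continuous_subspaceT.
  - by apply: (@primitive_LR g) => // z _.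
  - by move=> z _; exact: (proj2 (dth z)).
have IWg : I (fun t : R => W t * g t) = 0.
  have -> : (fun t : R => W t * g t) = (fun t : R => U t * g t) \+ (fun t : R => Q (Num.max t 0) * g t).
    by apply/funext => t /=; rewrite /W mulrDl.
  rewrite ID; [|exact: continuous_mul|exact: continuous_mul].
  rewrite HH.
  have -> : I (fun t : R => Q (Num.max t 0) * g t) = I (fun t : R => Q t * g t).
    apply: eq_Rintegral => t; rewrite inE /= in_itv/= => /andP[t0 _].
    by rewrite (max_idPl t0).
  by rewrite parts subrr.
have sq : I (fun t : R => k t * (W t - c) ^+ 2) = 0.
  have -> : (fun t : R => k t * (W t - c) ^+ 2) = (fun t : R => W t * g t) \+ (fun t : R => (- c) * g t).
    by apply/funext => t /=; rewrite /g; ring.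
  rewrite ID; [|exact: continuous_mul|].
    by rewrite IZ// Ig mulr0 addr0.
  by apply: continuous_mul => //; exact: cst_continuous.
have csq : continuous (fun t : R => k t * (W t - c) ^+ 2).
  have -> : (fun t : R => k t * (W t - c) ^+ 2) = (fun t : R => g t * (W t - c)).
    by apply/funext => t; rewrite /g; ring.
  by apply: continuous_mul => // x; apply: continuousB; [exact: cW|exact: cst_continuous].
have fin (x : R) : a' < x < b' -> 0 < x -> U x + Q x = c.
  move=> xab x0.
  have xT : x < T by case/andP: xab => _ /lt_trans; apply.
  have := Ipos _ csq _ _ x; rewrite sq lexx x0 xT => /(_ _ isT isT) h.
  have {h} : k x * (W x - c) ^+ 2 = 0.
    by apply: h => t; rewrite mulr_ge0// sqr_ge0.
  move/eqP; rewrite mulf_eq0 (gt_eqF (kin _ xab))/= expf_eq0/= subr_eq0 => /eqP.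
  by rewrite /W (max_idPl (ltW x0)).
rewrite (fin a) ?a'a ?(le_lt_trans ab)// (fin b) ?b'b ?(lt_le_trans a'a)//.
exact: lt_le_trans ab.
Qed.

End primitives.

(** * Energy and dissipation *)

Lemma continuous_eps (R : realType) (f : R -> R) :
  (forall t e, 0 < e -> exists2 d, 0 < d & forall r, `|r - t| < d -> `|f r - f t| <= e) ->
  continuous f.
Proof.
move=> H t; apply/cvgrPdist_le => e e0.
have [d d0 hd] := H t e e0.
by exists d => //= r /= rt; rewrite distrC; apply: hd; rewrite distrC.
Qed.

Lemma fine_dist_le (R : realType) (a b : \bar R) (e : R) :
  a \is a fin_num -> b \is a fin_num ->
  (a <= b + e%:E)%E -> (b <= a + e%:E)%E -> `|fine a - fine b| <= e.
Proof.
move=> /fineK <- /fineK <-; rewrite -!EFinD !lee_fin /= => h1 h2.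
by rewrite ler_norml; apply/andP; split; lra.
Qed.

(** * Integrals of nonnegative functions over compact intervals *)

Section interval_integrals.
Variables (R : realType) (F : R -> \bar R).
Hypotheses (mF : measurable_fun setT F) (F0 : forall r, (0 <= F r)%E).
Local Notation leb := (@lebesgue_measure R).

Let mFD (D : set R) : measurable_fun D F.
Proof. exact: (@measurable_funS _ _ _ _ setT). Qed.

Let int_cst (s t c : R) : s <= t ->
  (\int[leb]_(r in `[s, t]) c%:E = ((t - s) * c)%:E)%E.
Proof.
move=> st; rewrite integral_cst//= lebesgue_measure_itv/= lte_fin.
move: st; rewrite le_eqVlt => /predU1P[->|st].
  by rewrite ltxx mule0 subrr mul0r.
by rewrite st -EFinB -EFinM mulrC.
Qed.

Lemma itv_integral_ge (s t c : R) : s <= t ->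
  (forall r, s <= r <= t -> (c%:E <= F r)%E) ->
  (((t - s) * c)%:E <= \int[leb]_(r in `[s, t]) F r)%E.
Proof.
move=> st cF; case: (leP 0 c) => c0.
  rewrite -int_cst//; apply: ge0_le_integral => //.
  exact: mFD.
(* A negative [c] has to be allowed, since the lemma is applied with constants of the form
   [j s - e]; the bound is then trivial. *)
apply: (@le_trans _ _ 0%E); last by apply: integral_ge0 => r _.
by rewrite lee_fin mulr_ge0_le0 ?subr_ge0// ltW.
Qed.

Lemma itv_integral_le (s t c : R) : s <= t ->
  (forall r, s <= r <= t -> (F r <= c%:E)%E) ->
  (\int[leb]_(r in `[s, t]) F r <= ((t - s) * c)%:E)%E.
Proof.
move=> st cF; rewrite -int_cst//; apply: ge0_le_integral => //.
exact: mFD.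
Qed.

Lemma itv_integral_split (s q t : R) : s <= q -> q <= t ->
  (\int[leb]_(r in `[s, t]) F r =
   \int[leb]_(r in `[s, q]) F r + \int[leb]_(r in `[q, t]) F r)%E.
Proof.
move=> sq qt; rewrite -[X in (_ + X)%E]integral_itv_obnd_cbnd; last exact: mFD.
rewrite -ge0_integral_setU//.
- by rewrite -itv_bndbnd_setU// bnd_simp.
- exact: mFD.
- rewrite disj_set2E; apply/eqP/seteqP; split => // z [/=].
  rewrite !in_itv/= => /andP[_ h] /andP[h2 _].
  by move: (lt_le_trans h2 h); rewrite ltxx.
Qed.

End interval_integrals.

(* [B s t], [Z r t] and [A t] stand for the inner product of [u s] and [u t] in
   H^*, the integral of [u t ^ m * u r] and that of [u t ^ (1 + m)]; the [J k]
   approximate [Z] from below and, unlike [Z], are continuous. *)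
Section dissipation.
Variables (R : realType) (m : R) (B Z : R -> R -> \bar R) (A : R -> \bar R)
  (J : nat -> R -> R -> \bar R).
Local Notation leb := (@lebesgue_measure R).
Local Notation Y t := (B t t).
Hypothesis m01 : 0 < m < 1.
Hypothesis B_ge0 : forall s t, (0 <= B s t)%E.
Hypothesis B_sym : forall s t, B s t = B t s.
Hypothesis B_sqrt : forall s t, (Y s < +oo)%E -> (Y t < +oo)%E ->
  (B s t < +oo)%E /\ fine (B s t) <= Num.sqrt (fine (Y s)) * Num.sqrt (fine (Y t)).
Hypothesis Z_ge0 : forall r t, (0 <= Z r t)%E.
Hypothesis measurable_Z : forall r, measurable_fun setT (Z r).
Hypothesis duality : forall r a b : R, 0 <= a -> a <= b ->
  (B r a = B r b + \int[leb]_(t in `[a, b]) Z r t)%E.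
Hypothesis power_mass_ge0 : forall t, (0 <= A t)%E.
Hypothesis power_massE : forall t, A t = Z t t.
Hypothesis reaction_young : forall r t,
  (Z r t <= (m / (1 + m))%:E * A t + (1 + m)^-1%:E * A r)%E.
Hypothesis J_ge0 : forall k t r, (0 <= J k t r)%E.
Hypothesis J_le : forall k t r, (J k t r <= Z r t)%E.
Hypothesis J_near : forall k (s e : R), 0 < e -> exists2 dl : R, 0 < dl & forall t r : R,
  `|t - s| < dl -> `|r - s| < dl ->
  (J k t r <= J k s s + e%:E)%E /\ (J k s s <= J k t r + e%:E)%E.
Hypothesis J_fin : forall k t, J k t t \is a fin_num.
Hypothesis J_homo : forall t, {homo (fun k => J k t t) : k p / (k <= p)%N >-> (k <= p)%E}.
Hypothesis cvg_J : forall t, J k t t @[k --> \oo] --> A t.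
Hypothesis Y0_fin : (Y 0 < +oo)%E.
Hypothesis A0_fin : (A 0 < +oo)%E.

Lemma energy_balance (a b : R) : 0 <= a -> a <= b ->
  (Y a = Y b + (\int[leb]_(t in `[a, b]) Z a t +
                \int[leb]_(t in `[a, b]) Z b t))%E.
Proof.
move=> a0 ab; rewrite (duality a a0 ab) (B_sym a b).
by rewrite (duality b a0 ab) -addeA; congr (_ + _)%E; rewrite addeC.
Qed.

Let reac_int_ge0 r (a b : R) : (0 <= \int[leb]_(t in `[a, b]) Z r t)%E.
Proof. by apply: integral_ge0 => t _; exact: Z_ge0. Qed.

Let Y_ge0 t : (0 <= Y t)%E. Proof. exact: B_ge0. Qed.

Lemma Y_fin (t : R) : 0 <= t -> Y t \is a fin_num.
Proof.
move=> t0; rewrite ge0_fin_numE//; apply: le_lt_trans Y0_fin.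
by rewrite (energy_balance (lexx 0) t0) leeDl// adde_ge0// reac_int_ge0.
Qed.

Let reac_int_fin (r a b : R) : 0 <= a -> a <= b -> r = a \/ r = b ->
  (\int[leb]_(t in `[a, b]) Z r t)%E \is a fin_num.
Proof.
move=> a0 ab rab; rewrite ge0_fin_numE ?reac_int_ge0//.
apply: le_lt_trans (_ : Y a < +oo)%E; last by rewrite ltey_eq Y_fin.
rewrite (energy_balance a0 ab).
apply: (@le_trans _ _ (\int[leb]_(t in `[a, b]) Z a t +
                \int[leb]_(t in `[a, b]) Z b t)%E); last by rewrite leeDr.
by case: rab => ->; [rewrite leeDl|rewrite leeDr]; rewrite ?reac_int_ge0.
Qed.

Let J_continuous k : continuous (fun t => fine (J k t t)).
Proof.
apply: continuous_eps => t e e0; have [dl dl0 H] := J_near k t e0.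
exists dl => // r rt; have [h1 h2] := H r r rt rt.
by apply: fine_dist_le; [exact: J_fin|exact: J_fin|exact: h1|exact: h2].
Qed.

Let measurable_J k : measurable_fun setT (fun t => J k t t).
Proof.
have -> : (fun t => J k t t) = (fun t => (fine (J k t t))%:E).
  by apply/funext => t; rewrite fineK// J_fin.
by apply: measurable_fun_EFin; apply: continuous_measurable_fun; exact: J_continuous.
Qed.

Lemma measurable_power_mass : measurable_fun setT A.
Proof.
apply: (emeasurable_fun_cvg (fun k t => J k t t)) => // t _; exact: cvg_J.
Qed.

(** An increasing limit of continuous functions is lower semicontinuous. This is the regularity of
    [A] in time on which the monotonicity and extinction arguments rely. *)
Lemma power_mass_lsc (s r : R) : (r%:E < A s)%E ->
  exists2 dl : R, 0 < dl & forall t : R, `|t - s| < dl -> (r%:E < A t)%E.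
Proof.
move=> rA.
have [k rJ] : exists k, (r%:E < J k s s)%E.
  apply: contrapT => /forallNP H.
  have : (A s <= r%:E)%E.
    apply: (cvge_to_le (@cvg_J s)); near=> k.
    by rewrite leNgt; apply/negP; exact: H.
  by rewrite leNgt rA.
have jr : r < fine (J k s s) by rewrite -lte_fin fineK// J_fin.
have e0 : 0 < (fine (J k s s) - r) / 2 by rewrite divr_gt0// subr_gt0.
have [dl dl0 H] := J_near k s e0; exists dl => // t ts.
have [_ h] := H t t ts ts.
apply: (@lt_le_trans _ _ (J k t t)); last by rewrite power_massE; exact: J_le.
move: h; rewrite -(fineK (J_fin k s)) -(fineK (J_fin k t)) -EFinD lee_fin lte_fin; lra.
Unshelve. all: end_near. Qed.

(** On a short interval [[s, s + g]] the two integrands of [energy_balance] both exceed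
    [J k s s - e], while [J k t t] stays below [J k s s + e]. The resulting error [4 * e * g] is
    summed over [[a, b]] by [le_of_locally_nondecreasing]. *)
Let J_integral_le k (a b : R) : 0 <= a -> a <= b ->
  (\int[leb]_(t in `[a, b]) J k t t <= ((fine (Y a) - fine (Y b)) / 2)%:E)%E.
Proof.
move=> a0 ab; pose j (t : R) : R := fine (J k t t).
have cj : continuous j by exact: J_continuous.
have [P HP] := primitive_gt (-1) cj.
have intJ (x y : R) : 0 <= x -> x <= y -> (\int[leb]_(t in `[x, y]) J k t t = (P y - P x)%:E)%E.
  move=> x0 xy; rewrite -(integral_primitive cj)//; last first.
    move=> z /=; rewrite in_itv/= => /andP[za _]; apply: HP => /=.
    by rewrite (lt_le_trans (ltrN10 R))// (le_trans x0).
  by apply: eq_integral => t _; rewrite fineK// J_fin.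
rewrite intJ// lee_fin.
suff : forall e : R, 0 < e -> - fine (Y a) - 2 * P a <= - fine (Y b) - 2 * P b + 4 * e * (b - a).
  move=> H; rewrite ler_pdivlMr//.
  suff : - fine (Y a) - 2 * P a <= - fine (Y b) - 2 * P b by lra.
  apply/ler_addgt0Pr => e e0.
  have ba0 : 0 <= 4 * (b - a) by rewrite mulr_ge0// subr_ge0.
  have [c /andP[c0 _] ce] := exists_small ltr01 ba0 e0.
  have := H c c0; lra.
move=> e e0.
suff : - fine (Y a) - 2 * P a + 4 * e * a <= - fine (Y b) - 2 * P b + 4 * e * b by lra.
apply: (@le_of_locally_nondecreasing _ (fun r => - fine (Y r) - 2 * P r + 4 * e * r)) => //.
- move=> s /andP[as_ sb] d1 d10.
  have s0 : 0 <= s by exact: le_trans as_.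
  have [dl dl0 H] := J_near k s e0.
  have b0 : 0 < Num.min (Num.min d1 dl) (b - s) by rewrite !lt_min d10 dl0 subr_gt0.
  have [g /andP[g0]] := exists_small b0 (lexx 0) (ltr01).
  rewrite !lt_min => /andP[/andP[gd gdl] gb] _.
  exists (s + g).
  have sg : s <= s + g by rewrite lerDl ltW.
  split; rewrite ?ltrDl ?ltrD2l//; first by rewrite -lerBrDl ltW.
  have E : s + g - s = g by ring.
  have near_ (r : R) : s <= r <= s + g -> `|r - s| < dl.
    move=> /andP[sr rg]; rewrite ger0_norm ?subr_ge0//.
    by apply: le_lt_trans gdl; rewrite lerBlDl.
  have jb (r : R) : r \in `[s, s + g] -> forall r' : R, s <= r' <= s + g -> ((j s - e)%:E <= Z r r')%E.
    rewrite in_itv/= => sr r' sr'; apply: le_trans (J_le k r' r).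
    have [_] := H r' r (near_ _ sr') (near_ _ sr).
    by rewrite -(fineK (J_fin k s)) EFinB leeBlDr.
  have lo (r : R) : r \in `[s, s + g] -> ((g * (j s - e))%:E <= \int[leb]_(t in `[s, (s + g)%R]) Z r t)%E.
    move=> rs; rewrite -{1}E; apply: itv_integral_ge => //.
    - exact: jb.
  have up : P (s + g) - P s <= g * (j s + e).
    rewrite -lee_fin -intJ// -{2}E; apply: itv_integral_le => // r sr.
    have [h _] := H r r (near_ _ sr) (near_ _ sr).
    by apply: (le_trans h); rewrite -(fineK (J_fin k s)).
  have bal := energy_balance s0 sg.
  have sin : s \in `[s, s + g] by rewrite in_itv/= lexx.
  have sgin : s + g \in `[s, s + g] by rewrite in_itv/= lexx sg.
  have sg0 : 0 <= s + g by exact: le_trans sg.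
  have : ((fine (Y (s + g)) + (g * (j s - e) + g * (j s - e)))%:E <= (fine (Y s))%:E)%E.
    rewrite fineK ?Y_fin// bal !EFinD fineK ?Y_fin// leeD2l// leeD//; exact: lo.
  rewrite lee_fin; lra.
- move=> s /andP[as_ sb] e' e'0.
  have s0 : 0 <= s by rewrite (le_trans a0)// ltW.
  have cP : {for s, continuous (fun r => - (2 * P r) + 4 * e * r)}.
    apply: continuousD; last first.
      by apply: continuousM => //; exact: cst_continuous.
    apply: continuousN; apply: continuousM; first exact: cst_continuous.
    by apply: (primitive_continuous HP) => /=; rewrite (lt_le_trans (ltrN10 R)).
  move/cvgrPdist_le : cP => /(_ e' e'0)[dl /= dl0 H].
  exists dl => // t at_ /andP[sdt ts].
  have t0 : 0 <= t by exact: le_trans at_.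
  have := H t; rewrite /= ger0_norm ?subr_ge0 ?(ltW ts)// => /(_ ltac:(lra)).
  rewrite ler_norml => /andP[h1 h2].
  have : fine (Y s) <= fine (Y t).
    rewrite fine_le ?Y_fin// (energy_balance t0 (ltW ts)).
    by rewrite leeDl// adde_ge0// reac_int_ge0.
  lra.
Qed.

Lemma energy_dissipation (a b : R) : 0 <= a -> a <= b ->
  (\int[leb]_(t in `[a, b]) A t <= ((fine (Y a) - fine (Y b)) / 2)%:E)%E.
Proof.
move=> a0 ab.
have c : (\int[leb]_(t in `[a, b]) J k t t)%E @[k --> \oo] -->
    (\int[leb]_(t in `[a, b]) A t)%E.
  apply: cvg_integral_nondecreasing => //.
  - by move=> k; apply: (@measurable_funS _ _ _ _ setT) => //; exact: measurable_J.
by apply: (cvge_to_le c); near=> k; exact: J_integral_le.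
Unshelve. all: end_near. Qed.

Lemma sqrt_energy_dist (s t : R) : 0 <= s -> s <= t -> (A s < +oo)%E ->
  (1 + m) * (Num.sqrt (fine (Y s)) - Num.sqrt (fine (Y t))) ^+ 2 <=
  2 * ((t - s) * fine (A s) - fine (\int[leb]_(r in `[s, t]) A r)%E).
Proof.
move=> s0 st As; have t0 : 0 <= t by exact: le_trans st.
have /andP[m0 m1] := m01; have m10 : 0 < 1 + m by lra.
have [Ys Yt] := (Y_fin s0, Y_fin t0).
have AsF : A s \is a fin_num by rewrite ge0_fin_numE// power_mass_ge0.
have diss := energy_dissipation s0 st.
have IAF : (\int[leb]_(r in `[s, t]) A r)%E \is a fin_num.
  rewrite ge0_fin_numE; first exact: le_lt_trans diss (ltry _).
  by apply: integral_ge0 => r _; exact: power_mass_ge0.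
have IF := reac_int_fin s0 st (or_introl erefl).
have I_le : fine (\int[leb]_(r in `[s, t]) Z s r)%E <=
    m / (1 + m) * fine (\int[leb]_(r in `[s, t]) A r)%E + (t - s) * ((1 + m)^-1 * fine (A s)).
  rewrite -lee_fin fineK// EFinD EFinM fineK//.
  have c0 : (0 <= (1 + m)^-1%:E * A s)%E.
    by rewrite mule_ge0 ?power_mass_ge0// lee_fin invr_ge0 ltW.
  have mA D : measurable_fun D A by apply: (@measurable_funS _ _ _ _ setT) => //; exact: measurable_power_mass.
  apply: (@le_trans _ _ (\int[leb]_(r in `[s, t]) ((m / (1 + m))%:E * A r + (1 + m)^-1%:E * A s))%E).
    apply: ge0_le_integral => //.
    - by apply: (@measurable_funS _ _ _ _ setT) => //; exact: measurable_Z.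
    - by apply: emeasurable_funD; [apply: measurable_funeM; exact: mA|exact: measurable_cst].
  have mm0 : 0 <= m / (1 + m) by rewrite divr_ge0// ltW.
  rewrite ge0_integralD//; last 2 first.
    by move=> r _; rewrite mule_ge0// power_mass_ge0.
    by apply: measurable_funeM; exact: mA.
  rewrite ge0_integralZl_EFin//; last exact: mA.
  rewrite leeD2l// -(fineK AsF) -EFinM; apply: itv_integral_le => //.
  by move=> r; rewrite EFinM fineK.
have cs : fine (B s t) <= Num.sqrt (fine (Y s)) * Num.sqrt (fine (Y t)).
  by apply: (proj2 (B_sqrt _ _)); rewrite ltey_eq ?Ys ?Yt.
have dual : fine (Y s) = fine (B s t) + fine (\int[leb]_(r in `[s, t]) Z s r)%E.
  rewrite (duality s s0 st) fineD//.
  rewrite ge0_fin_numE ?B_ge0//.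
  apply: le_lt_trans (_ : Y s < +oo)%E; last by rewrite ltey_eq Ys.
  by rewrite (duality s s0 st) leeDl// reac_int_ge0.
rewrite -(fineK IAF) lee_fin in diss.
have y1 := sqr_sqrtr (fine_ge0 (Y_ge0 s)); have y2 := sqr_sqrtr (fine_ge0 (Y_ge0 t)).
have -> : (Num.sqrt (fine (Y s)) - Num.sqrt (fine (Y t))) ^+ 2 =
  fine (Y s) + fine (Y t) - 2 * (Num.sqrt (fine (Y s)) * Num.sqrt (fine (Y t))).
  by rewrite -{2}y1 -{2}y2; ring.
set IA := fine (\int[leb]_(r in _) A r)%E in diss I_le *.
move: I_le; set I := fine (\int[leb]_(r in _) Z _ _)%E in dual *.
move=> I_le.
have {}I_le : (1 + m) * I <= m * IA + (t - s) * fine (A s).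
  rewrite -(ler_pM2l m10) in I_le; apply: (le_trans I_le).
  have -> : (1 + m) * (m / (1 + m) * IA + (t - s) * ((1 + m)^-1 * fine (A s))) =
     m * IA + (t - s) * fine (A s) by field; rewrite gt_eqF.
  by [].
(* By Cauchy-Schwarz the left side is at most [Y s + Y t - 2 * B s t = 2 * (Y s - B s t) - (Y s - Y
   t)]. The first term is [2 * I] by duality, and [Y s - Y t >= 2 * IA] by dissipation. *)
have h1 : fine (Y s) + fine (Y t) - 2 * (Num.sqrt (fine (Y s)) * Num.sqrt (fine (Y t)))
   <= 2 * I - 2 * IA by lra.
have := ler_wpM2l (ltW m10) h1; lra.
Qed.

(** If [A s < A t], let [q] be the last time before [t] at which [A <= A s]; it is attained by lower
    semicontinuity. [sqrt_energy_dist] has a nonnegative left side, so the mean of [A] over [[q, t]]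
    is at most [A q]. Yet [A > A s >= A q] after [q], with a uniform gap near [t], again by lower
    semicontinuity. *)
Lemma power_mass_noninc (s t : R) : 0 <= s -> s <= t -> (A s < +oo)%E -> (A t <= A s)%E.
Proof.
move=> s0 st As; rewrite leNgt; apply/negP => Ast.
have AsF : A s \is a fin_num by rewrite ge0_fin_numE// power_mass_ge0.
pose S := [set r : R | s <= r <= t /\ (A r <= A s)%E].
have Ss : S s by split; rewrite ?lexx.
have supS : has_sup S by split; [exists s|exists t => r [/andP[]]].
set q := sup S.
have sq : s <= q by apply: ub_le_sup Ss; case: supS.
have qt : q <= t by apply: ge_sup; [exists s|move=> r [/andP[]]].
have Aq : (A q <= A s)%E.
  rewrite leNgt; apply/negP; rewrite -{1}(fineK AsF) => /power_mass_lsc[dl dl0 H].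
  have [r Sr qr] := sup_adherent dl0 supS; rewrite -/q in qr.
  have rq : r <= q by apply: ub_le_sup Sr; case: supS.
  case: Sr => _; rewrite leNgt => /negP; apply; rewrite -(fineK AsF); apply: H.
  by rewrite distrC ger0_norm ?subr_ge0//; lra.
have qt' : q < t.
  rewrite lt_neqAle qt andbT; apply/negP => /eqP qtE.
  by move: Aq; rewrite qtE leNgt Ast.
have after (r : R) : q < r -> r <= t -> (A s < A r)%E.
  move=> qr rt; rewrite ltNge; apply/negP => h.
  have : r <= q.
    by apply: ub_le_sup; [case: supS|split; rewrite // rt (le_trans sq (ltW qr))].
  by rewrite leNgt qr.
have q0 : 0 <= q by exact: le_trans sq.
have Aqoo : (A q < +oo)%E by exact: le_lt_trans As.
have AqF : A q \is a fin_num by rewrite ge0_fin_numE// power_mass_ge0.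
have := sqrt_energy_dist q0 qt Aqoo.
have /andP[m0 m1] := m01; have m10 : 0 <= 1 + m by lra.
move=> /(le_trans (mulr_ge0 m10 (sqr_ge0 _))).
rewrite pmulr_rge0// subr_ge0 => IA_le.
(* A real level strictly between, also when [A t] is infinite, which is not yet excluded. *)
have [c /andP[c1 c2]] : exists c : R, (A s < c%:E < A t)%E.
  have [tF|] := boolP (A t \is a fin_num).
    exists ((fine (A s) + fine (A t)) / 2).
    move: Ast; rewrite -(fineK AsF) -(fineK tF) !lte_fin => h.
    by apply/andP; split; lra.
  rewrite ge0_fin_numE ?power_mass_ge0// -leNgt leye_eq => /eqP ->.
  exists (fine (A s) + 1); rewrite ltry andbT -{1}(fineK AsF) lte_fin; lra.
have [dl dl0 H] := power_mass_lsc c2.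
pose w := Num.max q (t - dl / 2).
have wt : w < t by rewrite gt_max qt'/=; lra.
have qw : q <= w by rewrite le_max lexx.
have diss := energy_dissipation q0 qt.
have IAF : (\int[leb]_(r in `[q, t]) A r)%E \is a fin_num.
  rewrite ge0_fin_numE; first exact: le_lt_trans diss (ltry _).
  by apply: integral_ge0 => r _; exact: power_mass_ge0.
have l1 : (((w - q) * fine (A q))%:E <= \int[leb]_(r in `[q, w]) A r)%E.
  apply: itv_integral_ge => //; first exact: measurable_power_mass.
  move=> r /andP[]; rewrite le_eqVlt => /predU1P[<-|qr] rw; rewrite fineK//.
  by apply: (le_trans Aq); apply/ltW/after => //; rewrite (le_trans rw)// ltW.
have l2 : (((t - w) * c)%:E <= \int[leb]_(r in `[w, t]) A r)%E.
  apply: itv_integral_ge => //; [exact: measurable_power_mass|exact: ltW|].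
  move=> r /andP[wr rt]; apply/ltW/H; rewrite distrC ger0_norm ?subr_ge0//.
  have : t - dl / 2 <= w by rewrite le_max lexx orbT.
  lra.
have : (((w - q) * fine (A q) + (t - w) * c)%:E <= \int[leb]_(r in `[q, t]) A r)%E.
  rewrite (itv_integral_split measurable_power_mass power_mass_ge0 qw (ltW wt)).
  by rewrite EFinD leeD.
rewrite -(fineK IAF) lee_fin => h.
have cA : fine (A q) < c.
  by rewrite -lte_fin fineK//; exact: le_lt_trans c1.
have : (t - w) * fine (A q) < (t - w) * c by rewrite ltr_pM2l// subr_gt0.
lra.
Qed.

Lemma power_mass_fin (t : R) : 0 <= t -> A t \is a fin_num.
Proof.
move=> t0; rewrite ge0_fin_numE ?power_mass_ge0//.
exact: le_lt_trans (power_mass_noninc (lexx 0) t0 A0_fin) A0_fin.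
Qed.

Let A_noninc (s t : R) : 0 <= s -> s <= t -> fine (A t) <= fine (A s).
Proof.
move=> s0 st; rewrite fine_le ?power_mass_fin// ?(le_trans s0)//.
by apply: power_mass_noninc => //; rewrite ltey_eq power_mass_fin.
Qed.

Let Y_ge (s t : R) : 0 <= s -> s <= t ->
  2 * ((t - s) * fine (A t)) <= fine (Y s) - fine (Y t).
Proof.
move=> s0 st; have := energy_dissipation s0 st.
have : (((t - s) * fine (A t))%:E <= \int[leb]_(r in `[s, t]) A r)%E.
  apply: itv_integral_ge => //; first exact: measurable_power_mass.
  move=> r /andP[sr rt]; have r0 : 0 <= r by exact: le_trans sr.
  by rewrite -(fineK (power_mass_fin r0)) lee_fin; exact: A_noninc.
move=> h1 h2; have := le_trans h1 h2; rewrite lee_fin; lra.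
Qed.

Let Y_le (s t : R) : 0 <= s -> s <= t ->
  fine (Y s) - fine (Y t) <= 2 * ((t - s) * fine (A s)).
Proof.
move=> s0 st; have t0 : 0 <= t by exact: le_trans st.
have /andP[m0 m1] := m01; have m10 : 0 < 1 + m by lra.
have up (r : R) : s <= r <= t ->
    (\int[leb]_(x in `[s, t]) Z r x <= ((t - s) * fine (A s))%:E)%E.
  move=> /andP[sr rt]; apply: itv_integral_le => //.
  move=> x /andP[sx xt]; apply: (le_trans (reaction_young _ _)).
    have x0 : 0 <= x by exact: le_trans sx.
    have r0 : 0 <= r by exact: le_trans sr.
    rewrite -(fineK (power_mass_fin x0)) -(fineK (power_mass_fin r0)) -!EFinM -EFinD lee_fin.
    have -> : fine (A s) = m / (1 + m) * fine (A s) + (1 + m)^-1 * fine (A s).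
      by field; rewrite gt_eqF.
    apply: lerD.
      by apply: ler_wpM2l; [rewrite divr_ge0// ltW|exact: A_noninc].
    by apply: ler_wpM2l; [rewrite invr_ge0 ltW|exact: A_noninc].
have : ((fine (Y s))%:E <= (fine (Y t) + ((t - s) * fine (A s) + (t - s) * fine (A s)))%:E)%E.
  rewrite fineK ?Y_fin// (energy_balance s0 st) !EFinD fineK ?Y_fin// leeD2l// leeD//.
    by apply: up; rewrite lexx.
  by apply: up; rewrite lexx st.
rewrite lee_fin; lra.
Qed.

Let Y_sqrt (s t b : R) : 0 <= s -> s < t ->
  (forall r : R, s < r <= t -> fine (A s) + b * (r - s) <= fine (A r)) ->
  (1 + m) * (Num.sqrt (fine (Y s)) - Num.sqrt (fine (Y t))) ^+ 2 <= - b * (t - s) ^+ 2.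
Proof.
move=> s0 st H.
apply: (le_trans (sqrt_energy_dist s0 (ltW st) _)); first by rewrite ltey_eq power_mass_fin.
suff : (t - s) * fine (A s) + b * (t - s) ^+ 2 / 2 <= fine (\int[leb]_(r in `[s, t]) A r)%E by lra.
pose f (r : R) : R := fine (A s) + b * (r - s).
pose F (r : R) : R := fine (A s) * r + b / 2 * (r - s) ^+ 2.
have cf : continuous f.
  move=> x; rewrite /f; apply: (@continuousD _ _ _ (fun=> fine (A s)) (fun r : R => b * (r - s))).
    exact: cst_continuous.
  apply: (@continuousM _ _ (fun=> b) (fun r : R => r - s)); first exact: cst_continuous.
  by apply: continuousB => //; exact: cst_continuous.
have HF : has_primitive_on `[s, t] f F.
  move=> x _; split; first by rewrite /F; exact: ex_derive.
  by rewrite derive1E /F derive_val /f /GRing.scale /=; field.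
have IF := integral_primitive cf HF (ltW st).
have Ft : F t - F s = (t - s) * fine (A s) + b * (t - s) ^+ 2 / 2 by rewrite /F; field.
rewrite -Ft.
have -> : F t - F s = \int[leb]_(r in `[s, t]) f r by rewrite /Rintegral IF.
have -> : fine (\int[leb]_(r in `[s, t]) A r)%E = \int[leb]_(r in `[s, t]) fine (A r).
  rewrite /Rintegral; congr fine; apply: eq_integral => r.
  by rewrite inE/= in_itv/= => /andP[sr _]; rewrite fineK// power_mass_fin// (le_trans s0).
apply: le_Rintegral => //.
- exact: continuous_integrable_cc.
- apply/integrableP; split.
    apply: measurable_fun_EFin; apply: measurableT_comp => //.
    by apply: (@measurable_funS _ _ _ _ setT) => //; exact: measurable_power_mass.
  apply: le_lt_trans (ltry ((fine (Y s) - fine (Y t)) / 2)).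
  apply: le_trans (energy_dissipation s0 (ltW st)).
  rewrite le_eqVlt; apply/orP; left; apply/eqP; apply: eq_integral => r.
  rewrite inE/= in_itv/= => /andP[sr _]; rewrite ger0_norm ?fine_ge0// fineK// power_mass_fin// (le_trans s0)//.
- move=> r; rewrite /= in_itv/= => /andP[]; rewrite le_eqVlt => /predU1P[<-|sr] rt.
    by rewrite /f subrr mulr0 addr0.
  by apply: H; rewrite sr.
Qed.

Variable T0 : R.
Hypothesis Y_T0 : fine (Y T0) = 0.
Hypothesis extinct_min : forall t : R, 0 <= t ->
  (forall r : R, t <= r -> A r = 0%E) -> T0 <= t.

(** A zero of [Y] at [t < T0] would force [A = 0] at every later time by [Y_ge], and at [t] itself
    by lower semicontinuity, against the minimality of [T0]. *)
Let Y_gt0 (t : R) : 0 <= t < T0 -> 0 < fine (Y t).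
Proof.
move=> /andP[t0 tT]; rewrite lt_neqAle fine_ge0// andbT eq_sym; apply/negP => /eqP Yt.
suff : T0 <= t by rewrite leNgt tT.
have Apos (r : R) : t < r -> fine (A r) = 0.
  move=> tr; have := Y_ge t0 (ltW tr); rewrite Yt sub0r => h.
  have A0' : 0 <= fine (A r) by rewrite fine_ge0// power_mass_ge0.
  have h2 : (r - t) * fine (A r) <= 0 by have := fine_ge0 (Y_ge0 r); lra.
  apply/eqP; rewrite eq_le A0' andbT.
  by rewrite -(@pmulr_rle0 _ (r - t))// subr_gt0.
apply: extinct_min => // r; rewrite le_eqVlt => /predU1P[<-|tr].
  apply/eqP; rewrite eq_le power_mass_ge0 andbT leNgt; apply/negP => /power_mass_lsc[dl dl0 H].
  have := H (t + dl / 2); rewrite addrAC subrr add0r gtr0_norm ?divr_gt0//.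
  have h : dl / 2 < dl by lra.
  move=> /(_ h); have tdl : t < t + dl / 2 by rewrite ltrDl divr_gt0.
  rewrite -(fineK (power_mass_fin (le_trans t0 (ltW tdl)))) Apos// ltxx//.
by rewrite -(fineK (power_mass_fin (le_trans t0 (ltW tr)))) Apos.
Qed.

Let A_ge0 (t : R) : 0 <= t -> 0 <= fine (A t).
Proof. by move=> _; rewrite fine_ge0// power_mass_ge0. Qed.

Lemma energy_upper (t : R) : 0 <= t < T0 -> fine (Y t) `^ ((1 - m) / 2) <=
  (1 - m) * (fine (A 0) / fine (Y 0) `^ ((1 + m) / 2)) * (T0 - t).
Proof. exact: (@extinction_upper R T0 m (fun t => fine (Y t)) (fun t => fine (A t)) m01 A_ge0 A_noninc Y_ge Y_le Y_gt0 Y_T0 Y_sqrt). Qed.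

Lemma energy_lower (c t : R) : 0 <= c ->
  (forall r : R, 0 <= r < T0 -> c * fine (Y r) `^ ((1 + m) / 2) <= fine (A r)) ->
  0 <= t < T0 -> (1 - m) * c * (T0 - t) <= fine (Y t) `^ ((1 - m) / 2).
Proof. exact: (@extinction_lower R T0 m (fun t => fine (Y t)) (fun t => fine (A t)) m01 A_ge0 Y_ge Y_le Y_gt0 Y_T0). Qed.

End dissipation.

(** * Weak solutions for an abstract kernel *)

Lemma powR_le1D (R : realType) (m x : R) : 0 < m < 1 -> 0 <= x -> x `^ m <= 1 + x.
Proof.
move=> m01 x0; apply: (le_trans (powR_bernoulli m01 x0)).
case/andP: m01 => m0 m1.
have : m * x <= x by rewrite ler_piMl// ltW.
lra.
Qed.

(** The power is not Lipschitz at [0], but it is up to an error [e]: below [d = e ^ (1 / m)] the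
    values are at most [e], and beyond [d] the slopes are at most [d ^ (m - 1)]. It transfers the
    continuity in time of [u], in the weighted L^1 norm, to [u ^ m]. *)
Lemma powR_modulus (R : realType) (m e : R) : 0 < m < 1 -> 0 < e ->
  exists2 C, 0 <= C & forall x y, 0 <= x -> 0 <= y ->
    `|x `^ m - y `^ m| <= e + C * `|x - y|.
Proof.
move=> m01 e0; have /andP[m0 m1] := m01.
pose d := e `^ m^-1; have d0 : 0 < d by rewrite powR_gt0.
exists (d `^ (m - 1)); first exact: powR_ge0.
suff H x y : 0 <= y -> y <= x -> x `^ m - y `^ m <= e + d `^ (m - 1) * (x - y).
  move=> x y x0 y0; case: (leP y x) => [yx|/ltW xy].
    have yxm : y `^ m <= x `^ m by rewrite ge0_ler_powR ?(ltW m0)// nnegrE.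
    by rewrite !ger0_norm ?subr_ge0//; exact: H.
  have xym : x `^ m <= y `^ m by rewrite ge0_ler_powR ?(ltW m0)// nnegrE.
  by rewrite distrC [X in _ * X]distrC !ger0_norm ?subr_ge0//; exact: H.
move=> y0 yx; have x0 : 0 <= x by exact: le_trans yx.
have s0 : 0 <= d `^ (m - 1) * (x - y) by rewrite mulr_ge0 ?powR_ge0// subr_ge0.
case: (leP x d) => xd.
  have : x `^ m <= e.
    have <- : d `^ m = e by rewrite /d -powRrM mulVf ?gt_eqF// powRr1// ltW.
    by rewrite ge0_ler_powR ?(ltW m0)// nnegrE// ltW.
  have := powR_ge0 y m; lra.
have x0' : 0 < x by exact: lt_trans xd.
have h1 : x `^ m - y `^ m <= x `^ (m - 1) * (x - y).
  have q0 : 0 <= y / x by rewrite divr_ge0.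
  have q1 : y / x <= 1 by rewrite ler_pdivrMr// mul1r.
  have : x `^ m * (y / x) <= y `^ m.
    have -> : y `^ m = x `^ m * (y / x) `^ m.
      by rewrite -powRM// [x * _]mulrC divfK// gt_eqF.
    rewrite ler_wpM2l ?powR_ge0//.
    move: q0; rewrite le_eqVlt => /predU1P[<-|q0]; first exact: powR_ge0.
    by rewrite -[X in X <= _](@powRr1 _ (y / x)) ?(ltW q0)// ger_powR ?q0// ltW.
  rewrite powRB ?(gt_eqF x0') ?implybT// powRr1//.
  have -> : x `^ m / x * (x - y) = x `^ m - x `^ m * (y / x).
    by field; rewrite gt_eqF.
  lra.
have h2 : x `^ (m - 1) <= d `^ (m - 1).
  have -> : m - 1 = - (1 - m) by ring.
  rewrite !powRN lef_pV2 ?posrE ?powR_gt0// ge0_ler_powR ?nnegrE ?(ltW d0)// ?ltW//.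
  by rewrite subr_gt0.
have : x `^ (m - 1) * (x - y) <= d `^ (m - 1) * (x - y) by rewrite ler_wpM2r// subr_ge0.
lra.
Qed.

Section evolution.
Context d (T : measurableType d) (R : realType).
Variables (mu : {finite_measure set T -> \bar R}) (K : T * T -> R) (Phi : T -> R).
Variables (lam m : R) (u : R -> T -> R).
Local Notation nm := (@nonneg_measurable _ T R).
Local Notation leb := (@lebesgue_measure R).
Local Notation B := (kform mu K).
Local Notation dominated := (dominated Phi).
Local Notation trunc := (trunc Phi).
Hypothesis K_nm : nonneg_measurable K.
Hypothesis mPhi : measurable_fun setT Phi.
Hypothesis Phi_gt0 : forall x, 0 < Phi x.
Hypothesis B_sym_dominated : forall f g, nm f -> nm g ->
  dominated f -> dominated g -> B f g = B g f.
Hypothesis B_psd_dominated : forall f g, nm f -> nm g ->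
  dominated f -> dominated g -> (B f g + B g f <= B f f + B g g)%E.
Hypothesis lam0 : 0 < lam.
Hypothesis B_Phi : forall f, nm f -> (B f Phi = lam^-1%:E * \int[mu]_x (f x * Phi x)%:E)%E.
Hypothesis Phi_int : (\int[mu]_x (Phi x)%:E < +oo)%E.
Hypothesis m01 : 0 < m < 1.
Hypothesis u_nm : forall t, nm (u t).
Hypothesis u_L1 : forall t, (\int[mu]_x (u t x * Phi x)%:E < +oo)%E.
Hypothesis u_cont : forall t e : R, 0 < e -> exists2 d : R, 0 < d & forall r : R, `|r - t| < d ->
  (\int[mu]_x (`|u r x - u t x| * Phi x)%:E <= e%:E)%E.

Let nP : nm Phi. Proof. exact: nmPhi. Qed.
Let B_sym f g : nm f -> nm g -> B f g = B g f.
Proof. exact: (kform_sym K_nm mPhi Phi_gt0 B_sym_dominated). Qed.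

Let mE (f : T -> R) : nm f -> measurable_fun setT (fun x => (f x)%:E).
Proof. by move=> [mf _]; exact: measurable_fun_EFin. Qed.

Let int_ge0 (f : T -> R) : nm f -> (0 <= \int[mu]_x (f x)%:E)%E.
Proof. by move=> [_ f0]; apply: integral_ge0 => x _; rewrite lee_fin. Qed.

Let le_int (f g : T -> R) : nm f -> nm g -> (forall x, f x <= g x) ->
  (\int[mu]_x (f x)%:E <= \int[mu]_x (g x)%:E)%E.
Proof.
move=> nf ng fg; apply: ge0_le_integral => //.
- by move=> x _; rewrite lee_fin; exact: nf.2.
- exact: mE.
- exact: mE.
- by move=> x _; rewrite lee_fin.
Qed.

Let intZ (r : R) (f : T -> R) : 0 <= r -> nm f ->
  (\int[mu]_x (r * f x)%:E = r%:E * \int[mu]_x (f x)%:E)%E.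
Proof.
move=> r0 nf; under eq_integral do rewrite EFinM.
rewrite ge0_integralZl_EFin//; last exact: mE.
by move=> x _; rewrite lee_fin; exact: nf.2.
Qed.

Let intD (f g : T -> R) : nm f -> nm g ->
  (\int[mu]_x (f x + g x)%:E = \int[mu]_x (f x)%:E + \int[mu]_x (g x)%:E)%E.
Proof.
move=> nf ng; under eq_integral do rewrite EFinD.
rewrite ge0_integralD//.
- by move=> x _; rewrite lee_fin; exact: nf.2.
- exact: mE.
- by move=> x _; rewrite lee_fin; exact: ng.2.
- exact: mE.
Qed.

Lemma upow_cont (t e : R) : 0 < e -> exists2 d : R, 0 < d & forall r : R, `|r - t| < d ->
  (\int[mu]_x (`|u r x `^ m - u t x `^ m| * Phi x)%:E <= e%:E)%E.
Proof.
move=> e0.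
set I := (\int[mu]_x (Phi x)%:E)%E.
have Ioo : (I < +oo)%E by [].
have I0 : (0 <= I)%E by exact: int_ge0.
have IF : I \is a fin_num by rewrite ge0_fin_numE.
have i0 : 0 <= fine I by exact: fine_ge0.
have e20 : 0 < e / 2 by rewrite divr_gt0.
have [e1 /andP[e10 _] ie] := exists_small ltr01 i0 e20.
have [C C0 HC] := powR_modulus m01 e10.
have [c /andP[c0 _] Cc] := exists_small ltr01 C0 e20.
have [dl dl0 H] := u_cont t c0.
exists dl => // r /H {}H.
pose D (f g : T -> R) x := `|f x - g x| * Phi x.
have nD f g : nm f -> nm g -> nm (D f g).
  by move=> nf ng; apply: nm_mul => //; exact: nm_dist.
have -> : (e%:E = (e / 2)%:E + (e / 2)%:E)%E by rewrite -EFinD -splitr.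
apply: (@le_trans _ _ (\int[mu]_x (e1 * Phi x + C * D (u r) (u t) x)%:E)%E).
  apply: le_int.
  - by apply: nm_mul => //; apply: nm_dist; exact: nm_powR.
  - by apply: nmD; apply: nmZ => //; [exact: ltW|exact: nD].
  - move=> x; have := HC (u r x) (u t x) ((u_nm r).2 x) ((u_nm t).2 x).
    by rewrite -(ler_pM2r (Phi_gt0 x)) mulrDl mulrA.
rewrite intD; [|by apply: nmZ => //; exact: ltW|by apply: nmZ => //; exact: nD].
rewrite intZ ?(ltW e10)// intZ//; last exact: nD.
apply: leeD.
  by rewrite -/I -(fineK IF) -EFinM lee_fin mulrC.
apply: (@le_trans _ _ (C%:E * c%:E)%E); last by rewrite -EFinM lee_fin.
by rewrite lee_wpmul2l.
Qed.

Definition reaction (chi : T -> R) t : \bar R := (\int[mu]_x (u t x `^ m * chi x)%:E)%E.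

Let nm_reac chi t : nm chi -> nm (fun x => u t x `^ m * chi x).
Proof. by move=> nc; apply: nm_mul => //; exact: nm_powR. Qed.

Lemma reaction_ge0 chi t : nm chi -> (0 <= reaction chi t)%E.
Proof. by move=> nc; exact/int_ge0/nm_reac. Qed.

Lemma reaction_fin chi t : nm chi -> dominated chi -> reaction chi t \is a fin_num.
Proof.
move=> nc [n cn]; rewrite ge0_fin_numE ?reaction_ge0//.
apply: (@le_lt_trans _ _ (\int[mu]_x (n%:R * (Phi x + u t x * Phi x))%:E)%E).
  apply: le_int.
  - exact: nm_reac.
  - by apply: nmZ => //; apply: nmD => //; exact: nm_mul.
  - move=> x; apply: (@le_trans _ _ (u t x `^ m * (n%:R * Phi x))).
      by rewrite ler_wpM2l ?powR_ge0.
    have -> : n%:R * (Phi x + u t x * Phi x) = (1 + u t x) * (n%:R * Phi x) by ring.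
    rewrite ler_wpM2r ?mulr_ge0 ?(ltW (Phi_gt0 x))//.
    exact: (powR_le1D m01 ((u_nm t).2 x)).
have nuP : nm (fun x => u t x * Phi x) by exact: nm_mul.
rewrite intZ//; last exact: nmD.
rewrite intD// lte_mul_pinfty// ?adde_ge0 ?int_ge0//.
exact: lte_add_pinfty.
Qed.

Lemma reaction_dist chi t e : nm chi -> dominated chi -> 0 < e ->
  exists2 d, 0 < d & forall r, `|r - t| < d ->
    (reaction chi r <= reaction chi t + e%:E)%E /\
    (reaction chi t <= reaction chi r + e%:E)%E.
Proof.
move=> nc [n cn] e0.
have n0 : 0 <= n%:R :> R by [].
have [c /andP[c0 _] nce] := exists_small ltr01 n0 e0.
have [dl dl0 H] := upow_cont t c0; exists dl => // r /H {}H.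
pose D x := `|u r x `^ m - u t x `^ m| * Phi x.
have nD : nm D by apply: nm_mul => //; apply: nm_dist; exact: nm_powR.
have De : (\int[mu]_x (n%:R * D x)%:E <= e%:E)%E.
  rewrite intZ//; apply: (@le_trans _ _ (n%:R%:E * c%:E)%E).
    by rewrite lee_wpmul2l.
  by rewrite -EFinM lee_fin.
have aux p q : nm p -> nm q -> (forall x, p x <= q x + n%:R * D x) ->
    (\int[mu]_x (p x)%:E <= \int[mu]_x (q x)%:E + e%:E)%E.
  move=> np nq pq; apply: (@le_trans _ _ (\int[mu]_x (q x)%:E + \int[mu]_x (n%:R * D x)%:E)%E).
    by rewrite -intD//; [apply: le_int => //; apply: nmD => //; exact: nmZ|exact: nmZ].
  by rewrite leeD2l.
have bd x a b : `|a - b| * chi x <= n%:R * (`|a - b| * Phi x).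
  by rewrite mulrCA ler_wpM2l.
split; apply: aux; rewrite /D; do ?exact: nm_reac.
  move=> x; apply: (@le_trans _ _ (u t x `^ m * chi x + `|u r x `^ m - u t x `^ m| * chi x)).
    rewrite -mulrDl ler_wpM2r//; first exact: nc.2.
    by rewrite -lerBlDl ler_norm.
  by rewrite lerD2l.
move=> x; apply: (@le_trans _ _ (u r x `^ m * chi x + `|u r x `^ m - u t x `^ m| * chi x)).
  rewrite -mulrDl ler_wpM2r//; first exact: nc.2.
  by rewrite -lerBlDl distrC ler_norm.
by rewrite lerD2l.
Qed.

Lemma reaction_continuous chi : nm chi -> dominated chi ->
  continuous (fun t => fine (reaction chi t)).
Proof.
move=> nc dc; apply: continuous_eps => t e e0.
have [dl dl0 H] := reaction_dist t nc dc e0; exists dl => // r /H[h1 h2].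
by apply: fine_dist_le; [exact: reaction_fin|exact: reaction_fin|exact: h1|exact: h2].
Qed.

(** Symmetry and the eigenfunction relation make [B chi] continuous for the weighted L^1 norm, the
    norm in which the solution is continuous in time. *)
Let B_bound chi n g : nm chi -> (forall x, chi x <= n%:R * Phi x) -> nm g ->
  (B chi g <= (n%:R / lam)%:E * \int[mu]_x (g x * Phi x)%:E)%E.
Proof.
move=> nc cn ng; rewrite EFinM -muleA -B_Phi// (B_sym nc ng) -(kformZr _ K_nm)//.
apply: le_kform => //; exact: nmZ.
Qed.

Lemma B_u_fin chi t : nm chi -> dominated chi -> B chi (u t) \is a fin_num.
Proof.
move=> nc [n cn]; rewrite ge0_fin_numE; last exact: kform_ge0.
apply: (le_lt_trans (B_bound nc cn (u_nm t))).
by rewrite lte_mul_pinfty// lee_fin divr_ge0// ltW.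
Qed.

Lemma B_u_continuous chi : nm chi -> dominated chi ->
  continuous (fun t => fine (B chi (u t))).
Proof.
move=> nc dc; apply: continuous_eps => t e e0; have [n cn] := dc.
have nl0 : 0 <= n%:R / lam by rewrite divr_ge0// ltW.
have [c /andP[c0 _] nce] := exists_small ltr01 nl0 e0.
have [dl dl0 H] := u_cont t c0; exists dl => // r /H {}H.
pose D x := `|u r x - u t x|.
have nD : nm D by exact: nm_dist.
have De : (B chi D <= e%:E)%E.
  apply: (le_trans (B_bound nc cn nD)).
  apply: (@le_trans _ _ ((n%:R / lam)%:E * c%:E)%E); last by rewrite -EFinM lee_fin.
  by rewrite lee_wpmul2l.
apply: fine_dist_le; do ?exact: B_u_fin.
  apply: (@le_trans _ _ (B chi (u t) + B chi D)%E); last by rewrite leeD2l.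
  rewrite -kformDr//; apply: le_kform => //; first exact: nmD.
  by move=> x /=; rewrite -lerBlDl ler_norm.
apply: (@le_trans _ _ (B chi (u r) + B chi D)%E); last by rewrite leeD2l.
rewrite -kformDr//; apply: le_kform => //; first exact: nmD.
by move=> x /=; rewrite -lerBlDl /D distrC ler_norm.
Qed.

Hypothesis weak : forall chi, nm chi -> dominated chi -> forall S, 0 < S ->
  forall th dth : R -> R,
  (forall t : R, derivable th t 1 /\ derive1 th t = dth t) -> continuous dth ->
  (exists a b : R, [/\ 0 < a, b < S & forall t : R, ~ (a <= t <= b) -> th t = 0]) ->
  \int[leb]_(t in `]0, S[) (fine (B chi (u t)) * dth t) =
  \int[leb]_(t in `]0, S[) (fine (reaction chi t) * th t).

(** With test functions [th t * chi x] the weak equation says [U' = - V] in the sense of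
    distributions on positive times. Both functions are continuous, so [U] plus a primitive of [V]
    is constant there, and right continuity adds the time [0]. *)
Lemma duality_dominated chi (a b : R) : nm chi -> dominated chi -> 0 <= a -> a <= b ->
  (B chi (u a) = B chi (u b) + \int[leb]_(t in `[a, b]) reaction chi t)%E.
Proof.
move=> nc dc a0 ab.
pose U t := fine (B chi (u t)); pose V t := fine (reaction chi t).
have cU : continuous U by exact: B_u_continuous.
have cV : continuous V by exact: reaction_continuous.
have [Q HQ] := primitive_gt (-1) cV.
have S0 : 0 < b + 1 by rewrite ltr_wpDl// (le_trans a0).
have pos (x : R) : 0 < x -> x <= b -> U x + Q x = U b + Q b.
  move=> x0 xb; apply: (weak_primitive_constant cU cV S0 HQ) => //.
  - exact: weak.
  - by rewrite ltrDl.
have eqab : U a + Q a = U b + Q b.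
  move: a0; rewrite le_eqVlt => /predU1P[a0|a0]; last exact: pos.
  move: ab; rewrite -a0 le_eqVlt => /predU1P[<-//|b0].
  have c0 : {for 0, continuous (fun x => U x + Q x)}.
    apply: continuousD; first exact: cU.
    by apply: (primitive_continuous HQ) => /=; rewrite ltrN10.
  have h1 := cvg_at_right_filter c0.
  apply/esym; apply: (@cvg_unique _ _ _ _ _ _ _ h1) => //.
  apply: cvg_near_cst; near=> x; apply: pos.
    by near: x; exact: nbhs_right_gt.
  by near: x; exact: nbhs_right_le.
have -> : (\int[leb]_(t in `[a, b]) reaction chi t = (Q b - Q a)%:E)%E.
  rewrite -(integral_primitive cV)//; last first.
    move=> z /=; rewrite in_itv/= => /andP[za _]; apply: HQ => /=.
    by rewrite (lt_le_trans (ltrN10 R))// (le_trans a0).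
  by apply: eq_integral => t _; rewrite fineK// reaction_fin.
rewrite -(fineK (B_u_fin a nc dc)) -(fineK (B_u_fin b nc dc)) -EFinD; congr (_%:E).
rewrite -/(U a) -/(U b); lra.
Unshelve. all: end_near. Qed.

Let nt chi n : nm chi -> nm (trunc chi n).
Proof. exact: trunc_nm. Qed.

Lemma cvg_reaction_trunc chi t : nm chi ->
  reaction (trunc chi n) t @[n --> \oo] --> reaction chi t.
Proof.
move=> nc; apply: cvg_integral_nondecreasing => //.
- by move=> n; exact/mE/nm_reac/nt.
- by move=> n x _; rewrite lee_fin; exact: (nm_reac t (nt n nc)).2.
- move=> x _ n p np; rewrite lee_fin ler_wpM2l ?powR_ge0//; exact: trunc_homo.
- move=> x _; apply: cvg_near_cst; near=> n.
  by have -> : trunc chi n x = chi x by near: n; exact: trunc_eventually.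
Unshelve. all: end_near. Qed.

Lemma le_reaction f g t : nm f -> nm g -> (forall x, f x <= g x) ->
  (reaction f t <= reaction g t)%E.
Proof.
move=> nf ng fg; apply: le_int; do ?exact: nm_reac.
by move=> x; rewrite ler_wpM2l// powR_ge0.
Qed.

Lemma measurable_reaction_dominated chi : nm chi -> dominated chi ->
  measurable_fun setT (reaction chi).
Proof.
move=> nc dc; have -> : reaction chi = (fun t => (fine (reaction chi t))%:E).
  by apply/funext => t; rewrite fineK// reaction_fin.
by apply: measurable_fun_EFin; apply: continuous_measurable_fun; exact: reaction_continuous.
Qed.

Lemma measurable_reaction chi : nm chi -> measurable_fun setT (reaction chi).
Proof.
move=> nc; apply: (emeasurable_fun_cvg (fun n t => reaction (trunc chi n) t)).
  by move=> n; apply: measurable_reaction_dominated; [exact: nt|exact: trunc_dominated].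
by move=> t _; exact: cvg_reaction_trunc.
Qed.

Lemma duality chi (a b : R) : nm chi -> 0 <= a -> a <= b ->
  (B chi (u a) = B chi (u b) + \int[leb]_(t in `[a, b]) reaction chi t)%E.
Proof.
move=> nc a0 ab.
have c1 := cvg_kform_truncl (mu := mu) K_nm mPhi Phi_gt0 nc (u_nm a).
have c2 := cvg_kform_truncl (mu := mu) K_nm mPhi Phi_gt0 nc (u_nm b).
have c3 : (\int[leb]_(t in `[a, b]) reaction (trunc chi n) t)%E @[n --> \oo] -->
    (\int[leb]_(t in `[a, b]) reaction chi t)%E.
  apply: cvg_integral_nondecreasing => //.
  - move=> n; apply: (@measurable_funS _ _ _ _ setT) => //.
    by apply: measurable_reaction; exact: nt.
  - by move=> n t _; apply: reaction_ge0; exact: nt.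
  - move=> t _ n p np; apply: le_reaction; do ?exact: nt.
    by move=> x; exact: trunc_homo.
  - by move=> t _; exact: cvg_reaction_trunc.
apply: (@cvg_unique _ (@ereal_hausdorff R) _ _ _ _ c1).
have : (B (trunc chi n) (u b) + \int[leb]_(t in `[a, b]) reaction (trunc chi n) t)%E
    @[n --> \oo] --> (B chi (u b) + \int[leb]_(t in `[a, b]) reaction chi t)%E.
  apply: cvgeD => //; apply: ge0_adde_def; rewrite inE; first exact: kform_ge0.
  by apply: integral_ge0 => t _; exact: reaction_ge0.
apply: cvg_trans; apply: near_eq_cvg; near=> n.
by rewrite -duality_dominated//; [exact: nt|exact: trunc_dominated].
Unshelve. all: end_near. Qed.

Local Notation Y t := (B (u t) (u t)).
Definition power_mass t : \bar R := (\int[mu]_x (u t x `^ (1 + m))%:E)%E.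
Local Notation A := power_mass.

Hypothesis Y0_fin : (Y 0 < +oo)%E.
Hypothesis A0_fin : (A 0 < +oo)%E.

Lemma power_massE t : A t = reaction (u t) t.
Proof.
apply: eq_integral => x _; congr (_%:E); case/andP: m01 => m0 m1.
rewrite addrC powRD ?powRr1 ?(u_nm t).2//.
by apply/implyP; rewrite gt_eqF// addr_gt0.
Qed.

Lemma power_mass_ge0 t : (0 <= A t)%E.
Proof. by rewrite power_massE; exact: reaction_ge0. Qed.

(* The truncations are below multiples of [Phi], so that continuity of [u] in
   the weighted L^1 norm makes the integral continuous in [(t, r)]. *)
Let J_integrand (k : nat) (t r : R) (x : T) : R :=
  Num.min (u t x `^ m) k%:R * (Num.min (u r x) k%:R * Num.min 1 (k%:R * Phi x)).
Let J (k : nat) (t r : R) : \bar R := (\int[mu]_x (J_integrand k t r x)%:E)%E.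

Let nm_J k t r : nm (J_integrand k t r).
Proof.
apply: nm_mul; first by apply: nm_min; [exact: nm_powR|exact: nm_cst].
apply: nm_mul; first by apply: nm_min => //; exact: nm_cst.
by apply: nm_min; [exact: nm_cst|exact: nmZ].
Qed.

Let J_ge0 k t r : (0 <= J k t r)%E. Proof. exact: int_ge0. Qed.

Let J_le_reaction k t r : (J k t r <= reaction (u r) t)%E.
Proof.
apply: le_int => //; first exact: nm_reac.
move=> x; have [[[ut0 ur0] P0] k0] := ((u_nm t).2 x, (u_nm r).2 x, ltW (Phi_gt0 x), ler0n R k).
rewrite ler_pM// ?mulr_ge0 ?le_min ?powR_ge0 ?ut0 ?ur0 ?ler01 ?mulr_ge0 ?ge_min ?lexx//.
rewrite -[X in _ <= X]mulr1 ler_pM// ?le_min ?ur0 ?ler01 ?mulr_ge0//.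
  by rewrite ge_min lexx.
by rewrite ge_min lexx.
Qed.

Let min_dist (a b c : R) : `|Num.min a c - Num.min b c| <= `|a - b|.
Proof.
wlog ba : a b / b <= a => [H|].
  by case: (leP b a) => [|/ltW] h; [|rewrite distrC [X in _ <= X]distrC]; exact: H.
have h : Num.min b c <= Num.min a c by rewrite le_min !ge_min ba lexx ?orbT.
rewrite !ger0_norm ?subr_ge0//.
by rewrite /Num.min; case: (ltP a c) => h1; case: (ltP b c) => h2; lra.
Qed.

Let J_near k (s e : R) : 0 < e -> exists2 dl : R, 0 < dl & forall t r : R,
  `|t - s| < dl -> `|r - s| < dl ->
  (J k t r <= J k s s + e%:E)%E /\ (J k s s <= J k t r + e%:E)%E.
Proof.
(* In the difference of two integrands one factor changes at a time; the other two are at most [k]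
   and [k * Phi x], hence the constant [k * k] in front of the weighted distances. *)
move=> e0; set k2 : R := k%:R * k%:R.
have k20 : 0 <= k2 by rewrite mulr_ge0.
have e20 : 0 < e / 2 by rewrite divr_gt0.
have [c /andP[c0 _] kc] := exists_small ltr01 k20 e20.
have [d1 d10 H1] := upow_cont s c0; have [d2 d20 H2] := u_cont s c0.
exists (Num.min d1 d2); first by rewrite lt_min d10.
move=> t r; rewrite !lt_min => /andP[/H1 {}H1 _] /andP[_ /H2 {}H2].
pose D1 x := `|u t x `^ m - u s x `^ m| * Phi x.
pose D2 x := `|u r x - u s x| * Phi x.
have nD1 : nm D1 by apply: nm_mul => //; apply: nm_dist; exact: nm_powR.
have nD2 : nm D2 by apply: nm_mul => //; exact: nm_dist.
have nD : nm (fun x => k2 * D1 x + k2 * D2 x) by apply: nmD; exact: nmZ.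
have De : (\int[mu]_x (k2 * D1 x + k2 * D2 x)%:E <= e%:E)%E.
  rewrite intD; [|exact: nmZ|exact: nmZ]; rewrite !intZ//.
  rewrite [e]splitr EFinD; apply: leeD.
    apply: (@le_trans _ _ (k2%:E * c%:E)%E); last by rewrite -EFinM lee_fin.
    by rewrite lee_wpmul2l.
  apply: (@le_trans _ _ (k2%:E * c%:E)%E); last by rewrite -EFinM lee_fin.
  by rewrite lee_wpmul2l.
have aux p q : nm p -> nm q -> (forall x, p x <= q x + (k2 * D1 x + k2 * D2 x)) ->
    (\int[mu]_x (p x)%:E <= \int[mu]_x (q x)%:E + e%:E)%E.
  move=> np nq pq; apply: (@le_trans _ _ (\int[mu]_x (q x)%:E +
      \int[mu]_x (k2 * D1 x + k2 * D2 x)%:E)%E).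
    by rewrite -intD//; apply: le_int => //; exact: nmD.
  by rewrite leeD2l.
have bd x : `|J_integrand k t r x - J_integrand k s s x| <= k2 * D1 x + k2 * D2 x.
  rewrite /J_integrand.
  have := min_dist (u t x `^ m) (u s x `^ m) k%:R.
  have := min_dist (u r x) (u s x) k%:R.
  have : 0 <= Num.min (u s x `^ m) k%:R <= k%:R.
    by rewrite le_min powR_ge0 ler0n ge_min lexx orbT.
  have : 0 <= Num.min (u r x) k%:R <= k%:R.
    by rewrite le_min (u_nm r).2 ler0n ge_min lexx orbT.
  have P0 := ltW (Phi_gt0 x).
  have : 0 <= Num.min 1 (k%:R * Phi x) <= k%:R * Phi x.
    by rewrite le_min ler01 mulr_ge0//= ge_min lexx orbT.
  rewrite /D1 /D2.
  move: (Num.min (u t x `^ m) k%:R) (Num.min (u s x `^ m) k%:R) => p p'.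
  move: (Num.min (u r x) k%:R) (Num.min (u s x) k%:R) => q q'.
  move: (Num.min 1 _) (`|u t x `^ m - _|) (`|u r x - _|) => w n1 n2.
  move=> /andP[w0 wk] /andP[q0 qk] /andP[p0 pk] hq hp.
  have -> : p * (q * w) - p' * (q' * w) = (p - p') * (q * w) + p' * ((q - q') * w) by ring.
  apply: (le_trans (ler_normD _ _)); rewrite !normrM.
  rewrite (ger0_norm q0) (ger0_norm w0) (ger0_norm p0).
  apply: lerD.
    have -> : k2 * (n1 * Phi x) = n1 * (k%:R * (k%:R * Phi x)) by rewrite /k2; ring.
    by apply: ler_pM => //; [rewrite mulr_ge0|apply: ler_pM].
  have -> : k2 * (n2 * Phi x) = k%:R * (n2 * (k%:R * Phi x)) by rewrite /k2; ring.
  by apply: ler_pM => //; [rewrite mulr_ge0|apply: ler_pM].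
split; apply: aux; do ?exact: nm_J.
  by move=> x; rewrite -lerBlDl (le_trans (ler_norm _)).
by move=> x; rewrite -lerBlDl (le_trans (ler_norm _))// distrC.
Qed.

Let J_fin k t : J k t t \is a fin_num.
Proof.
rewrite ge0_fin_numE//.
apply: (@le_lt_trans _ _ (\int[mu]_x (k%:R * k%:R * k%:R * Phi x)%:E)%E); last first.
  by rewrite intZ ?mulr_ge0// lte_mul_pinfty// lee_fin !mulr_ge0.
apply: le_int => //; first by apply: nmZ; rewrite ?mulr_ge0.
move=> x; have [ut0 P0] := ((u_nm t).2 x, ltW (Phi_gt0 x)).
rewrite /J_integrand -!mulrA ler_pM//.
- by rewrite le_min powR_ge0 ler0n.
- by rewrite mulr_ge0// le_min ?ut0 ?ler0n// ler01 mulr_ge0.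
- by rewrite ge_min lexx orbT.
- rewrite ler_pM//.
  + by rewrite le_min ut0 ler0n.
  + by rewrite le_min ler01 mulr_ge0.
  + by rewrite ge_min lexx orbT.
  + by rewrite ge_min lexx orbT.
Qed.

Let J_homo t : {homo (fun k => J k t t) : k p / (k <= p)%N >-> (k <= p)%E}.
Proof.
move=> k p kp; apply: le_int => // x; have [ut0 P0] := ((u_nm t).2 x, ltW (Phi_gt0 x)).
have kpR : k%:R <= p%:R :> R by rewrite ler_nat.
have minr (a b c : R) : b <= c -> Num.min a b <= Num.min a c.
  by move=> bc; rewrite le_min !ge_min lexx bc orbT.
rewrite /J_integrand ler_pM//.
- by rewrite le_min powR_ge0 ler0n.
- by rewrite mulr_ge0// le_min ?ut0 ?ler0n// ler01 mulr_ge0.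
- exact: minr.
- rewrite ler_pM//.
  + by rewrite le_min ut0 ler0n.
  + by rewrite le_min ler01 mulr_ge0.
  + exact: minr.
  + by apply: minr; rewrite ler_wpM2r.
Qed.

Let cvg_J t : J k t t @[k --> \oo] --> A t.
Proof.
rewrite power_massE; apply: cvg_integral_nondecreasing => //.
- by move=> k; exact: mE.
- by move=> k x _; rewrite lee_fin; exact: (nm_J k t t).2.
- move=> x _ k p kp; rewrite lee_fin; have [ut0 P0] := ((u_nm t).2 x, ltW (Phi_gt0 x)).
  have kpR : k%:R <= p%:R :> R by rewrite ler_nat.
  have minr (a b c : R) : b <= c -> Num.min a b <= Num.min a c.
    by move=> bc; rewrite le_min !ge_min lexx bc orbT.
  rewrite /J_integrand ler_pM//.
  + by rewrite le_min powR_ge0 ler0n.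
  + by rewrite mulr_ge0// le_min ?ut0 ?ler0n// ler01 mulr_ge0.
  + exact: minr.
  + rewrite ler_pM//.
    * by rewrite le_min ut0 ler0n.
    * by rewrite le_min ler01 mulr_ge0.
    * exact: minr.
    * by apply: minr; rewrite ler_wpM2r.
- move=> x _; apply: cvg_near_cst.
  have big (a : R) : \forall k \near \oo, a <= k%:R.
    exists (Num.Def.truncn a).+1 => // k /= ak.
    by apply/ltW/(lt_le_trans (truncnS_gt _)); rewrite ler_nat.
  near=> k; rewrite /J_integrand.
  have -> : Num.min (u t x `^ m) k%:R = u t x `^ m by apply/min_idPl; near: k; exact: big.
  have -> : Num.min (u t x) k%:R = u t x by apply/min_idPl; near: k; exact: big.
  have -> : Num.min 1 (k%:R * Phi x) = 1.
    by apply/min_idPl; rewrite -ler_pdivrMr//; near: k; exact: big.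
  by rewrite mulr1.
Unshelve. all: end_near. Qed.

Let power_mass_eq0 t : A t = 0%E -> (\int[mu]_x (u t x * Phi x)%:E = 0)%E.
Proof.
move=> At0.
have nA : nm (fun x => u t x `^ (1 + m)) by exact: nm_powR.
have nuP : nm (fun x => u t x * Phi x) by exact: nm_mul.
have : (\int[mu]_x `|(u t x `^ (1 + m))%:E| = 0)%E.
  rewrite -[RHS]At0; apply: eq_integral => x _.
  by rewrite gee0_abs// lee_fin powR_ge0.
move/(ae_eq_integral_abs mu measurableT (mE nA)) => h.
rewrite (@ge0_ae_eq_integral _ _ _ _ _ _ (cst 0%E))//.
- by rewrite integral_cst// mul0e.
- exact: mE.
- by move=> x _; rewrite lee_fin; exact: nuP.2.
- apply: filterS h => x /(_ I) [/eqP]; rewrite powR_eq0 => /andP[/eqP -> _] _.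
  by rewrite mul0r.
Qed.

Lemma reaction_young r t :
  (reaction (u r) t <= (m / (1 + m))%:E * A t + (1 + m)^-1%:E * A r)%E.
Proof.
have /andP[m0 m1] := m01; have m10 : 0 < 1 + m by lra.
have nA q : nm (fun x => u q x `^ (1 + m)) by exact: nm_powR.
rewrite /power_mass -!intZ//; [|by rewrite invr_ge0 ltW|by rewrite divr_ge0// ltW].
rewrite -intD; [|by apply: nmZ => //; rewrite divr_ge0// ltW|by apply: nmZ => //; rewrite invr_ge0 ltW].
apply: le_int.
- exact: nm_reac.
- by apply: nmD; apply: nmZ => //; rewrite ?invr_ge0 ?divr_ge0// ltW.
move=> x.
have q0 : 0 < (1 + m) / m by rewrite divr_gt0.
have := @conjugate_powR R (u t x `^ m) (u r x) ((1 + m) / m) (1 + m) (powR_ge0 _ _) ((u_nm r).2 x) q0 m10.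
rewrite -powRrM [m * _]mulrC divfK ?gt_eqF// invf_div.
have -> : m / (1 + m) + (1 + m)^-1 = 1 by field; rewrite gt_eqF.
by move=> /(_ erefl) h; apply: (le_trans h); rewrite [X in X + _]mulrC [X in _ + X]mulrC.
Qed.

Variable T0 : R.
Hypothesis extinct : (\int[mu]_x (u T0 x * Phi x)%:E = 0)%E.
Hypothesis extinct_min : forall t : R, 0 <= t ->
  (forall r : R, t <= r -> (\int[mu]_x (u r x * Phi x)%:E = 0)%E) -> T0 <= t.

Let Y_T0 : fine (Y T0) = 0.
Proof.
suff -> : Y T0 = 0%E by [].
(* The weighted L^1 norm, which vanishes at [T0], controls [B] when the first argument is dominated,
   so that argument is truncated first. *)
apply: (@cvg_unique _ (@ereal_hausdorff R) _ _ _ _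
  (cvg_kform_truncl (mu := mu) K_nm mPhi Phi_gt0 (u_nm T0) (u_nm T0))).
apply: cvg_near_cst; near=> n.
have tn : nm (trunc (u T0) n) by exact: nt.
apply/eqP; rewrite eq_le kform_ge0// andbT.
have cn x : trunc (u T0) n x <= n%:R * Phi x by rewrite ge_min lexx orbT.
by rewrite (le_trans (B_bound tn cn (u_nm T0)))// extinct mule0.
Unshelve. all: end_near. Qed.

Let B_uu_sqrt s t : (Y s < +oo)%E -> (Y t < +oo)%E -> (B (u s) (u t) < +oo)%E /\
  fine (B (u s) (u t)) <= Num.sqrt (fine (Y s)) * Num.sqrt (fine (Y t)).
Proof. exact: (kform_sqrt K_nm mPhi Phi_gt0 B_sym_dominated B_psd_dominated). Qed.

Let extinct_min_mass t : 0 <= t -> (forall r : R, t <= r -> A r = 0%E) -> T0 <= t.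
Proof.
move=> t0 H; apply: extinct_min => // r tr; apply: power_mass_eq0; exact: H.
Qed.

Let Buu s t := B (u s) (u t).
Let Ruu r t := reaction (u r) t.
Let Buu_ge0 s t : (0 <= Buu s t)%E. Proof. exact: kform_ge0. Qed.
Let Buu_sym s t : Buu s t = Buu t s. Proof. exact: B_sym. Qed.
Let Ruu_ge0 r t : (0 <= Ruu r t)%E. Proof. exact: reaction_ge0. Qed.
Let measurable_Ruu r : measurable_fun setT (Ruu r).
Proof. exact: measurable_reaction. Qed.
Let duality_uu (r a b : R) : 0 <= a -> a <= b ->
  (Buu r a = Buu r b + \int[leb]_(t in `[a, b]) Ruu r t)%E.
Proof. exact: duality. Qed.

Lemma power_mass_fin_num t : 0 <= t -> A t \is a fin_num.
Proof.
exact: (@power_mass_fin R m Buu Ruu A J m01 Buu_ge0 Buu_sym B_uu_sqrt Ruu_ge0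
  measurable_Ruu duality_uu power_mass_ge0 power_massE reaction_young J_ge0
  J_le_reaction J_near J_fin J_homo cvg_J Y0_fin A0_fin).
Qed.

Lemma Hstar_energy_fin t : 0 <= t -> Y t \is a fin_num.
Proof.
exact: (@Y_fin R Buu Ruu Buu_ge0 Buu_sym Ruu_ge0 duality_uu Y0_fin).
Qed.

Lemma Hstar_energy_upper t : 0 <= t < T0 -> fine (Y t) `^ ((1 - m) / 2) <=
  (1 - m) * (fine (A 0) / fine (Y 0) `^ ((1 + m) / 2)) * (T0 - t).
Proof.
exact: (@energy_upper R m Buu Ruu A J m01 Buu_ge0 Buu_sym B_uu_sqrt Ruu_ge0
  measurable_Ruu duality_uu power_mass_ge0 power_massE reaction_young J_ge0
  J_le_reaction J_near J_fin J_homo cvg_J Y0_fin A0_fin T0 Y_T0 extinct_min_mass).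
Qed.

Lemma Hstar_energy_lower c t : 0 <= c ->
  (forall r : R, 0 <= r < T0 -> c * fine (Y r) `^ ((1 + m) / 2) <= fine (A r)) ->
  0 <= t < T0 -> (1 - m) * c * (T0 - t) <= fine (Y t) `^ ((1 - m) / 2).
Proof.
exact: (@energy_lower R m Buu Ruu A J m01 Buu_ge0 Buu_sym B_uu_sqrt Ruu_ge0
  measurable_Ruu duality_uu power_mass_ge0 power_massE reaction_young J_ge0
  J_le_reaction J_near J_fin J_homo cvg_J Y0_fin A0_fin T0 Y_T0 extinct_min_mass).
Qed.

End evolution.

(** * Lebesgue measure of a bounded open set *)

Section lebesgue_domain.
Variables (R : realType).

Definition box n (M : R) : set 'rV[R]_n := [set v | forall i, `|v ord0 i| <= M].

Lemma measurable_box n M : measurable (@box n M).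
Proof.
have -> : @box n M = \bigcap_(i in [set: 'I_n]) ((fun v : 'rV[R]_n => v ord0 i) @^-1` `[- M, M]).
  apply/seteqP; split => [v bv i _ /=|v bv i].
    by rewrite in_itv/= -ler_norml; exact: bv.
  by have := bv i Logic.I; rewrite /= in_itv/= -ler_norml.
apply: fin_bigcap_measurable => // i _.
rewrite -[X in measurable X]setTI.
have : measurable_fun setT (fun v : 'rV[R]_n => v ord0 i).
  by apply: continuous_measurable_rV; exact: coord_continuous.
by apply.
Qed.

Lemma lebesgue_rV_box n M : (lebesgue_rV R n (box M) < +oo)%E.
Proof.
elim: n => [|n IH] /=.
  rewrite diracE; case: (_ \in _) => /=; exact: ltry.
rewrite /lebesgue_step /pushforward.
have -> : @cons_rV R n @^-1` box M = `[- M, M] `*` box M.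
  apply/seteqP; split => [[x v] /= H|[x v] /= [H1 H2] i].
    split=> [|i] /=.
      by have := H ord0; rewrite mxE unlift_none in_itv/= -ler_norml.
    by have := H (lift ord0 i); rewrite mxE liftK.
  rewrite mxE; case: (unliftP ord0 i) => [j _|_] /=; first exact: H2.
  by move: H1; rewrite in_itv/= -ler_norml.
rewrite product_measure1E//; last exact: measurable_box.
have h : (lebesgue_measure (`[(- M)%R, M] : set (measurableTypeR R)) < +oo)%E.
  by rewrite lebesgue_measure_itv/=; case: ifP => // _; rewrite -EFinB ltry.
by rewrite lte_mul_pinfty// ge0_fin_numE.
Qed.

Lemma bounded_lebesgue_rV n (O : set 'rV[R]_n) : bounded_set O -> measurable O ->
  (lebesgue_rV R n O < +oo)%E.
Proof.
move=> [M [_ HM]] mO; apply: le_lt_trans (lebesgue_rV_box n (M + 1)).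
rewrite le_measure ?inE//; first exact: measurable_box.
move=> v Ov i; have M1 : M < M + 1 by rewrite ltrDl.
have := HM (M + 1) M1 v Ov; apply: le_trans.
rewrite [X in _ <= X]mx_normrE; exact: (@le_bigmax _ _ _ 0 (fun ij : 'I_1 * 'I_n => `|v ij.1 ij.2|) (ord0, i)).
Qed.

Variables (n : nat) (O : set 'rV[R]_n) (oO : open O).

Lemma ae_lebesgue_on (P : 'rV[R]_n -> Prop) :
  {ae lebesgue_rV R n, forall x, O x -> P x} -> {ae lebesgue_on oO, forall x, P x}.
Proof.
move=> [A [mA A0 PA]].
have mO := open_measurable_rV oO.
exists (A `|` ~` O); split.
- by apply: measurableU => //; exact: measurableC.
- rewrite /lebesgue_on /= /mrestr setIUl setICl setU0.
  apply/eqP; rewrite eq_le measure_ge0 andbT -A0.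
  by rewrite le_measure ?inE//; exact: measurableI.
- move=> x /= nP; case: (pselect (O x)) => Ox; last by right.
  by left; apply: PA => /= H; apply: nP; exact: H.
Qed.

(** By Fubini, almost every section of a null set of the product is null. This turns a bound for
    almost every pair into one for almost every [x] and then almost every [y]. *)
Lemma ae_ae_lebesgue_on (P : 'rV[R]_n -> 'rV[R]_n -> Prop) :
  {ae (lebesgue_rV R n \x lebesgue_rV R n)%E, forall z, O z.1 -> O z.2 -> P z.1 z.2} ->
  {ae lebesgue_on oO, forall x, {ae lebesgue_on oO, forall y, P x y}}.
Proof.
move=> [A [mA A0 PA]]; apply: ae_lebesgue_on.
have h : ae_eq (lebesgue_rV R n) setT (lebesgue_rV R n \o xsection A) (cst 0%E).
  apply/ae_eq_integral_abs => //; first exact: measurable_fun_xsection.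
  rewrite -[RHS]A0 /product_measure1.
  by apply: eq_integral => x _; rewrite gee0_abs.
apply: filterS h => x /(_ Logic.I) /= h Ox; apply: ae_lebesgue_on.
exists (xsection A x); split => //; first exact: measurable_xsection.
move=> y /= nP; rewrite /xsection/= inE; apply: PA => /= H; apply: nP => Oy.
exact: H.
Qed.

(** The same restricted measure as [lebesgue_on], packaged as a finite one, as the inclusions
    between L^p spaces require. *)
Definition lebesgue_on_finite (fO : (lebesgue_rV R n O < +oo)%E) :
    {finite_measure set 'rV[R]_n -> \bar R} :=
  mfrestr (open_measurable_rV oO) fO.

End lebesgue_domain.

(** * The Green function *)

Section Lfun_bounded.
Context d (T : measurableType d) (R : realType) (mu : {finite_measure set T -> \bar R}).

Lemma Lfun_measurable p (f : T -> R) : f \in Lfun mu p -> measurable_fun setT f.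
Proof. by case/andP => + _; rewrite inE. Qed.

Lemma ae_bounded_Loo (f : T -> R) (C : R) : 0 <= C -> {ae mu, forall x, `|f x| <= C} ->
  ('N[mu]_(+oo)[EFin \o f] <= C%:E)%E.
Proof.
move=> C0 fC; rewrite unlock /Lnorm; case: ifP => _; last by rewrite lee_fin.
by apply/ess_supP; apply: filterS fC => x /=; rewrite lee_fin.
Qed.

Lemma bounded_LfunP (f : T -> R) (C : R) : measurable_fun setT f ->
  {ae mu, forall x, `|f x| <= C} -> f \in Lfun mu +oo%E.
Proof.
move=> mf fC; apply/andP; rewrite !inE; split => //=.
rewrite /finite_norm; apply: (@le_lt_trans _ _ (`|C|%:E)); last exact: ltry.
apply: ae_bounded_Loo => //; apply: filterS fC => x /le_trans; apply.
exact: ler_norm.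
Qed.

Lemma Loo_bounded (f : T -> R) : f \in Lfun mu +oo%E ->
  exists2 C, 0 <= C & {ae mu, forall x, `|f x| <= C}.
Proof.
case/andP; rewrite !inE => mf /=; rewrite /finite_norm unlock /Lnorm.
case: ifPn => [mu0 foo|]; last first.
  (* For the null measure the L^oo norm is [0] by convention, and every property holds almost
     everywhere. *)
  rewrite -leNgt => mu0 _; exists 0 => //.
  exists setT; split => //; apply/eqP; rewrite eq_le mu0/=; exact: measure_ge0.
have H := ess_sup_ge mu (abse \o (EFin \o f)).
move: foo H; case E : (ess_sup _ _) => [r| |] // _ H.
  exists `|r| => //; apply: filterS H => x /=; rewrite lee_fin => /le_trans; apply.
  exact: ler_norm.
exists 0 => //; apply: filterS H => x /=.
by rewrite leNgt ltNyr.
Qed.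

Lemma Loo_Lfun (f : T -> R) (r : R) : 1 <= r -> f \in Lfun mu +oo%E -> f \in Lfun mu r%:E.
Proof.
move=> r1 fo; apply: (@Lfun_subset _ _ _ mu r%:E +oo%E) => //.
- by rewrite leey.
- by rewrite fin_num_measure.
- by rewrite leey.
Qed.

Lemma bounded_integrable (f : T -> R) (C : R) : measurable_fun setT f ->
  {ae mu, forall x, `|f x| <= C} -> mu.-integrable setT (EFin \o f).
Proof.
move=> mf fC; apply/Lfun1_integrable; apply: (Loo_Lfun (lexx _)).
exact: bounded_LfunP fC.
Qed.

Lemma ae_eq_Rintegral (f g : T -> R) : measurable_fun setT f -> measurable_fun setT g ->
  {ae mu, forall x, f x = g x} -> \int[mu]_x f x = \int[mu]_x g x.
Proof.
move=> mf mg fg; rewrite /Rintegral; congr fine; apply: ae_eq_integral => //.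
- exact: measurable_fun_EFin.
- exact: measurable_fun_EFin.
- by apply: filterS fg => x -> .
Qed.

End Lfun_bounded.

(** * Symmetry and positivity of the form of the Green function *)

Section kernel.
Variables (R : realType) (N : nat).
Local Notation E := 'rV[R]_N.
Variables (mu : {finite_measure set E -> \bar R}) (L : operator R N)
  (G : E -> E -> R) (lam : R) (Phi1 : E -> R).
Hypothesis L_lin : densely_defined_linear mu L.
Hypothesis L_sa : selfadjoint_nonneg mu L.
Hypothesis L_inv : inverse_kernel mu L G.
Hypothesis L_eig : first_eigenpair mu L lam Phi1.
Hypothesis G_ge0 : {ae mu, forall x, {ae mu, forall y, 0 <= G x y}}.
Local Notation nm := (@nonneg_measurable _ E R).

(* [G] and [Phi1] have a sign only almost everywhere; [kernel_pos] and [weight]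
   are versions with this sign everywhere. *)
Definition kernel_pos (z : E * E) : R := Num.max (G z.1 z.2) 0.
Definition weight (x : E) : R := if 0 < Phi1 x then Phi1 x else 1.
Local Notation K := kernel_pos.
Local Notation Phi := weight.
Local Notation B := (kform mu K).
Local Notation gr := (green_op mu G).

Let mG : measurable_fun setT (fun z : E * E => G z.1 z.2).
Proof. by case: L_inv. Qed.

Lemma kernel_pos_nm : nonneg_measurable K.
Proof.
split; first exact: measurable_maxr.
by move=> z; rewrite le_max lexx orbT.
Qed.
Let K_nm := kernel_pos_nm.

Let mPhi1 : measurable_fun setT Phi1.
Proof. by case: L_eig => _ _ _ [_ /Lfun_measurable]. Qed.

Lemma measurable_weight : measurable_fun setT Phi.
Proof.
apply: measurable_fun_ifT => //.
exact: measurable_fun_ltr.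
Qed.
Let mPhi := measurable_weight.

Lemma weight_gt0 x : 0 < Phi x.
Proof. by rewrite /weight; case: ifP. Qed.
Let Phi_gt0 := weight_gt0.
Let nP : nm Phi. Proof. by split => // x; exact: ltW. Qed.

Lemma ae_weight : {ae mu, forall x, Phi1 x = Phi x}.
Proof.
case: L_eig => _ _ _ [P0 _] _; apply: filterS P0 => x.
by rewrite /weight => ->.
Qed.

Lemma weight_bounded : exists2 C, 0 <= C & {ae mu, forall x, `|Phi x| <= C}.
Proof.
case: L_eig => _ _ _ [_ /Loo_bounded[C C0 PC]] _; exists C => //.
by apply: filterS2 PC ae_weight => x + <-.
Qed.

Lemma dominated_bounded f : nm f -> dominated Phi f ->
  exists2 C, 0 <= C & {ae mu, forall x, `|f x| <= C}.
Proof.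
move=> [mf f0] [n fn]; have [C C0 PC] := weight_bounded.
exists (n%:R * C); first by rewrite mulr_ge0.
apply: filterS PC => x; rewrite !ger0_norm// ?(ltW (Phi_gt0 x))// => PC.
by rewrite (le_trans (fn x))// ler_wpM2l.
Qed.

Lemma dominated_Loo f : nm f -> dominated Phi f -> f \in Lfun mu +oo%E.
Proof.
by move=> nf /(dominated_bounded nf)[C _ fC]; apply: bounded_LfunP fC; case: nf.
Qed.

Let dPhi : dominated Phi Phi. Proof. by exists 1%N => x; rewrite mul1r. Qed.

Lemma weight_integral_lty : (\int[mu]_x (Phi x)%:E < +oo)%E.
Proof.
have /Lfun1_integrable/integrableP[_] := Loo_Lfun (lexx 1) (dominated_Loo nP dPhi).
apply: le_lt_trans; rewrite le_eqVlt; apply/orP; left; apply/eqP.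
by apply: eq_integral => x _; rewrite /= ger0_norm// ltW.
Qed.

(** An extended-real counterpart of [green_op]: the latter is a real integral, which takes the value
    [0] where the integral is infinite, so the two can be identified only after finiteness has been
    shown. *)
Definition potential (f : E -> R) (x : E) : \bar R := (\int[mu]_y (K (x, y) * f y)%:E)%E.

Let mKf f : nm f -> measurable_fun setT (fun z : E * E => (K z * f z.2)%:E).
Proof.
move=> [mf _]; apply: measurable_fun_EFin; apply: measurable_funM; first by case: K_nm.
exact: (measurableT_comp mf measurable_snd).
Qed.

Let Kf_ge0 f z : nm f -> (0 <= (K z * f z.2)%:E)%E.
Proof. by move=> [_ f0]; rewrite lee_fin mulr_ge0//; case: K_nm. Qed.

Lemma potential_ge0 f x : nm f -> (0 <= potential f x)%E.
Proof. by move=> nf; apply: integral_ge0 => y _; exact: (Kf_ge0 (x, y)). Qed.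

Lemma measurable_potential f : nm f -> measurable_fun setT (potential f).
Proof.
move=> nf.
apply: (measurable_fun_fubini_tonelli_F (m2 := mu) (fun z : E * E => (K z * f z.2)%:E)).
- exact: mKf.
- by move=> z; exact: Kf_ge0.
Qed.

Lemma kformE f g : nm f -> nm g -> (B f g = \int[mu]_x ((f x)%:E * potential g x))%E.
Proof.
move=> nf ng; rewrite /kform fubini_tonelli1.
- apply: eq_integral => x _; rewrite /fubini_F /potential.
  rewrite -ge0_integralZl_EFin//; last 3 first.
  + by move=> y _; exact: (Kf_ge0 (x, y)).
  + by apply: (measurableT_comp (mKf ng)); exact: measurable_pair1.
  + by case: nf.
  by apply: eq_integral => y _; rewrite -EFinM mulrA.
- by apply: measurable_fun_EFin; exact: kform_measurable.
- by move=> z; rewrite lee_fin kform_integrand_ge0.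
Qed.

Let mGx x : measurable_fun setT (G x).
Proof. exact: (measurableT_comp mG (measurable_pair1 x)). Qed.

Let mGf x f : measurable_fun setT f -> measurable_fun setT (fun y => G x y * f y).
Proof. by move=> mf; apply: (measurable_funM (mGx x)). Qed.

Lemma measurable_green f : measurable_fun setT f -> measurable_fun setT (gr f).
Proof.
move=> mf; rewrite /green_op /Rintegral; apply: measurableT_comp => //.
pose F (z : E * E) : \bar R := (G z.1 z.2 * f z.2)%:E.
have mF : measurable_fun setT F.
  apply: measurable_fun_EFin; apply: measurable_funM => //.
  exact: (measurableT_comp mf measurable_snd).
have -> : (fun x => \int[mu]_y (G x y * f y)%:E)%E =
    ((fun x => \int[mu]_y (F ^\+ (x, y))) \- (fun x => \int[mu]_y (F ^\- (x, y))))%E.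
  apply/funext => x; rewrite [LHS]integralE.
  by congr (_ - _)%E; apply: eq_integral => y _; rewrite ?funeposE ?funenegE.
apply: emeasurable_funB.
  by apply: (measurable_fun_fubini_tonelli_F (m2 := mu) (F ^\+)%E) => //; exact: measurable_funepos.
by apply: (measurable_fun_fubini_tonelli_F (m2 := mu) (F ^\-)%E) => //; exact: measurable_funeneg.
Qed.

Lemma green_ae_eq f g : measurable_fun setT f -> measurable_fun setT g ->
  {ae mu, forall x, f x = g x} -> gr f = gr g.
Proof.
move=> mf mg fg; apply/funext => x; apply: ae_eq_Rintegral.
- exact: mGf.
- exact: mGf.
- by apply: filterS fg => y ->.
Qed.

Lemma green_potential f : nm f -> {ae mu, forall x, gr f x = fine (potential f x)}.
Proof.
move=> [mf f0]; apply: filterS G_ge0 => x Gx; rewrite /green_op /Rintegral.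
congr fine; apply: ae_eq_integral => //.
- by apply: measurable_fun_EFin; exact: mGf.
- by apply: (measurableT_comp (mKf (conj mf f0))); exact: measurable_pair1.
- by apply: filterS Gx => y Gy _; rewrite /K/= (max_idPl Gy).
Qed.

Lemma potential_fin_L1 f : nm f -> f \in Lfun mu 1 ->
  {ae mu, forall x, potential f x \is a fin_num}.
Proof.
move=> [mf f0] f1; case: L_inv => _ /(_ f f1) H _ _.
apply: filterS2 H G_ge0 => x /integrableP[_ Gi] Gx.
rewrite ge0_fin_numE ?potential_ge0//; apply: le_lt_trans Gi.
rewrite le_eqVlt; apply/orP; left; apply/eqP; apply: ae_eq_integral => //.
- by apply: (measurableT_comp (mKf (conj mf f0))); exact: measurable_pair1.
- by apply: measurableT_comp => //; apply: measurable_fun_EFin; exact: mGf.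
- by apply: filterS Gx => y Gy _; rewrite /K/= (max_idPl Gy) ger0_norm// mulr_ge0.
Qed.

(** The left inverse applied to the eigenvalue equation: [gr (L Phi1) = Phi1] with
    [L Phi1 = lam * Phi1]. *)
Lemma potential_weight : {ae mu, forall x, potential Phi x = (lam^-1 * Phi x)%:E}.
Proof.
case: (L_eig) => lam0 [[dP _ _] LP] _ _ _.
have P1 : Phi \in Lfun mu 1 by exact: (Loo_Lfun (lexx 1) (dominated_Loo nP dPhi)).
have mLP : measurable_fun setT (L Phi1).
  by case: L_lin => /(_ _ dP)[_ /Lfun_measurable].
have mlP : measurable_fun setT (fun x => lam * Phi x) by exact: measurable_funM.
have nlP : nm (fun x => lam * Phi x) by apply: nmZ => //; exact: ltW.
have LPE : {ae mu, forall x, L Phi1 x = lam * Phi x}.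
  by apply: filterS2 LP ae_weight => x /(_ Logic.I) -> ->.
case: (L_inv) => _ _ _ /(_ _ dP); rewrite (green_ae_eq mLP mlP LPE) => H.
have fp := potential_fin_L1 nP P1.
have gp := green_potential nlP.
have Hw := ae_weight.
apply: filterS2 (filterI H Hw) (filterI fp gp) => x [/(_ Logic.I) h1 h2] [h3 h4].
move: h1; rewrite h4 h2.
have -> : potential (fun x => lam * Phi x) x = (lam%:E * potential Phi x)%E.
  rewrite /potential -ge0_integralZl_EFin//.
  - by apply: eq_integral => y _; rewrite -EFinM mulrCA.
  - by move=> y _; exact: (Kf_ge0 (x, y)).
  - by apply: (measurableT_comp (mKf nP)); exact: measurable_pair1.
  - exact: ltW.
rewrite -(fineK h3) -EFinM /= => <-.
by rewrite mulrA mulVf ?mul1r// gt_eqF.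
Qed.

Let lam0 : 0 < lam. Proof. by case: L_eig. Qed.

Lemma kform_weight f : nm f -> (B f Phi = lam^-1%:E * \int[mu]_x (f x * Phi x)%:E)%E.
Proof.
move=> nf; rewrite kformE//.
have nfP : nm (fun x => f x * Phi x) by exact: nm_mul.
rewrite -ge0_integralZl_EFin//; last 3 first.
- by move=> x _; rewrite lee_fin; case: nfP.
- by apply: measurable_fun_EFin; case: nfP.
- by rewrite invr_ge0 ltW.
apply: ae_eq_integral => //.
- apply: emeasurable_funM; first by apply: measurable_fun_EFin; case: nf.
  exact: measurable_potential.
- by apply: measurable_funeM; apply: measurable_fun_EFin; case: nfP.
- by apply: filterS potential_weight => x -> _; rewrite -!EFinM mulrCA.
Qed.

Lemma kform_dominated_fin f g : nm f -> nm g -> dominated Phi f -> dominated Phi g ->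
  B f g \is a fin_num.
Proof.
move=> nf ng df [n gn]; rewrite ge0_fin_numE; last exact: kform_ge0.
apply: (@le_lt_trans _ _ (B f (fun x => n%:R * Phi x))).
  by apply: le_kform => //; exact: nmZ.
rewrite kformZr// kform_weight// lte_mul_pinfty// ?lee_fin// ?mule_ge0//.
rewrite lte_mul_pinfty// ?lee_fin ?invr_ge0 ?ltW//.
have [C C0 fC] := dominated_bounded nf df; have [D D0 PD] := weight_bounded.
have /integrableP[_] : mu.-integrable setT (EFin \o (fun x => f x * Phi x)).
  apply: (@bounded_integrable _ _ _ _ _ (C * D)); first by case: (nm_mul nf nP).
  by apply: filterS2 fC PD => x h1 h2; rewrite normrM ler_pM.
apply: le_lt_trans; rewrite le_eqVlt; apply/orP; left; apply/eqP.
apply: eq_integral => x _; rewrite /= ger0_norm//.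
by case: (nm_mul nf nP).
Qed.

(** The solution is controlled in the weighted L^1 space rather than in L^1, so finiteness comes
    from the form: [Phi] times the potential is integrable and [Phi > 0]. *)
Lemma potential_fin f : nm f -> (B Phi f < +oo)%E ->
  {ae mu, forall x, potential f x \is a fin_num}.
Proof.
move=> nf; rewrite kformE// => foo.
have mPp : measurable_fun setT (fun x => (Phi x)%:E * potential f x)%E.
  apply: emeasurable_funM; first exact: measurable_fun_EFin.
  exact: measurable_potential.
have Pp0 x : (0 <= (Phi x)%:E * potential f x)%E.
  by rewrite mule_ge0 ?potential_ge0// lee_fin ltW.
have : mu.-integrable setT (fun x => (Phi x)%:E * potential f x)%E.
  apply/integrableP; split => //; apply: le_lt_trans foo.
  rewrite le_eqVlt; apply/orP; left; apply/eqP; apply: eq_integral => x _.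
  by rewrite gee0_abs.
move/(integrable_ae measurableT); apply: filterS => x /(_ Logic.I).
rewrite ge0_fin_numE// ge0_fin_numE ?potential_ge0//.
move=> h; rewrite ltey; apply/eqP => pE; move: h.
by rewrite pE gt0_muley ?lte_fin.
Qed.

Lemma integral_green f g : nm f -> nm g -> (B Phi g < +oo)%E ->
  (\int[mu]_x (f x * gr g x)%:E = B f g)%E.
Proof.
move=> nf ng goo; rewrite kformE//; apply: ae_eq_integral => //.
- apply: measurable_fun_EFin; apply: measurable_funM; first by case: nf.
  by apply: measurable_green; case: ng.
- apply: emeasurable_funM; first by apply: measurable_fun_EFin; case: nf.
  exact: measurable_potential.
- apply: filterS2 (potential_fin ng goo) (green_potential ng) => x h1 h2 _.
  by rewrite h2 EFinM fineK.
Qed.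

Lemma pairing_green f g : nm f -> nm g -> (B Phi g < +oo)%E ->
  pairing mu f (gr g) = fine (B f g).
Proof. by move=> nf ng goo; rewrite /pairing /Rintegral integral_green. Qed.

Let kform_weight_lty f : nm f -> dominated Phi f -> (B Phi f < +oo)%E.
Proof.
by move=> nf df; rewrite ltey_eq kform_dominated_fin.
Qed.

(** Comparison with the eigenfunction: if [f <= n * Phi], the potential of [f] is at most
    [n / lam * Phi]. Hence [gr f] lies in the domain of [L] in L^2, where self-adjointness can be
    used. *)
Lemma green_bounded f : nm f -> dominated Phi f ->
  exists2 C, 0 <= C & {ae mu, forall x, `|gr f x| <= C}.
Proof.
move=> nf [n fn]; have [C C0 PC] := weight_bounded.
exists (n%:R * (lam^-1 * C)); first by rewrite !mulr_ge0// invr_ge0 ltW.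
apply: filterS2 (filterI PC (green_potential nf)) potential_weight => x [h1 h2] h3.
have h4 : (potential f x <= (n%:R * (lam^-1 * Phi x))%:E)%E.
  rewrite EFinM -h3 /potential -ge0_integralZl_EFin//.
  - apply: ge0_le_integral => //.
    + by move=> y _; exact: (Kf_ge0 (x, y)).
    + by apply: (measurableT_comp (mKf nf)); exact: measurable_pair1.
    + by apply: measurable_funeM; apply: (measurableT_comp (mKf nP)); exact: measurable_pair1.
    + move=> y _; rewrite -EFinM lee_fin mulrCA ler_wpM2l//; by case: K_nm.
  - by move=> y _; exact: (Kf_ge0 (x, y)).
  - by apply: (measurableT_comp (mKf nP)); exact: measurable_pair1.
have p0 := potential_ge0 x nf.
rewrite h2 ger0_norm ?fine_ge0//.
have pf : potential f x \is a fin_num by rewrite ge0_fin_numE// (le_lt_trans h4)// ltry.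
move: h4; rewrite -{1}(fineK pf) lee_fin => /le_trans; apply.
rewrite ler_wpM2l// ler_wpM2l ?invr_ge0 ?(ltW lam0)//.
by rewrite (le_trans (ler_norm _)).
Qed.

Lemma green_dom f (C : R) : f \in Lfun mu +oo%E -> {ae mu, forall x, `|gr f x| <= C} ->
  dom2 mu L (gr f) /\ {ae mu, forall x, L (gr f) x = f x}.
Proof.
move=> foo gC; have f1 := Loo_Lfun (lexx 1) foo.
have mf := Lfun_measurable foo.
case: L_inv => _ _ /(_ _ f1)[dg Lg] _.
have [D D0 fD] := Loo_bounded foo.
have Lg' : {ae mu, forall x, L (gr f) x = f x} by apply: filterS Lg => x; apply.
split => //; split => //.
  apply: Loo_Lfun; first by rewrite ler1n.
  by apply: bounded_LfunP gC; exact: measurable_green.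
apply: Loo_Lfun; first by rewrite ler1n.
apply: (@bounded_LfunP _ _ _ _ _ D).
  by case: L_lin => /(_ _ dg)[_ /Lfun_measurable].
by apply: filterS2 Lg' fD => x ->.
Qed.

Lemma measurable_Lgreen f : f \in Lfun mu 1 -> measurable_fun setT (L (gr f)).
Proof.
move=> f1; case: L_inv => _ _ /(_ _ f1)[dg _] _.
by case: L_lin => /(_ _ dg)[_ /Lfun_measurable].
Qed.

Lemma pairing_Lgreen f g : f \in Lfun mu 1 -> measurable_fun setT g ->
  {ae mu, forall x, L (gr f) x = f x} -> pairing mu (L (gr f)) g = pairing mu f g.
Proof.
move=> f1 mg H; apply: ae_eq_Rintegral.
- by apply: measurable_funM => //; exact: measurable_Lgreen.
- by apply: measurable_funM => //; exact: Lfun_measurable f1.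
- by apply: filterS H => x ->.
Qed.

Lemma pairingC f g : pairing mu f g = pairing mu g f.
Proof. by apply: eq_Rintegral => x _; rewrite mulrC. Qed.

(** Self-adjointness at [gr f] and [gr g]: the pairing of [f] with [gr g] is that of [L (gr f)] with
    [gr g], hence that of [gr f] with [L (gr g) = g]. *)
Lemma kform_sym_dominated f g : nm f -> nm g -> dominated Phi f -> dominated Phi g ->
  B f g = B g f.
Proof.
move=> nf ng df dg.
have [Cf Cf0 fC] := green_bounded nf df; have [Cg Cg0 gC] := green_bounded ng dg.
have [foo goo] := (dominated_Loo nf df, dominated_Loo ng dg).
have [d2f Lf] := green_dom foo fC; have [d2g Lg] := green_dom goo gC.
have f1 := Loo_Lfun (lexx 1) foo.
case: L_sa => _ /(_ (gr g) g) H _.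
have l12 : 1 <= 2 :> R by rewrite ler1n.
have g2 : gr g \in Lfun mu 2%:E by case: d2g.
have [H1 _] := H g2 (Loo_Lfun l12 goo).
have := H1 (conj d2g (filterS (fun x h _ => h) Lg)) _ d2f.
rewrite pairing_Lgreen//; last by apply: measurable_green; case: ng.
rewrite pairing_green//; last exact: kform_weight_lty.
rewrite pairingC pairing_green//; last exact: kform_weight_lty.
move=> h; rewrite -(fineK (kform_dominated_fin nf ng df dg)).
by rewrite -(fineK (kform_dominated_fin ng nf dg df)) h.
Qed.

(** Nonnegativity of [L] at [gr (f - g)], which gives a nonnegative pairing of [f - g] with its
    Green potential. It is expanded with real integrals of bounded functions, since [f - g] has no
    sign. *)
Lemma kform_psd_dominated f g : nm f -> nm g -> dominated Phi f -> dominated Phi g ->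
  (B f g + B g f <= B f f + B g g)%E.
Proof.
move=> nf ng df dg.
have [Cf Cf0 fC] := green_bounded nf df; have [Cg Cg0 gC] := green_bounded ng dg.
have [foo goo] := (dominated_Loo nf df, dominated_Loo ng dg).
have [Df Df0 fD] := Loo_bounded foo; have [Dg Dg0 gD] := Loo_bounded goo.
have [mf mg] := (Lfun_measurable foo, Lfun_measurable goo).
have mh : measurable_fun setT (f \- g) by exact: measurable_funB.
have hoo : f \- g \in Lfun mu +oo%E.
  apply: (@bounded_LfunP _ _ _ _ _ (Df + Dg)) => //.
  by apply: filterS2 fD gD => x h1 h2; rewrite (le_trans (ler_normB _ _))// lerD.
have f1 := Loo_Lfun (lexx 1) foo; have g1 := Loo_Lfun (lexx 1) goo.
have h1 := Loo_Lfun (lexx 1) hoo.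
have ghE : {ae mu, forall x, gr (f \- g) x = gr f x - gr g x}.
  case: L_inv => _ I _ _; apply: filterS2 (I _ f1) (I _ g1) => x If Ig.
  rewrite /green_op -RintegralB//; apply: eq_Rintegral => y _.
  by rewrite -mulrBr.
have hC : {ae mu, forall x, `|gr (f \- g) x| <= Cf + Cg}.
  apply: filterS2 ghE (filterI fC gC) => x -> [x1 x2].
  by rewrite (le_trans (ler_normB _ _))// lerD.
have [d2h Lh] := green_dom hoo hC.
case: L_sa => _ _ /(_ _ d2h); rewrite pairingC pairing_Lgreen//; last exact: measurable_green.
have gint (a b : E -> R) (Ca Cb : R) : measurable_fun setT a -> measurable_fun setT b ->
    {ae mu, forall x, `|a x| <= Ca} -> {ae mu, forall x, `|b x| <= Cb} ->
    mu.-integrable setT (EFin \o (fun x => a x * b x)).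
  move=> ma mb aC bC; apply: (@bounded_integrable _ _ _ _ _ (Ca * Cb)).
    exact: measurable_funM.
  by apply: filterS2 aC bC => x *; rewrite normrM ler_pM.
have mgf := measurable_green mf; have mgg := measurable_green mg.
have -> : pairing mu (f \- g) (gr (f \- g)) =
   \int[mu]_x ((f x * gr f x - f x * gr g x) - (g x * gr f x - g x * gr g x)).
  apply: ae_eq_Rintegral.
  - by apply: measurable_funM => //; exact: measurable_green.
  - by apply: measurable_funB; apply: measurable_funB; exact: measurable_funM.
  - by apply: filterS ghE => x -> /=; ring.
have If := gint _ _ _ _ mf mgf fD fC; have Ifg := gint _ _ _ _ mf mgg fD gC.
have Igf := gint _ _ _ _ mg mgf gD fC; have Ig := gint _ _ _ _ mg mgg gD gC.
rewrite RintegralB//; last 2 first.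
- exact: (integrableB measurableT If Ifg).
- exact: (integrableB measurableT Igf Ig).
rewrite !RintegralB//.
have pE (a b : E -> R) : nm a -> nm b -> dominated Phi b -> \int[mu]_x (a x * gr b x) = fine (B a b).
  by move=> na nb db; apply: pairing_green => //; exact: kform_weight_lty.
rewrite !pE// => h.
rewrite -(fineK (kform_dominated_fin nf nf df df)) -(fineK (kform_dominated_fin nf ng df dg)).
rewrite -(fineK (kform_dominated_fin ng nf dg df)) -(fineK (kform_dominated_fin ng ng dg dg)).
rewrite -!EFinD lee_fin; lra.
Qed.

End kernel.

(** * Weak dual solutions *)

Lemma cvge0_near (R : realType) (I : Type) (F : set_system I) (FF : Filter F)
    (f : I -> \bar R) (e : R) : 0 < e -> f @ F --> 0%E ->
  \forall x \near F, (f x < e%:E)%E.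
Proof.
move=> e0 f0; have h : nbhs (0%E : \bar R) [set y | (y < e%:E)%E].
  by apply: open_ereal_lt'; rewrite lte_fin.
exact: f0 h.
Qed.

Lemma cvge0_squeeze (R : realType) (I : Type) (F : set_system I) (FF : Filter F)
    (f : I -> \bar R) (g : I -> R) :
  (forall x, (0 <= f x <= (g x)%:E)%E) -> g @ F --> (0 : R) -> f @ F --> 0%E.
Proof.
move=> fg g0; apply: (@squeeze_cvge _ _ _ _ (cst 0%E) _ (fun x => (g x)%:E)).
- exact: nearW.
- exact: cvg_cst.
- by apply/fine_cvgP; split; [exact: nearW|exact: g0].
Qed.

Lemma cvg_norm_mul0 (R : realType) (I : Type) (F : set_system I) (FF : Filter F)
    (f : I -> R) (l c : R) :
  f @ F --> l -> (fun x => `|f x - l| * c) @ F --> (0 : R).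
Proof.
move=> fl; have : (fun x => `|f x - l| * c) @ F --> `|l - l| * c.
  by apply: cvgM; [apply: cvg_norm; apply: cvgB => //; exact: cvg_cst|exact: cvg_cst].
by rewrite subrr normr0 mul0r.
Qed.

Lemma sqrtr_powR (R : realType) (x p : R) : 0 <= x -> Num.sqrt x `^ p = x `^ (p / 2).
Proof.
move=> x0; rewrite -{2}(sqr_sqrtr x0) -powR_mulrn ?sqrtr_ge0// -powRrM.
by congr (_ `^ _); field.
Qed.

Lemma le_sqr_of_le_mul_sqrt (R : realType) (b c : R) : 0 <= b -> 0 <= c ->
  b <= c * Num.sqrt b -> b <= c ^+ 2.
Proof.
move=> b0 c0; have s0 := sqrtr_ge0 b; rewrite -{1 3}(sqr_sqrtr b0).
move: s0; rewrite le_eqVlt => /predU1P[<- _|s0]; first by rewrite expr0n/= sqr_ge0.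
rewrite expr2 ler_pM2r// => sc.
by rewrite -expr2 lerXn2r// nnegrE ltW.
Qed.

Section solution.
Variables (R : realType) (N : nat).
Local Notation E := 'rV[R]_N.
Variables (mu : {finite_measure set E -> \bar R}) (L : operator R N)
  (G : E -> E -> R) (lam : R) (Phi1 : E -> R).
Hypothesis L_lin : densely_defined_linear mu L.
Hypothesis L_sa : selfadjoint_nonneg mu L.
Hypothesis L_inv : inverse_kernel mu L G.
Hypothesis L_eig : first_eigenpair mu L lam Phi1.
Hypothesis G_ge0 : {ae mu, forall x, {ae mu, forall y, 0 <= G x y}}.
Variables (m T : R) (u0 : E -> R) (u : R -> E -> R).
Hypothesis m01 : 0 < m < 1.
Hypothesis u0_Lp : u0 \in Lfun mu (1 + m)%:E.
Hypothesis u0_Hstar : in_Hstar mu L u0.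
Hypothesis u_sol : WDS_CDP mu Phi1 G m u0 u.
Hypothesis u_ge0 : forall t, 0 <= t -> {ae mu, forall x, 0 <= u t x}.
Hypothesis u_ext : extinction_time mu u T.
Local Notation nm := (@nonneg_measurable _ E R).
Local Notation K := (kernel_pos G).
Local Notation Phi := (weight Phi1).
Local Notation B := (kform mu K).
Local Notation gr := (green_op mu G).
Local Notation leb := (@lebesgue_measure R).

Let K_nm : nonneg_measurable K. Proof. exact: (kernel_pos_nm L_inv). Qed.
Let mPhi : measurable_fun setT Phi. Proof. exact: (measurable_weight L_eig). Qed.
Let Phi_gt0 : forall x, 0 < Phi x. Proof. exact: weight_gt0. Qed.
Let nP : nm Phi. Proof. by split => // x; exact: ltW. Qed.
Let Phi1E := ae_weight L_eig.

(* Freezing [u] for [t < 0] turns continuity on the half-line into continuity on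
   the whole line. *)
Definition positive_extension (t : R) (x : E) : R := Num.max (u (Num.max t 0) x) 0.
Local Notation v := positive_extension.

Let max0 (t : R) : 0 <= Num.max t 0. Proof. by rewrite le_max lexx orbT. Qed.

Let u_L1w (t : R) : 0 <= t -> in_L1w mu Phi1 (u t).
Proof.
move=> t0; case: u_sol => _ H; have t1 : 0 < t + 1 by rewrite ltr_wpDl.
have [_ + _] := H _ t1; move=> /(_ t); case; rewrite //= in_itv/= t0/=.
by rewrite ltrDl.
Qed.

Let measurable_u (t : R) : 0 <= t -> measurable_fun setT (u t).
Proof. by case/u_L1w. Qed.

Let v_nm t : nm (v t).
Proof.
split; last by move=> x; rewrite le_max lexx orbT.
by apply: measurable_maxr => //; exact: measurable_u.
Qed.

Lemma positive_extensionE (t : R) : 0 <= t -> {ae mu, forall x, v t x = u t x}.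
Proof.
move=> t0; apply: filterS (u_ge0 t0) => x ux.
by rewrite /v (max_idPl t0) (max_idPl ux).
Qed.

Let wnormE f : measurable_fun setT f ->
  wnorm mu Phi1 f = (\int[mu]_x (`|f x| * Phi x)%:E)%E.
Proof.
move=> mf; have mPhi1 : measurable_fun setT Phi1.
  by case: L_eig => _ _ _ [_ /Lfun_measurable].
apply: ae_eq_integral => //.
- apply: measurable_fun_EFin; apply: measurable_funM => //.
  exact: measurableT_comp.
- apply: measurable_fun_EFin; apply: measurable_funM => //.
  exact: measurableT_comp.
- by apply: filterS Phi1E => x -> _.
Qed.

Let v_L1 t : (\int[mu]_x (v t x * Phi x)%:E < +oo)%E.
Proof.
have [mut] := u_L1w (max0 t); rewrite wnormE//; apply: le_lt_trans.
apply: ge0_le_integral => //.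
- by move=> x _; rewrite lee_fin mulr_ge0//; [exact: (v_nm t).2|exact: ltW].
- by apply: measurable_fun_EFin; apply: measurable_funM => //; case: (v_nm t).
- apply: measurable_fun_EFin; apply: measurable_funM => //.
  exact: measurableT_comp.
- move=> x _; rewrite lee_fin ler_wpM2r ?(ltW (Phi_gt0 x))// /v.
  by rewrite ge_max normr_ge0 ler_norm.
Qed.

Let max_dist (a b c : R) : `|Num.max a c - Num.max b c| <= `|a - b|.
Proof.
wlog ba : a b / b <= a => [H|].
  by case: (leP b a) => [|/ltW] h; [|rewrite distrC [X in _ <= X]distrC]; exact: H.
have h : Num.max b c <= Num.max a c by rewrite ge_max !le_max ba lexx ?orbT.
rewrite !ger0_norm ?subr_ge0//.
by rewrite /Num.max; case: (ltP a c) => h1; case: (ltP b c) => h2; lra.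
Qed.

Let v_cont (t e : R) : 0 < e -> exists2 dl : R, 0 < dl & forall r : R, `|r - t| < dl ->
  (\int[mu]_x (`|v r x - v t x| * Phi x)%:E <= e%:E)%E.
Proof.
move=> e0; pose t' := Num.max t 0; have t'0 : 0 <= t' by exact: max0.
case: u_sol => _ H; have t1 : 0 < t' + 1 by rewrite ltr_wpDl.
have [_ + _] := H _ t1; move=> /(_ t').
rewrite /= in_itv/= t'0 ltrDl ltr01 => /(_ isT)[_].
move/(cvge0_near _ e0); rewrite near_withinE => -[dl /= dl0 Hd].
exists (Num.min dl 1); first by rewrite lt_min dl0 ltr01.
move=> r; rewrite lt_min => /andP[rt rt1].
pose r' := Num.max r 0; have r'0 : 0 <= r' by exact: max0.
have rt' : `|r' - t'| <= `|r - t| by exact: max_dist.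
have Ir : `[0, t' + 1[%classic r'.
  rewrite /= in_itv/= r'0/= -ltrBlDl.
  by rewrite (le_lt_trans (ler_norm _))// (le_lt_trans rt').
have hb : `|t' - r'| < dl.
  by rewrite distrC (le_lt_trans rt').
have := Hd r' hb Ir; rewrite wnormE; last by apply: measurable_funB; exact: measurable_u.
move=> /ltW; apply: le_trans.
apply: ge0_le_integral => //.
- by move=> x _; rewrite lee_fin mulr_ge0// ltW.
- apply: measurable_fun_EFin; apply: measurable_funM => //.
  by apply: measurableT_comp => //; apply: measurable_funB; [case: (v_nm r)|case: (v_nm t)].
- apply: measurable_fun_EFin; apply: measurable_funM => //.
  by apply: measurableT_comp => //; apply: measurable_funB; exact: measurable_u.
- by move=> x _; rewrite lee_fin ler_wpM2r ?(ltW (Phi_gt0 x))// max_dist.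
Qed.

Let lam0 : 0 < lam. Proof. by case: L_eig. Qed.
Let B_sym_dominated := kform_sym_dominated L_lin L_sa L_inv L_eig G_ge0.
Let B_psd_dominated := kform_psd_dominated L_lin L_sa L_inv L_eig G_ge0.
Let B_Phi := kform_weight L_lin L_inv L_eig G_ge0.

Let B_sym f g : nm f -> nm g -> B f g = B g f.
Proof. exact: (kform_sym K_nm mPhi Phi_gt0 B_sym_dominated). Qed.

Let B_Phi_lty f : nm f -> (\int[mu]_x (f x * Phi x)%:E < +oo)%E -> (B Phi f < +oo)%E.
Proof.
move=> nf foo; rewrite B_sym// B_Phi// lte_mul_pinfty// ?lee_fin ?invr_ge0 ?ltW//.
Qed.

Let gr_v (t : R) : 0 <= t -> gr (u t) = gr (v t).
Proof.
move=> t0; apply: (green_ae_eq L_inv); [exact: measurable_u|by case: (v_nm t)|].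
by apply: filterS (positive_extensionE t0) => x ->.
Qed.

Let integrable_green f g : nm f -> nm g -> (B Phi g < +oo)%E -> (B f g < +oo)%E ->
  mu.-integrable setT (EFin \o (fun x => f x * gr g x)).
Proof.
move=> nf ng goo fgoo.
have mg : measurable_fun setT (gr g) by apply: (measurable_green L_inv); case: ng.
have mfg : measurable_fun setT (fun x => f x * gr g x).
  by apply: measurable_funM => //; case: nf.
apply/integrableP; split; first exact: measurable_fun_EFin.
apply: le_lt_trans fgoo; rewrite -(integral_green L_inv L_eig G_ge0 nf ng goo).
rewrite le_eqVlt; apply/orP; left; apply/eqP; apply: ae_eq_integral => //.
- by apply: measurableT_comp => //; exact: measurable_fun_EFin.
- exact: measurable_fun_EFin.
- apply: filterS (green_potential L_inv G_ge0 ng) => x gx _ /=.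
  rewrite ger0_norm// gx mulr_ge0 ?fine_ge0//; first by case: nf.
  exact: (potential_ge0 L_inv).
Qed.

(** The test function [th t * chi x] has to be written [eta * Phi1], so [eta] is [th] times
    [c = chi / Phi], bounded because [chi] is dominated. The L^oo norms in the C^1 conditions are
    then at most [n] times the corresponding quantities for [th]. *)
Let weak chi : nm chi -> dominated Phi chi -> forall S, 0 < S -> forall th dth : R -> R,
  (forall t : R, derivable th t 1 /\ derive1 th t = dth t) -> continuous dth ->
  (exists a b : R, [/\ 0 < a, b < S & forall t : R, ~ (a <= t <= b) -> th t = 0]) ->
  \int[leb]_(t in `]0, S[) (fine (B chi (v t)) * dth t) =
  \int[leb]_(t in `]0, S[) (fine (reaction mu m v chi t) * th t).
Proof.
move=> nc [n cn] S S0 th dth Hth cdth [a [b [a0 bS thout]]].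
have B_chi_fin t : B chi (v t) \is a fin_num.
  exact: (B_u_fin K_nm mPhi Phi_gt0 B_sym_dominated lam0 B_Phi v_nm v_L1 t nc (ex_intro _ n cn)).
have [m0 m1] := andP m01.
pose c x := chi x / Phi x.
have mc : measurable_fun setT c.
  have -> : c = (fun x => chi x * Phi x `^ (- 1)).
    by apply/funext => x; rewrite powR_inv1// ltW.
  apply: measurable_funM; first by case: nc.
  exact: (measurableT_comp (measurable_powR _) mPhi).
have cb x : `|c x| <= n%:R.
  rewrite /c ger0_norm; first by rewrite ler_pdivrMr.
  by rewrite divr_ge0 ?(ltW (Phi_gt0 x))//; case: nc.
pose eta t x := th t * c x; pose deta t x := dth t * c x.
have cLoo (r : R) : (fun x => r * c x) \in Lfun mu +oo%E.
  apply: (@bounded_LfunP _ _ _ _ _ (`|r| * n%:R)); first exact: measurable_funM.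
  by apply/nearW => x; rewrite normrM ler_wpM2l.
have Loo_le (r : R) f : (forall x, f x = r * c x) -> (0 <= Loo_norm mu f <= (`|r| * n%:R)%:E)%E.
  move=> fE; rewrite Lnorm_ge0/=; apply: ae_bounded_Loo; first by rewrite mulr_ge0.
  by apply/nearW => x; rewrite fE normrM ler_wpM2l.
have C1 : C1c_Loo mu S eta deta.
  split.
  - by move=> t; split; exact: cLoo.
  - move=> t.
    apply: (@cvge0_squeeze _ _ _ _ _ (fun h : R => `|h^-1 * (th (t + h) - th t) - dth t| * n%:R)).
      by move=> h; apply: Loo_le => x; rewrite /eta /deta; ring.
    apply: cvg_norm_mul0.
    have [dt dE] := Hth t; rewrite derive1E in dE.
    have Hl : h^-1 *: ((th \o shift t) (h *: 1) - th t) @[h --> 0^'] --> dth t.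
      by rewrite -dE; exact: dt.
    apply: cvg_trans Hl; apply: near_eq_cvg; apply: nearW => h /=.
    by rewrite /GRing.scale/= mulr1 [h + t]addrC.
  - move=> t.
    apply: (@cvge0_squeeze _ _ _ _ _ (fun h : R => `|dth h - dth t| * n%:R)).
      by move=> h; apply: Loo_le => x; rewrite /deta /=; ring.
    by apply: cvg_norm_mul0; exact: cdth.
  - exists a, b; split => // t tab; apply/nearW => x _.
    by rewrite /eta thout// mul0r.
have mPhi1 : measurable_fun setT Phi1 by case: L_eig => _ _ _ [_ /Lfun_measurable].
have mrc (r : R) : measurable_fun setT (fun x => r * c x * Phi1 x).
  exact: (measurable_funM (measurable_funM (measurable_cst _) mc) mPhi1).
have chiE : {ae mu, forall x, c x * Phi1 x = chi x}.
  apply: filterS Phi1E => x ->; rewrite /c divfK//.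
  by rewrite gt_eqF.
have l1 t : 0 < t -> \int[mu]_x (gr (u t) x * (deta t x * Phi1 x)) =
    fine (B chi (v t)) * dth t.
  move=> t0; rewrite gr_v ?(ltW t0)//.
  have Bfin : (B Phi (v t) < +oo)%E by apply: B_Phi_lty => //; exact: v_L1.
  rewrite -(pairing_green L_inv L_eig G_ge0 nc (v_nm t) Bfin) mulrC /pairing.
  have mg : measurable_fun setT (gr (v t)) by apply: (measurable_green L_inv); case: (v_nm t).
  have [mchi _] := nc.
  have Icg := integrable_green nc (v_nm t) Bfin (ltac:(by rewrite -ge0_fin_numE ?kform_ge0// B_chi_fin)).
  rewrite -RintegralZl//; apply: ae_eq_Rintegral.
  - exact: (measurable_funM mg (mrc (dth t))).
  - exact: (measurable_funM (measurable_cst _) (measurable_funM mchi mg)).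
  - by apply: filterS chiE => x <-; rewrite /deta; ring.
have l2 t : 0 < t -> \int[mu]_x (spow m (u t) x * (eta t x * Phi1 x)) =
    fine (reaction mu m v chi t) * th t.
  move=> t0; have t0' := ltW t0; have [mchi _] := nc.
  have nvc : nm (fun x => v t x `^ m * chi x) by apply: nm_mul => //; exact: nm_powR.
  have Ivc : mu.-integrable setT (EFin \o (fun x => v t x `^ m * chi x)).
    apply/integrableP; split; first by apply: measurable_fun_EFin; case: nvc.
    have := reaction_fin mPhi Phi_gt0 (weight_integral_lty L_eig) m01 v_nm v_L1 t nc (ex_intro _ n cn).
    rewrite ge0_fin_numE; last by apply: integral_ge0 => x _; rewrite lee_fin; case: nvc.
    apply: le_lt_trans; rewrite le_eqVlt; apply/orP; left; apply/eqP.
    by apply: eq_integral => x _; rewrite /= ger0_norm//; case: nvc.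
  rewrite mulrC -RintegralZl//; apply: ae_eq_Rintegral.
  - have mut := measurable_u t0'.
    have mutm : measurable_fun setT (fun x => `|u t x| `^ (m - 1)).
      by apply: (measurableT_comp (measurable_powR _)); exact: measurableT_comp.
    exact: (measurable_funM (measurable_funM mutm mut) (mrc (th t))).
  - exact: (measurable_funM (measurable_cst _) (proj1 nvc)).
  - apply: filterS2 chiE (filterI (positive_extensionE t0') (u_ge0 t0')) => x <- [-> ux].
    have -> : spow m (u t) x = u t x `^ m.
      rewrite /spow ger0_norm//; move: ux; rewrite le_eqVlt => /predU1P[<-|ux].
        by rewrite mulr0 powR0// gt_eqF.
      rewrite -{2}(powRr1 (ltW ux)) -powRD; first by rewrite subrK.
      by rewrite (gt_eqF ux) implybT.
    by rewrite /eta; ring.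
case: u_sol => _ /(_ S S0)[[_ _ /(_ _ _ C1) W] _ _].
transitivity (\int[leb]_(t in `]0, S[) (\int[mu]_x (gr (u t) x * (deta t x * Phi1 x)))).
  apply: eq_Rintegral => t; rewrite inE/= in_itv/= => /andP[t0 _]; exact/esym/l1.
rewrite W; apply: eq_Rintegral => t; rewrite inE/= in_itv/= => /andP[t0 _]; exact: l2.
Unshelve. all: end_near. Qed.

Let weighted_eq0 f : nm f -> (\int[mu]_x (f x * Phi x)%:E = 0)%E ->
  {ae mu, forall x, f x = 0}.
Proof.
move=> nf f0; have [mfP fP0] := nm_mul nf nP.
have : (\int[mu]_x `|(f x * Phi x)%:E| = 0)%E.
  by rewrite -[RHS]f0; apply: eq_integral => x _; rewrite gee0_abs// lee_fin fP0.
move/(ae_eq_integral_abs mu measurableT (measurable_fun_EFin mfP)).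
apply: filterS => x /(_ Logic.I) [/eqP].
by rewrite mulf_eq0 (gt_eqF (Phi_gt0 x)) orbF => /eqP.
Qed.

Let u0_measurable : measurable_fun setT u0.
Proof. by case: u_sol => -[]. Qed.

(** The datum enters only as the limit at [0] from the right. Continuity of the solution at [0]
    identifies this limit with [u 0]. *)
Lemma initial_value : {ae mu, forall x, u 0 x = u0 x}.
Proof.
have mD : measurable_fun setT (fun x => `|u 0 x - u0 x|).
  by apply: measurableT_comp => //; apply: measurable_funB => //; exact: measurable_u.
have nD : nm (fun x => `|u 0 x - u0 x|) by split.
have := weighted_eq0 nD.
suff -> : (\int[mu]_x (`|u 0 x - u0 x| * Phi x)%:E = 0)%E.
  by move=> /(_ erefl); apply: filterS => x /eqP; rewrite normr_eq0 subr_eq0 => /eqP.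
apply/eqP; rewrite eq_le; apply/andP; split; last first.
  by apply: integral_ge0 => x _; rewrite lee_fin mulr_ge0// ltW.
apply/lee_addgt0Pr => e e0; rewrite add0e.
case: u_sol => _ /(_ 1 ltr01)[_ cont ini].
have e20 : 0 < e / 2 by rewrite divr_gt0.
have := cont 0; rewrite /= in_itv/= lexx ltr01 => /(_ isT)[_].
move/(cvge0_near _ e20); rewrite near_withinE => -[d1 /= d10 H1].
move: ini => /(cvge0_near _ e20); rewrite near_withinE => -[d2 /= d20 H2].
pose t := Num.min (Num.min d1 d2) 1 / 2.
have min0 : 0 < Num.min (Num.min d1 d2) 1 by rewrite !lt_min d10 d20 ltr01.
have t0 : 0 < t by rewrite divr_gt0.
have tlt : t < Num.min (Num.min d1 d2) 1 by rewrite /t ltr_pdivrMr// ltr_pMr// ltr1n.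
move: tlt; rewrite !lt_min => /andP[/andP[td1 td2] t1].
have h1 : (wnorm mu Phi1 (u t \- u 0)%R < (e / 2)%:E)%E.
  apply: H1; first by rewrite /ball_/= sub0r normrN gtr0_norm.
  by rewrite in_itv/= t1 ltW.
have h2 : (wnorm mu Phi1 (u t \- u0)%R < (e / 2)%:E)%E.
  by apply: H2 => //; rewrite /ball_/= sub0r normrN gtr0_norm.
have [mt m0'] := (measurable_u (ltW t0), measurable_u (lexx 0)).
rewrite wnormE in h1; last exact: measurable_funB.
rewrite wnormE in h2; last exact: measurable_funB.
rewrite [e]splitr EFinD; apply: (le_trans _ (leeD (ltW h1) (ltW h2))).
have mA (g k : E -> R) : measurable_fun setT g -> measurable_fun setT k ->
    measurable_fun setT (fun x => `|g x - k x| * Phi x).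
  move=> mg mk; apply: measurable_funM => //.
  by apply: measurableT_comp => //; exact: measurable_funB.
have P0 x := ltW (Phi_gt0 x).
apply: le_integralD.
- exact: mA.
- exact: mA.
- exact: mA.
- by move=> x; rewrite mulr_ge0.
- by move=> x; rewrite mulr_ge0.
- by move=> x; rewrite mulr_ge0.
- move=> x; rewrite -mulrDl ler_wpM2r//=.
  have -> : u 0 x - u0 x = (u 0 x - u t x) + (u t x - u0 x) by ring.
  by rewrite (distrC (u t x)) ler_normD.
Qed.

Let v0E : {ae mu, forall x, v 0 x = u0 x}.
Proof.
by apply: filterS2 (positive_extensionE (lexx 0)) initial_value => x -> ->.
Qed.

Let p0 : 0 < 1 + m. Proof. by case/andP: m01 => ? ?; lra. Qed.

Let Lp_powR f : measurable_fun setT f ->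
  (Lp_norm mu (1 + m) f `^ (1 + m) = \int[mu]_x (`|f x| `^ (1 + m))%:E)%E.
Proof.
by move=> mf; rewrite /Lp_norm poweR_Lnorm ?gt_eqF//.
Qed.

Lemma power_mass0 : (fine (Lp_norm mu (1 + m) u0) `^ (1 + m))%:E = power_mass mu m v 0.
Proof.
case/andP: (u0_Lp) => _; rewrite inE/= /finite_norm => foo.
have NF : Lp_norm mu (1 + m) u0 \is a fin_num by rewrite ge0_fin_numE ?Lnorm_ge0.
rewrite -poweR_EFin (fineK NF) (Lp_powR u0_measurable); apply: ae_eq_integral => //.
- apply: measurable_fun_EFin; apply: (measurableT_comp (measurable_powR _)).
  exact: measurableT_comp.
- by apply: measurable_fun_EFin; case: (nm_powR (1 + m) (v_nm 0)).
- apply: filterS v0E => x <- _; rewrite ger0_norm//; exact: (v_nm 0).2.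
Qed.

Let A0_fin : (power_mass mu m v 0 < +oo)%E.
Proof. by rewrite -power_mass0 ltry. Qed.

(** The constant sequence [gr f] competes in the infimum defining [energy], with value the pairing
    of [gr f] with [L (gr f) = f]. *)
Let energy_green f : nm f -> dominated Phi f ->
  in_H mu L (gr f) /\ (energy mu L (gr f) <= B f f)%E.
Proof.
move=> nf df; have [C _ fC] := green_bounded L_lin L_inv L_eig G_ge0 nf df.
have foo := dominated_Loo L_eig nf df.
have [d2f Lf] := green_dom L_lin L_inv foo fC.
have eB : (energy mu L (gr f) <= B f f)%E.
  apply: ereal_inf_lbound; exists (fun=> gr f); split => //.
    have -> : gr f \- gr f = cst 0 by apply/funext => x /=; rewrite subrr.
    rewrite /Lp_norm (_ : EFin \o _ = cst 0%E); last by apply/funext.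
    rewrite Lnorm0; first exact: cvg_cst.
    by rewrite eqe pnatr_eq0.
  rewrite is_cvg_limn_einfE; last exact: is_cvg_cst.
  rewrite lim_cst// pairingC (pairing_Lgreen L_lin L_inv)//; first last.
  - exact: (measurable_green L_inv (proj1 nf)).
  - exact: (Loo_Lfun (lexx 1) foo).
  rewrite (pairing_green L_inv L_eig G_ge0)//.
    rewrite fineK//; exact: (kform_dominated_fin L_lin L_inv L_eig G_ge0).
  rewrite ltey_eq (kform_dominated_fin L_lin L_inv L_eig G_ge0)//.
  by exists 1%N => x; rewrite mul1r.
split => //; split; first by case: d2f.
apply: (le_lt_trans eB); rewrite ltey_eq.
by rewrite (kform_dominated_fin L_lin L_inv L_eig G_ge0).
Qed.

(* For [f] a truncation of [v 0], [B f f <= B (v 0) f], which is the pairing of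
   [u0] with [gr f], an element of H of energy at most [B f f]. *)
Let Y0_fin : (B (v 0) (v 0) < +oo)%E.
Proof.
have [C HC] := u0_Hstar.
apply: (@le_lt_trans _ _ (`|C| ^+ 2)%:E); last exact: ltry.
have cv := cvg_kform_trunc (mu := mu) K_nm mPhi Phi_gt0 (v_nm 0) (v_nm 0).
apply: (cvge_to_le cv); apply: nearW => n.
set f := trunc Phi (v 0) n.
have nf : nm f by exact: trunc_nm.
have df : dominated Phi f by exact: trunc_dominated.
have [inH eB] := energy_green nf df.
have [int_ug pair_ug] := HC _ inH.
have Bf : B f f \is a fin_num := kform_dominated_fin L_lin L_inv L_eig G_ge0 nf nf df df.
have dPhi : dominated Phi Phi by exists 1%N => x; rewrite mul1r.
have BPf : (B Phi f < +oo)%E.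
  by rewrite ltey_eq (kform_dominated_fin L_lin L_inv L_eig G_ge0).
have mg : measurable_fun setT (gr f) := measurable_green L_inv (proj1 nf).
have mvg : measurable_fun setT (fun x => v 0 x * gr f x).
  exact: (measurable_funM (proj1 (v_nm 0)) mg).
have Bvf : B (v 0) f \is a fin_num.
  rewrite -(integral_green L_inv L_eig G_ge0 (v_nm 0) nf BPf).
  have -> : (\int[mu]_x (v 0 x * gr f x)%:E = \int[mu]_x (u0 x * gr f x)%:E)%E.
    apply: ae_eq_integral => //.
    - exact: measurable_fun_EFin.
    - apply: measurable_fun_EFin; exact: (measurable_funM u0_measurable mg).
    - by apply: filterS v0E => x ->.
  exact: integrable_fin_num.
have pE : pairing mu u0 (gr f) = fine (B (v 0) f).
  rewrite -(pairing_green L_inv L_eig G_ge0 (v_nm 0) nf BPf).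
  apply: ae_eq_Rintegral => //; first exact: (measurable_funM u0_measurable mg).
  by apply: filterS v0E => x ->.
have le1 : fine (B f f) <= fine (B (v 0) f).
  by apply: fine_le => //; apply: le_kform => // x; exact: trunc_le.
have b0 : 0 <= fine (B (v 0) f) by apply: fine_ge0; exact: kform_ge0.
have a0 : 0 <= fine (B f f) by apply: fine_ge0; exact: kform_ge0.
have eA : fine (energy mu L (gr f)) <= fine (B f f).
  move: eB; rewrite -{1}(fineK Bf); case: (energy mu L (gr f)) => [r||]//=.
(* Absorbing the square root gives the bound [|C| ^ 2], which does not depend on the truncation. *)
have sq : fine (B (v 0) f) <= `|C| * Num.sqrt (fine (B (v 0) f)).
  rewrite pE ger0_norm// in pair_ug; apply: (le_trans pair_ug).
  apply: (@le_trans _ _ (`|C| * Num.sqrt (fine (energy mu L (gr f))))).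
    by rewrite ler_wpM2r ?sqrtr_ge0// ler_norm.
  by rewrite ler_wpM2l// ler_wsqrtr// (le_trans eA).
rewrite -(fineK Bf) lee_fin; apply: (le_trans le1).
exact: le_sqr_of_le_mul_sqrt.
Qed.

Let Phi_int := weight_integral_lty L_eig.

Lemma energy_fin t : 0 <= t -> B (v t) (v t) \is a fin_num.
Proof.
exact: (Hstar_energy_fin K_nm mPhi Phi_gt0 B_sym_dominated lam0 B_Phi Phi_int m01
  v_nm v_L1 v_cont weak Y0_fin).
Qed.

Let power_mass_fin t : 0 <= t -> power_mass mu m v t \is a fin_num.
Proof.
exact: (power_mass_fin_num K_nm mPhi Phi_gt0 B_sym_dominated B_psd_dominated lam0 B_Phi Phi_int
  m01 v_nm v_L1 v_cont weak Y0_fin A0_fin).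
Qed.

Lemma Hstar_normE t : 0 <= t -> Hstar_norm mu G (u t) = (Num.sqrt (fine (B (v t) (v t))))%:E.
Proof.
move=> t0; rewrite /Hstar_norm gr_v//.
have BPv : (B Phi (v t) < +oo)%E by apply: B_Phi_lty => //; exact: v_L1.
have mg : measurable_fun setT (gr (v t)) := measurable_green L_inv (proj1 (v_nm t)).
have -> : (\int[mu]_x (u t x * gr (v t) x)%:E = B (v t) (v t))%E.
  rewrite -(integral_green L_inv L_eig G_ge0 (v_nm t) (v_nm t) BPv).
  apply: ae_eq_integral => //.
  - apply: measurable_fun_EFin; exact: (measurable_funM (measurable_u t0) mg).
  - apply: measurable_fun_EFin; exact: (measurable_funM (proj1 (v_nm t)) mg).
  - by apply: filterS (positive_extensionE t0) => x ->.
by rewrite -{1}(fineK (energy_fin t0)).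
Qed.

Lemma Hstar_norm_initial : Hstar_norm mu G u0 = Hstar_norm mu G (u 0).
Proof.
rewrite /Hstar_norm.
have -> : gr u0 = gr (u 0).
  apply: (green_ae_eq L_inv) => //; first exact: measurable_u.
  by apply: filterS initial_value => x ->.
have mg : measurable_fun setT (gr (u 0)) := measurable_green L_inv (measurable_u (lexx 0)).
congr sqrte; apply: ae_eq_integral => //.
- apply: measurable_fun_EFin; exact: (measurable_funM u0_measurable mg).
- apply: measurable_fun_EFin; exact: (measurable_funM (measurable_u (lexx 0)) mg).
- by apply: filterS initial_value => x ->.
Qed.

Lemma QstarE : Qstar mu G m u0 =
  fine (power_mass mu m v 0) / fine (B (v 0) (v 0)) `^ ((1 + m) / 2).
Proof.
rewrite /Qstar Hstar_norm_initial Hstar_normE// -power_mass0 /=.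
by rewrite sqrtr_powR// fine_ge0// kform_ge0.
Qed.

Let v_extinct : (\int[mu]_x (v T x * Phi x)%:E = 0)%E.
Proof.
case: u_ext => -[T0 /(_ T (lexx T)) uT] _.
transitivity (\int[mu]_x (cst 0%E x : \bar R))%E; last by rewrite integral0.
apply: ae_eq_integral => //.
- by apply: measurable_fun_EFin; case: (nm_mul (v_nm T) nP).
- apply: filterS2 (positive_extensionE T0) uT => x -> /(_ Logic.I) -> _.
  by rewrite mul0r.
Qed.

Let v_extinct_min t : 0 <= t ->
  (forall r : R, t <= r -> (\int[mu]_x (v r x * Phi x)%:E = 0)%E) -> T <= t.
Proof.
move=> t0 H; case: u_ext => _; apply; split => // r tr.
have r0 : 0 <= r by exact: le_trans tr.
have := weighted_eq0 (v_nm r) (H r tr).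
by apply: filterS2 (positive_extensionE r0) => x -> ->.
Qed.

Let powR_rootK (x : R) : 0 <= x -> (x `^ (1 - m)) `^ (1 / (1 - m)) = x.
Proof.
move=> x0; have m1 : 0 < 1 - m by case/andP: m01 => _; rewrite subr_gt0.
by rewrite -powRrM mulrC divfK ?gt_eqF// powRr1.
Qed.

Let rootm_ge0 : 0 <= 1 / (1 - m).
Proof. by rewrite divr_ge0// subr_ge0; case/andP: m01 => _ /ltW. Qed.

Let powR_root (x y : R) : 0 <= x -> x `^ (1 - m) <= y -> x <= y `^ (1 / (1 - m)).
Proof.
move=> x0 xy; rewrite -[leLHS]powR_rootK//.
by rewrite ge0_ler_powR ?nnegrE ?powR_ge0// (le_trans _ xy) ?powR_ge0.
Qed.

Let powR_root_ge (x y : R) : 0 <= x -> 0 <= y -> y <= x `^ (1 - m) ->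
  y `^ (1 / (1 - m)) <= x.
Proof.
move=> x0 y0 xy; rewrite -[leRHS]powR_rootK//.
by rewrite ge0_ler_powR ?nnegrE ?powR_ge0.
Qed.

(** [Y ^ ((1 - m) / 2)] is the norm to the power [1 - m]; the root of order [1 - m] turns the factor
    [1 - m] of the energy estimate into the constant [(1 - m) ^ (1 / (1 - m))]. *)
Lemma Hstar_norm_upper t : 0 <= t < T ->
  (Hstar_norm mu G (u t) <= ((1 - m) `^ (1 / (1 - m)) * Qstar mu G m u0 `^ (1 / (1 - m)) *
        (T - t) `^ (1 / (1 - m)))%:E)%E.
Proof.
move=> tT; have /andP[t0 tT'] := tT.
have Tt : 0 <= T - t by rewrite subr_ge0 ltW.
have m1 : 0 <= 1 - m by case/andP: m01 => _ /ltW; rewrite subr_ge0.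
have Q0 : 0 <= Qstar mu G m u0 by rewrite /Qstar divr_ge0// powR_ge0.
have mQ0 : 0 <= (1 - m) * Qstar mu G m u0 by exact: mulr_ge0.
rewrite Hstar_normE// lee_fin -!powRM//.
apply: powR_root; first exact: sqrtr_ge0.
rewrite sqrtr_powR; last by rewrite fine_ge0// kform_ge0.
rewrite QstarE.
exact: (Hstar_energy_upper K_nm mPhi Phi_gt0 B_sym_dominated B_psd_dominated lam0 B_Phi
  Phi_int m01 v_nm v_L1 v_cont weak Y0_fin A0_fin v_extinct v_extinct_min tT).
Qed.

(* [z ^ q <= d ^ q + d ^ (q - p) z ^ p] for every [d > 0] replaces Hoelder's inequality. *)
Lemma Lp_norm_le (q d : R) f : 1 <= q -> q <= 1 + m -> 0 < d -> nm f ->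
  (\int[mu]_x (f x `^ (1 + m))%:E <= (d `^ (1 + m))%:E)%E ->
  (Lp_norm mu q f <= (d * (fine (mu setT) + 1) `^ q^-1)%:E)%E.
Proof.
move=> q1 qp d0 nf fp; have q0 : 0 < q by exact: lt_le_trans q1.
have muF : mu setT \is a fin_num by exact: fin_num_measure.
have mu0 : 0 <= fine (mu setT) by rewrite fine_ge0.
have pw (z : R) : 0 <= z -> z `^ q <= d `^ q + d `^ (q - (1 + m)) * z `^ (1 + m).
  move=> z0; case: (leP z d) => zd.
    apply: (@le_trans _ _ (d `^ q)).
      by rewrite ge0_ler_powR ?nnegrE// ltW.
    by rewrite lerDl mulr_ge0 ?powR_ge0.
  have z0' : 0 < z by exact: lt_trans zd.
  have -> : z `^ q = z `^ (q - (1 + m)) * z `^ (1 + m).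
    by rewrite -powRD ?subrK// (gt_eqF z0') implybT.
  rewrite ler_wpDl ?powR_ge0// ler_wpM2r ?powR_ge0//.
  have -> : q - (1 + m) = - (1 + m - q) by ring.
  rewrite !powRN lef_pV2 ?posrE ?powR_gt0// ge0_ler_powR ?nnegrE ?(ltW d0) ?(ltW z0')//.
    by rewrite subr_ge0.
  exact: ltW.
have nc : nm (fun=> d `^ q) by exact: nm_cst (powR_ge0 _ _).
have np : nm (fun x => f x `^ (1 + m)) by exact: nm_powR.
have ndp : nm (fun x => d `^ (q - (1 + m)) * f x `^ (1 + m)) by apply: nmZ => //; exact: powR_ge0.
have nq : nm (fun x => f x `^ q) by exact: nm_powR.
(* The constant term contributes [d ^ q] times the total mass, and the other one at most
   [d ^ (q - (1 + m)) * d ^ (1 + m) = d ^ q]; hence the total mass plus one. *)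
have Iq : (\int[mu]_x (f x `^ q)%:E <= (d `^ q * (fine (mu setT) + 1))%:E)%E.
  apply: (le_trans (le_integralD mu (proj1 nq) (proj1 nc) (proj1 ndp) (proj2 nq)
    (proj2 nc) (proj2 ndp) _)); first by move=> x; apply: pw; exact: nf.2.
  rewrite mulrDr mulr1 EFinD; apply: leeD.
    by rewrite integral_cst// EFinM fineK.
  under eq_integral do rewrite EFinM.
  rewrite ge0_integralZl_EFin ?powR_ge0//; last 2 first.
  - by move=> x _; rewrite lee_fin powR_ge0.
  - by apply: measurable_fun_EFin; case: np.
  apply: (@le_trans _ _ ((d `^ (q - (1 + m)))%:E * (d `^ (1 + m))%:E)%E).
    by rewrite lee_wpmul2l// lee_fin powR_ge0.
  by rewrite -EFinM lee_fin -powRD ?subrK// (gt_eqF d0) implybT.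
have -> : (d * (fine (mu setT) + 1) `^ q^-1)%:E = (((d `^ q * (fine (mu setT) + 1))%:E) `^ q^-1)%E.
  rewrite poweR_EFin powRM ?powR_ge0//; last by rewrite addr_ge0.
  by rewrite -powRrM mulfV ?gt_eqF// powRr1// ltW.
rewrite /Lp_norm unlock /Lnorm.
have -> : (\int[mu]_x (`|(EFin \o f) x| `^ q) = \int[mu]_x (f x `^ q)%:E)%E.
  apply: eq_integral => x _.
  by rewrite -[(EFin \o f) x]/((f x)%:E) gee0_abs ?poweR_EFin// lee_fin; exact: nf.2.
apply: gt0_ler_poweR => //.
- by rewrite invr_ge0 ltW.
- by rewrite in_itv/= leey andbT; apply: integral_ge0 => x _; rewrite lee_fin powR_ge0.
- by rewrite in_itv/= leey andbT lee_fin mulr_ge0 ?powR_ge0// addr_ge0.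
Qed.

(** The Hardy-Littlewood-Sobolev inequality in L^q and the passage from L^q to L^(1+m) on a set of
    finite measure bound the dual norm by [M] times the L^(1+m) norm. The quotient is therefore at
    least [1 / M ^ (1 + m)], the constant fed to the lower energy estimate. *)
Lemma Hstar_norm_lower (q H t : R) : 1 <= q -> q <= 1 + m ->
  (forall f, f \in Lfun mu q%:E -> (Hstar_norm mu G f <= H%:E * Lp_norm mu q f)%E) ->
  0 <= t < T -> forall M : R, M = Num.max H 1 * (fine (mu setT) + 1) `^ q^-1 ->
  ((((1 - m) / M `^ (1 + m)) `^ (1 / (1 - m)) * (T - t) `^ (1 / (1 - m)))%:E <=
    Hstar_norm mu G (u t))%E.
Proof.
move=> q1 qp HLS tT M ME; have /andP[t0 tT'] := tT.
have Tt : 0 <= T - t by rewrite subr_ge0 ltW.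
have m1 : 0 <= 1 - m by case/andP: m01 => _ /ltW; rewrite subr_ge0.
have mu0 : 0 <= fine (mu setT) by rewrite fine_ge0.
have Hm0 : 0 < Num.max H 1 by rewrite lt_max ltr01 orbT.
have M0 : 0 < M by rewrite ME mulr_gt0// powR_gt0// ltr_wpDl.
have Mp0 : 0 < M `^ (1 + m) by exact: powR_gt0.
rewrite Hstar_normE// lee_fin -powRM//; last by rewrite divr_ge0// ltW.
apply: powR_root_ge; [exact: sqrtr_ge0|by rewrite mulr_ge0// divr_ge0// ltW|].
rewrite sqrtr_powR; last by rewrite fine_ge0// kform_ge0.
apply: (Hstar_energy_lower K_nm mPhi Phi_gt0 B_sym_dominated B_psd_dominated lam0 B_Phi
  Phi_int m01 v_nm v_L1 v_cont weak Y0_fin A0_fin v_extinct v_extinct_min _ _ tT).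
  by rewrite invr_ge0 ltW.
move=> r /andP[r0 rT].
set A := power_mass mu m v r; set Y := B (v r) (v r).
have AF : A \is a fin_num by exact: power_mass_fin.
have A0 : 0 <= fine A.
  by rewrite fine_ge0//; apply: integral_ge0 => x _; rewrite lee_fin powR_ge0.
have Y0 : 0 <= fine Y by rewrite fine_ge0// kform_ge0.
pose a := fine A `^ (1 + m)^-1; have a0 : 0 <= a by exact: powR_ge0.
have aA : a `^ (1 + m) = fine A by rewrite /a -powRrM mulVf ?gt_eqF// powRr1.
have ya : Num.sqrt (fine Y) <= M * a.
  apply/ler_addgt0Pr => e e0.
  (* [Lp_norm_le] asks for a positive level, while [a] may be [0]; the excess [e / M] costs [e]
     after multiplication by [M]. *)
  have d0 : 0 < e / M by rewrite divr_gt0.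
  have ad0 : 0 < a + e / M by rewrite ltr_wpDl.
  have LN : (Lp_norm mu q (v r) <= ((a + e / M) * (fine (mu setT) + 1) `^ q^-1)%:E)%E.
    apply: Lp_norm_le => //; rewrite -[X in (X <= _)%E]/A -(fineK AF) lee_fin -aA.
    by rewrite ge0_ler_powR ?nnegrE// ?(ltW p0) ?(ltW ad0)// lerDl ltW.
  have uvE : Lp_norm mu q (u r) = Lp_norm mu q (v r).
    have q0 : 0 < q by exact: lt_le_trans q1.
    rewrite /Lp_norm unlock /Lnorm; congr (_ `^ _)%E; apply: ae_eq_integral => //.
    - apply: (measurableT_comp (measurable_poweR _)).
      by apply: measurableT_comp => //; apply: measurable_fun_EFin; exact: measurable_u.
    - apply: (measurableT_comp (measurable_poweR _)).
      by apply: measurableT_comp => //; apply: measurable_fun_EFin; case: (v_nm r).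
    - by apply: filterS (positive_extensionE r0) => x /= ->.
  have uLq : u r \in Lfun mu q%:E.
    apply/andP; rewrite !inE; split; first exact: measurable_u.
    by rewrite /= /finite_norm -/(Lp_norm mu q (u r)) uvE (le_lt_trans LN)// ltry.
  have := HLS _ uLq; rewrite Hstar_normE// uvE => h.
  rewrite -lee_fin; apply: (le_trans h).
  have N0 : (0 <= Lp_norm mu q (v r))%E by exact: Lnorm_ge0.
  apply: (@le_trans _ _ ((Num.max H 1)%:E * Lp_norm mu q (v r))%E).
    by rewrite lee_wpmul2r// lee_fin le_max lexx.
  apply: (@le_trans _ _ ((Num.max H 1)%:E * ((a + e / M) * (fine (mu setT) + 1) `^ q^-1)%:E)%E).
    by rewrite lee_wpmul2l// lee_fin ltW.
  rewrite -EFinM lee_fin.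
  have -> : Num.max H 1 * ((a + e / M) * (fine (mu setT) + 1) `^ q^-1) = M * (a + e / M).
    by rewrite ME; ring.
  by rewrite mulrDr [M * (e / M)]mulrC divfK ?gt_eqF.
rewrite mulrC ler_pdivrMr// -sqrtr_powR// -aA -powRM ?(ltW M0)//.
rewrite mulrC ge0_ler_powR ?nnegrE ?sqrtr_ge0 ?(ltW p0)//.
by rewrite mulr_ge0// ltW.
Qed.

End solution.

Theorem proposition5 (R : realType) (N : nat) (s m : R)
    (Omega : set 'rV[R]_N) (oOmega : open Omega) :
  let mu := lebesgue_on oOmega in
  (1 <= N)%N -> 0 < s <= 1 -> 2 * s < N%:R ->
  bounded_C2alpha_domain Omega ->
  0 < m < 1 ->
  exists2 c0 : R -> R, (forall H, 0 < c0 H) &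
  forall (L : operator R N) (G : 'rV[R]_N -> 'rV[R]_N -> R)
    (lambda1 : R) (Phi1 : 'rV[R]_N -> R) (u0 : 'rV[R]_N -> R)
    (u : R -> 'rV[R]_N -> R) (T : R),
  densely_defined_linear mu L ->
  selfadjoint_nonneg mu L ->
  inverse_kernel mu L G ->
  first_eigenpair mu L lambda1 Phi1 ->
  m_accretive mu L ->
  sub_markovian mu L ->
  u0 \in Lfun mu (1 + m)%:E ->
  in_Hstar mu L u0 ->
  WDS_CDP mu Phi1 G m u0 u ->
  (forall t, 0 <= t -> {ae mu, forall x, 0 <= u t x}) ->
  extinction_time mu u T ->
  0 < T ->
  green_bound Omega s G ->
  let c1 := (1 - m) `^ (1 / (1 - m)) in
  (forall t, 0 <= t < T ->
    (Hstar_norm mu G (u t) <=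
      (c1 * Qstar mu G m u0 `^ (1 / (1 - m)) *
        (T - t) `^ (1 / (1 - m)))%:E)%E) /\
  ((N%:R - 2 * s) / (N%:R + 2 * s) < m ->
    forall H : R, HLS_constant mu G s H ->
    forall t, 0 <= t < T ->
    ((c0 H * (T - t) `^ (1 / (1 - m)))%:E <= Hstar_norm mu G (u t) <=
      (c1 * Qstar mu G m u0 `^ (1 / (1 - m)) *
        (T - t) `^ (1 / (1 - m)))%:E)%E).
Proof.
move=> mu N1 s01 sN [_ _ bO _] m01.
pose muF := lebesgue_on_finite oOmega (bounded_lebesgue_rV bO (open_measurable_rV oOmega)).
pose q : R := 2 * N%:R / (N%:R + 2 * s).
(* [Num.max H 1] because a constant [H] in the inequality may be [0]. *)
pose M (H : R) := Num.max H 1 * (fine (muF setT) + 1) `^ q^-1.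
have M0 H : 0 < M H.
  rewrite mulr_gt0 ?powR_gt0//; first by rewrite lt_max ltr01 orbT.
  by rewrite ltr_wpDl// fine_ge0.
have m1 : 0 < 1 - m by case/andP: m01 => _; rewrite subr_gt0.
(* The constant is chosen before the operator, its kernel and the solution; [Omega] enters it
   through its measure. *)
exists (fun H => ((1 - m) / M H `^ (1 + m)) `^ (1 / (1 - m))).
  by move=> H; rewrite powR_gt0// divr_gt0// powR_gt0.
move=> L G lambda1 Phi1 u0 u T Llin Lsa Linv Leig _ _ u0L u0H sol uge0 ext T0 Gb.
have G0 : {ae muF, forall x, {ae muF, forall y, 0 <= G x y}}.
  have [c _ Gc] := Gb.
  apply: ae_ae_lebesgue_on; apply: filterS Gc => z h h1 h2.
  by case/andP: (h h1 h2).
have up t : 0 <= t < T -> _ :=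
  @Hstar_norm_upper R N muF L G lambda1 Phi1 Llin Lsa Linv Leig G0 m T u0 u m01 u0L u0H
    sol uge0 ext t.
split; first exact: up.
move=> msm H HLS t tT; apply/andP; split; last exact: up.
have [s0 s1] := andP s01.
have Ns : 0 < N%:R + 2 * s by rewrite addr_gt0 ?mulr_gt0// ltr0n.
apply: (@Hstar_norm_lower R N muF L G lambda1 Phi1 Llin Lsa Linv Leig G0 m T u0 u m01 u0L u0H
    sol uge0 ext q H t) => //.
(* [1 <= q] amounts to [2 * s <= N], and [q <= 1 + m] to [(N - 2 * s) / (N + 2 * s) <= m]: the
   critical exponent is the one at which L^(1+m) still embeds into L^q. *)
- by rewrite /q ler_pdivlMr// mul1r; lra.
- move: msm; rewrite /q ltr_pdivrMr// ler_pdivrMr//; lra.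
Qed.
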